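(* Assume (A1) (see context). Let $[\eta,\theta]$ be the solution of the system (S)$_\varepsilon$ (see context), and assume (A2) $\partial_t^l\partial_x^m\eta,\ \partial_t^l\partial_x^m\theta\in C(\overline Q)$ for $0\le l\le1$, $0\le m\le2$, $l+m\le2$; (A3) $\partial_t\eta$, $\partial_x^2\eta$, $\partial_t\theta$, $\partial_x^2\theta$ are Hölder continuous functions of order $\sigma\in(0,1)$. For $K,N\in\mathbb N$ let $\Delta x=1/K$, $\Delta t=T/N$, and let $\{(\boldsymbol H^{(j)},\boldsymbol\Theta^{(j)})\}_{j=0}^N$ be a solution of the scheme (Sch) (see context) started from $H_k^{(0)}=\tilde\eta(0,k\Delta x)$, $\Theta_k^{(0)}=\tilde\theta(0,k\Delta x)$ ($k=-1,0,\dots,K+1$). Let $C_1$ be a constant, the same for all meshes under consideration, with $$\max_{0\le j\le N}\ \max_{0\le k\le K}\ \max\{|H_k^{(j)}|,\ |\eta(j\Delta t,k\Delta x)|\}\le C_1 ,$$ and put $a:=\max\{2(\kappa C_1/\nu)^2-(2\kappa\varepsilon+c),\ (L_{\alpha_0}+1)/\delta_0\}$. Assume $$\Delta t<\frac{\nu^2\varepsilon^2}{4\kappa^2\delta_0(\delta_0+\frac12)^2}(\Delta x)^2\qquad\text{and}\qquad\Delta t<\frac1{3a}.$$ Then there exists a constant $C$, independent of $k$ and $j$ and of $\Delta x$ and $\Delta t$, such that $$\|\boldsymbol e_\eta^{(j)}\|_{L^2_{\mathrm d}}\le C\bigl((\Delta x)^\sigma+(\Delta t)^\sigma+\Delta t+\Delta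 x+(\Delta x)^2\bigr)\qquad(j=1,\dots,N),$$ $$\|\boldsymbol e_\theta^{(j)}\|_{L^2_{\mathrm d}}\le C\bigl((\Delta x)^\sigma+(\Delta t)^\sigma+\Delta t+\Delta x+(\Delta x)^2\bigr)\qquad(j=1,\dots,N).$$
   Context: **Setting.** $0<T<\infty$, $\Omega=(0,1)$, $Q=(0,T)\times\Omega$. **(A1).** $\varepsilon\in(0,1)$, $\delta_0\in(0,1)$, $c>0$, $\kappa_0>0$, $\kappa>0$, $\nu>0$ are fixed constants. $\alpha_0:Q\to\mathbb R$ is Lipschitz continuous with Lipschitz constant $L_{\alpha_0}\ge0$ and $\inf\alpha_0(Q)=\delta_0>0$ (the same $\delta_0$; $\alpha_0$ is extended continuously to $\overline Q$). $\gamma_\varepsilon(\vartheta):=\sqrt{\varepsilon^2+|\vartheta|^2}$, so $\gamma_\varepsilon'(\vartheta)=\vartheta/\sqrt{\varepsilon^2+|\vartheta|^2}$. $\alpha(\eta):=\eta^2/2+\delta_0$, so $\alpha'(\eta)=\eta$. The initial data satisfy $[\eta_0,\theta_0]\in[H^1(\Omega)]^2$ and $0\le\eta_0\le1$ a.e. in $\Omega$. **Solution of (S)$_\varepsilon$.** A pair $[\eta,\theta]\in L^2(0,T;[L^2(\Omega)]^2)$ such that: $[\eta,\theta]\in W^{1,2}(0,T;[L^2(\Omega)]^2)\cap L^\infty(0,T;[H^1(\Omega)]^2)$ and $[\eta(0),\theta(0)]=[\eta_0,\theta_0]$ in $[L^2(\Omega)]^2$; and, for a.e. $t\in(0,T)$,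 $$\int_\Omega\bigl(\partial_t\eta(t)+c(\eta(t)-1)+\kappa\alpha'(\eta(t))\gamma_\varepsilon(\partial_x\theta(t))\bigr)\varphi\,dx+\kappa_0^2\int_\Omega\partial_x\eta(t)\partial_x\varphi\,dx=0\quad\forall\varphi\in H^1(\Omega),$$ $$\int_\Omega\alpha_0(t)\partial_t\theta(t)\psi\,dx+\int_\Omega\bigl(\kappa\alpha(\eta(t))\gamma_\varepsilon'(\partial_x\theta(t))+\nu^2\partial_x\theta(t)\bigr)\partial_x\psi\,dx=0\quad\forall\psi\in H^1(\Omega).$$ **Discrete notation.** For a sequence $\{f_k\}$: $\delta_k^+f_k=\frac{f_{k+1}-f_k}{\Delta x}$, $\delta_k^-f_k=\frac{f_k-f_{k-1}}{\Delta x}$, $\delta_k^{\langle1\rangle}f_k=\frac{f_{k+1}-f_{k-1}}{2\Delta x}$, $\delta_k^{\langle2\rangle}f_k=\frac{f_{k+1}-2f_k+f_{k-1}}{(\Delta x)^2}$; $\sum_{k=0}^K{}''f_k:=\frac12f_0+\sum_{k=1}^{K-1}f_k+\frac12f_K$; $\|\boldsymbol f\|_{L^2_{\mathrm d}}:=(\sum_{k=0}^K{}''|f_k|^2\Delta x)^{1/2}$ (only indices $0,\dots,K$ are used, also for vectors indexed by $-1,\dots,K+1$). $\alpha_{0,k}^{(j)}:=\alpha_0(j\Delta t,k\Delta x)$. **Scheme (Sch).** Vectors $\boldsymbol H^{(j)}=(H_k^{(j)})_{k=-1}^{K+1}$, $\boldsymbol\Theta^{(j)}=(\Theta_k^{(j)})_{k=-1}^{K+1}$,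 $j=0,\dots,N$, such that for $j=0,\dots,N-1$ and $k=0,\dots,K$ $$\frac{H_k^{(j+1)}-H_k^{(j)}}{\Delta t}=\kappa_0^2\delta_k^{\langle2\rangle}H_k^{(j+1)}-c(H_k^{(j+1)}-1)-\kappa H_k^{(j+1)}\frac{\gamma_\varepsilon(\delta_k^+\Theta_k^{(j)})+\gamma_\varepsilon(\delta_k^-\Theta_k^{(j)})}{2},$$ $$\alpha_{0,k}^{(j+1)}\frac{\Theta_k^{(j+1)}-\Theta_k^{(j)}}{\Delta t}=\frac\kappa2\Bigl\{\delta_k^+\bigl(\alpha(H_k^{(j+1)})\gamma_\varepsilon'(\delta_k^-\Theta_k^{(j+1)})\bigr)+\delta_k^-\bigl(\alpha(H_k^{(j+1)})\gamma_\varepsilon'(\delta_k^+\Theta_k^{(j+1)})\bigr)\Bigr\}+\nu^2\delta_k^{\langle2\rangle}\Theta_k^{(j+1)},$$ and, for all $j=0,\dots,N$, $\delta_k^{\langle1\rangle}H_k^{(j)}=0$ and $\delta_k^{\langle1\rangle}\Theta_k^{(j)}=0$ for $k=0,K$ (i.e. $H_{-1}^{(j)}=H_1^{(j)}$, $H_{K+1}^{(j)}=H_{K-1}^{(j)}$, and likewise for $\Theta$). Here $\delta_k^+(\alpha(H_k)\gamma_\varepsilon'(\delta_k^-\Theta_k))=\frac1{\Delta x}\bigl[\alpha(H_{k+1})\gamma_\varepsilon'(\tfrac{\Theta_{k+1}-\Theta_k}{\Delta x})-\alpha(H_k)\gamma_\varepsilon'(\tfrac{\Theta_k-\Theta_{k-1}}{\Delta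 x})\bigr]$, and similarly for the other term. **Extension and errors.** $\tilde\eta$ is the even reflection extension of $\eta$ to $[0,T]\times[-\Delta x,1+\Delta x]$: $\tilde\eta(t,x)=\eta(t,-x)$ for $-\Delta x\le x<0$, $\eta(t,x)$ for $0\le x\le1$, $\eta(t,2-x)$ for $1<x\le1+\Delta x$; $\tilde\theta$ is defined similarly from $\theta$. $e_{\eta,k}^{(j)}:=H_k^{(j)}-\tilde\eta(j\Delta t,k\Delta x)$, $e_{\theta,k}^{(j)}:=\Theta_k^{(j)}-\tilde\theta(j\Delta t,k\Delta x)$ for $k=-1,\dots,K+1$, $j=0,\dots,N$; $\boldsymbol e_\eta^{(j)}=(e_{\eta,k}^{(j)})_{k=-1}^{K+1}$, $\boldsymbol e_\theta^{(j)}=(e_{\theta,k}^{(j)})_{k=-1}^{K+1}$. *)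

(* Defs.v *)
From HB Require Import structures.
From mathcomp Require Import all_boot all_order all_algebra.
From mathcomp Require Import all_classical all_reals all_analysis.

Set Implicit Arguments.
Unset Strict Implicit.
Unset Printing Implicit Defensive.

Import Order.TTheory GRing.Theory Num.Theory.
Import numFieldNormedType.Exports.

Local Open Scope classical_set_scope.
Local Open Scope ring_scope.

(* Functions on space-time are functions of the pair (t, x); elements of
   Lebesgue, Sobolev and Bochner spaces are represented by functions, all
   identifications being almost everywhere for the Lebesgue measure. *)

Section Domains.
Context {R : realType}.

Definition Omega : set R := `]0, 1[.
Definition Qopen (T : R) : set (R * R) := `]0, T[ `*` Omega.
Definition Qbar (T : R) : set (R * R) := `[0, T] `*` `[0, 1].

End Domains.

Section FunctionSpaces.
Context {R : realType}.

Notation mu := (@lebesgue_measure R).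

Definition L2 d (X : measurableType d) (m : {measure set X -> \bar R})
    (D : set X) (f : X -> R) : Prop :=
  measurable_fun D f /\ m.-integrable D (fun x => ((f x) ^+ 2)%:E).

Definition L2Q (T : R) (u : R * R -> R) : Prop :=
  L2 (mu \x mu)%E (Qopen T) u.

(* C_c^oo(]a, b[) *)
Definition test_function (a b : R) (z : R -> R) : Prop :=
  (forall (n : nat) (x : R), derivable (derive1n n z) x 1) /\
  (exists a' b' : R, [/\ a < a', b' < b &
     forall x : R, x \notin `[a', b'] -> z x = 0]).

(* u \in H^1(Omega) with weak derivative v *)
Definition H1_deriv (u v : R -> R) : Prop :=
  [/\ L2 mu Omega u, L2 mu Omega v &
    forall z : R -> R, test_function 0 1 z ->
      (\int[mu]_(x in Omega) (u x * derive1 z x) =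
       - \int[mu]_(x in Omega) (v x * z x))%R].

Definition H1 (u : R -> R) : Prop := exists v : R -> R, H1_deriv u v.

(* u \in W^{1,2}(0, T; L^2(Omega)) with weak time derivative ut.  The space
   L^2(0, T; L^2(Omega)) is identified with L^2(Q), and the Bochner integral
   over ]0, T[ of an element of it is computed for almost every x. *)
Definition W12_L2 (T : R) (u ut : R * R -> R) : Prop :=
  [/\ L2Q T u, L2Q T ut &
    forall z : R -> R, test_function 0 T z ->
      {ae mu, forall x, Omega x ->
        (\int[mu]_(t in `]0, T[) (u (t, x) * derive1 z t) =
         - \int[mu]_(t in `]0, T[) (ut (t, x) * z t))%R}].

(* u \in L^oo(0, T; H^1(Omega)) with weak space derivative ux *)
Definition Linfty_H1 (T : R) (u ux : R * R -> R) : Prop :=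
  [/\ measurable_fun (Qopen T) u, measurable_fun (Qopen T) ux &
    exists M : R, {ae mu, forall t, `]0, T[%classic t ->
      H1_deriv (fun x => u (t, x)) (fun x => ux (t, x)) /\
      Num.sqrt ((\int[mu]_(x in Omega) (u (t, x) ^+ 2))%R +
                (\int[mu]_(x in Omega) (ux (t, x) ^+ 2))%R) <= M}].

(* u(0) = u0 in L^2(Omega), where u(0) is the value at 0 of the
   representative w of u in C([0, T]; L^2(Omega)) *)
Definition initial_value (T : R) (u : R * R -> R) (u0 : R -> R) : Prop :=
  exists w : R * R -> R,
  [/\ forall t, `[0, T]%classic t -> L2 mu Omega (fun x => w (t, x)),
      forall t, `[0, T]%classic t ->
        Num.sqrt (\int[mu]_(x in Omega) ((w (s, x) - w (t, x)) ^+ 2))%R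
          @[s --> within `[0, T] (nbhs t)] --> (0 : R),
      {ae mu, forall t, `]0, T[%classic t ->
        {ae mu, forall x, Omega x -> w (t, x) = u (t, x)}} &
      {ae mu, forall x, Omega x -> w (0, x) = u0 x}].

Definition dist2 (p q : R * R) : R :=
  Num.sqrt ((p.1 - q.1) ^+ 2 + (p.2 - q.2) ^+ 2).

Definition lipschitz_with (L : R) (D : set (R * R)) (f : R * R -> R) : Prop :=
  forall p q, D p -> D q -> `|f p - f q| <= L * dist2 p q.

Definition hoelder_continuous (s : R) (D : set (R * R)) (f : R * R -> R) :
    Prop :=
  exists L : R, forall p q, D p -> D q -> `|f p - f q| <= L * (dist2 p q) `^ s.

End FunctionSpaces.

Section ClassicalDerivatives.
Context {R : realType}.

Definition pdt (u : R * R -> R) : R * R -> R :=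
  fun p => derive1 (fun s => u (s, p.2)) p.1.

Definition pdx (u : R * R -> R) : R * R -> R :=
  fun p => derive1 (fun y => u (p.1, y)) p.2.

(* \partial_t^l \partial_x^m u *)
Definition pd (l m : nat) (u : R * R -> R) : R * R -> R :=
  iter l pdt (iter m pdx u).

Definition has_pd (l m : nat) (D : set (R * R)) (u : R * R -> R) : Prop :=
  forall p, D p ->
    (forall i, (i < m)%N ->
       derivable (fun y => iter i pdx u (p.1, y)) p.2 1) /\
    (forall i, (i < l)%N ->
       derivable (fun s => iter i pdt (iter m pdx u) (s, p.2)) p.1 1).

(* u \in C(Qbar), and its derivatives exist classically in Q and have
   continuous extensions to Qbar *)
Definition regular_Qbar (T : R) (u : R * R -> R) : Prop :=
  {within Qbar T, continuous u} /\
  forall l m : nat, (l <= 1)%N -> (m <= 2)%N -> (l + m <= 2)%N ->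
    has_pd l m (Qopen T) u /\
    exists w : R * R -> R, {within Qbar T, continuous w} /\
      (forall p, Qopen T p -> w p = pd l m u p).

End ClassicalDerivatives.

Section System.
Context {R : realType}.

Notation mu := (@lebesgue_measure R).

Definition gam (eps v : R) : R := Num.sqrt (eps ^+ 2 + `|v| ^+ 2).
Definition alp (delta0 e : R) : R := e ^+ 2 / 2 + delta0.

Definition solution_S (T eps delta0 c kappa0 kappa nu : R)
    (alpha0 : R * R -> R) (eta0 theta0 : R -> R)
    (eta theta : R * R -> R) : Prop :=
  exists etat etax thetat thetax : R * R -> R,
  [/\ W12_L2 T eta etat /\ W12_L2 T theta thetat,
      Linfty_H1 T eta etax /\ Linfty_H1 T theta thetax,
      initial_value T eta eta0 /\ initial_value T theta theta0,
      {ae mu, forall t, `]0, T[%classic t ->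
        forall phi dphi : R -> R, H1_deriv phi dphi ->
        (\int[mu]_(x in Omega)
           ((etat (t, x) + c * (eta (t, x) - 1)
             + kappa * derive1 (alp delta0) (eta (t, x)) * gam eps (thetax (t, x)))
            * phi x))%R
        + kappa0 ^+ 2 * (\int[mu]_(x in Omega) (etax (t, x) * dphi x))%R
        = 0} &
      {ae mu, forall t, `]0, T[%classic t ->
        forall psi dpsi : R -> R, H1_deriv psi dpsi ->
        (\int[mu]_(x in Omega) (alpha0 (t, x) * thetat (t, x) * psi x))%R
        + (\int[mu]_(x in Omega)
             ((kappa * alp delta0 (eta (t, x)) * derive1 (gam eps) (thetax (t, x))
               + nu ^+ 2 * thetax (t, x)) * dpsi x))%R
        = 0}].

End System.

Section Scheme.
Context {R : realType}.

(* Grid vectors indexed by k = -1, ..., K + 1 are functions on int, of which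
   only these indices matter; h is the mesh size. *)

Definition dplus (h : R) (f : int -> R) (k : int) : R := (f (k + 1) - f k) / h.
Definition dminus (h : R) (f : int -> R) (k : int) : R := (f k - f (k - 1)) / h.
Definition dcent (h : R) (f : int -> R) (k : int) : R :=
  (f (k + 1) - f (k - 1)) / (2 * h).
Definition dsecond (h : R) (f : int -> R) (k : int) : R :=
  (f (k + 1) - 2 * f k + f (k - 1)) / h ^+ 2.

Definition trapsum (K : nat) (f : int -> R) : R :=
  f 0 / 2 + \sum_(1 <= k < K) f k%:Z + f K%:Z / 2.

Definition L2d (K : nat) (h : R) (f : int -> R) : R :=
  Num.sqrt (trapsum K (fun k => `|f k| ^+ 2 * h)).

Definition scheme_sol (eps delta0 c kappa0 kappa nu : R) (alpha0 : R * R -> R)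
    (K N : nat) (dx dt : R) (H Theta : nat -> int -> R) : Prop :=
  let g := gam eps in
  let g' := derive1 (gam eps) in
  let al := alp delta0 in
  [/\ forall j k : nat, (j < N)%N -> (k <= K)%N ->
        (H j.+1 k%:Z - H j k%:Z) / dt =
          kappa0 ^+ 2 * dsecond dx (H j.+1) k%:Z - c * (H j.+1 k%:Z - 1)
          - kappa * H j.+1 k%:Z *
            ((g (dplus dx (Theta j) k%:Z) + g (dminus dx (Theta j) k%:Z)) / 2),
      forall j k : nat, (j < N)%N -> (k <= K)%N ->
        alpha0 (j.+1%:R * dt, k%:R * dx) *
          ((Theta j.+1 k%:Z - Theta j k%:Z) / dt) =
          kappa / 2 *
            (dplus dx (fun i => al (H j.+1 i) * g' (dminus dx (Theta j.+1) i))
               k%:Z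
             + dminus dx (fun i => al (H j.+1 i) * g' (dplus dx (Theta j.+1) i))
               k%:Z)
          + nu ^+ 2 * dsecond dx (Theta j.+1) k%:Z &
      forall j : nat, (j <= N)%N ->
        [/\ dcent dx (H j) 0 = 0, dcent dx (H j) K%:Z = 0,
            dcent dx (Theta j) 0 = 0 & dcent dx (Theta j) K%:Z = 0]].

(* even reflection at x = 0 and x = 1 *)
Definition refl_ext (u : R * R -> R) : R * R -> R :=
  fun p => if p.2 < 0 then u (p.1, - p.2)
           else if p.2 <= 1 then u p else u (p.1, 2 - p.2).

Definition err (u : R * R -> R) (dx dt : R) (U : nat -> int -> R)
    (j : nat) (k : int) : R :=
  U j k - refl_ext u (j%:R * dt, k%:~R * dx).

End Scheme.

(* Main.v *)
Require Import Defs.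
From HB Require Import structures.
From mathcomp Require Import all_boot all_order all_algebra.
From mathcomp Require Import all_classical all_reals all_analysis.
From mathcomp Require Import measurable_realfun.
From mathcomp Require Import ring lra zify.

(** The solution is classical: since its derivatives are continuous on the closed
cylinder, the weak derivatives in the system agree with the classical ones
([H1_deriv_ae], [W12_L2_ae]), and at almost every time each of the two equations
says that a continuous flux F and a continuous source G satisfy
[int G phi + int F phi' = 0] for all phi in H^1.  Testing with 1 and with a
primitive of F - int G yields F_x = G together with F = 0 at both end points
([natural_flux]).  By continuity this holds at all times, in the integrated form
[flux_balance].  The vanishing of F is what makes the even reflection, that is
the doubling of the boundary fluxes in the scheme, consistent.

The scheme is a system of balances as well: its two-sided differences combine to
one flux per edge of the grid ([dsecond_edge], [average_edge], [flux_edge]), and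
summation by parts with trapezoidal weights leaves no boundary term
([trap_edge_div]).  Subtracting the exact balance over the cell of each node, the
errors e_eta = H - eta and e_theta = Theta - theta satisfy the same difference
equations up to two kinds of residuals, all of them bounded by a constant times
R = h^s + dt^s + dt + h + h^2 with the Hoelder exponent s: a residual at the
nodes, which comes from the time quotient, from freezing the source in its cell
and from the explicit coupling ([eta_residual], [theta_residual]), and a residual
inside the flux, which comes from replacing derivatives at midpoints by
difference quotients ([eta_flux_residual], [theta_flux_residual]).  The latter
need not be divided by h, because it is tested against difference quotients of
the errors.

Testing the two error equations with the errors gives [eta_energy_step] and
[theta_energy_step].  The nonlinear flux is monotone, and the remaining coupling
is the product of one error with the slope of the other one: the first
inequality sees the slope D e_theta at the old time level, the second one at the
new level.  Each time Young's inequality spends a share s of the dissipation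
nu^2 |D e_theta|^2, so that for
[Z = |e_eta|^2 + |sqrt alpha0 e_theta|^2 + s nu^2 dt |D e_theta|^2] the slopes
telescope and
[Z' - Z <= dt (a Z' + a Z + C R^2)].
The damping c > 0 leaves room for a share s < 1 with exactly the rate a of the
statement.  As Z vanishes initially and a dt < 1 / 3, the discrete Gronwall
inequality [discrete_gronwall] gives Z <= C R^2. *)

Import Order.TTheory GRing.Theory Num.Theory.
Import numFieldNormedType.Exports.

Local Open Scope classical_set_scope.
Local Open Scope ring_scope.

Set Implicit Arguments.
Unset Strict Implicit.
Unset Printing Implicit Defensive.

(** * A flat exponential *)

Section PointwiseDerivatives.
Context {R : realType}.
Implicit Types (f g : R -> R) (x df dg k : R).

Lemma is_derive_oppf f x df :
  is_derive x 1 f df -> is_derive x 1 (fun y => - f y) (- df).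
Proof. by move=> H; have := is_deriveN H; rewrite opprfctE. Qed.

Lemma is_derive_addf f g x df dg : is_derive x 1 f df -> is_derive x 1 g dg ->
  is_derive x 1 (fun y => f y + g y) (df + dg).
Proof. by move=> H K; have := is_deriveD H K; rewrite addrfctE. Qed.

Lemma is_derive_mulf f g x df dg : is_derive x 1 f df -> is_derive x 1 g dg ->
  is_derive x 1 (fun y => f y * g y) (df * g x + f x * dg).
Proof.
move=> H K; have := is_deriveM H K; rewrite mulrfctE /GRing.scale /= => L.
by rewrite addrC [df * _]mulrC.
Qed.

Lemma is_derive_scalef f x df k :
  is_derive x 1 f df -> is_derive x 1 (fun y => k * f y) (k * df).
Proof.
move=> H; have := is_derive_mulf (is_derive_cst k x 1) H.
by rewrite mul0r add0r.
Qed.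

Lemma is_derive_affine k c x : is_derive x 1 (fun y => k * (y - c)) k.
Proof.
have := is_derive_scalef k (is_derive_addf (is_derive_id x 1)
  (is_derive_cst (- c) x 1)).
by rewrite addr0 mulr1.
Qed.

Lemma is_derive_continuous f x df : is_derive x 1 f df -> {for x, continuous f}.
Proof. by case=> fx _; apply/differentiable_continuous/derivable1_diffP. Qed.

Lemma is_derive_derive1 f x df : is_derive x 1 f df -> derive1 f x = df.
Proof. by move=> H; rewrite derive1E; exact: derive_val. Qed.

End PointwiseDerivatives.

Section FlatExponential.
Context {R : realType}.
Implicit Types (u v x : R).

(** The functions u ^- n * exp (- 1 / u), continued by 0 to the left, are stable
under differentiation up to linear combinations; this is what makes the bumps
built from them smooth. *)
Definition flat (n : nat) (u : R) : R :=
  if 0 < u then u ^- n * expR (- u^-1) else 0.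

Lemma flat_ge0 n u : 0 <= flat n u.
Proof.
rewrite /flat; case: ifP => // u0.
by rewrite mulr_ge0 ?expR_ge0 // invr_ge0 exprn_ge0 // ltW.
Qed.

(** For n > 0 this is the n-th power of v / n <= exp (v / n). *)
Lemma exprn_le_expR n v : 0 <= v -> v ^+ n <= n%:R ^+ n * expR v.
Proof.
case: n => [|n] v0; first by rewrite expr0 mul1r -[leLHS]expR0 ler_expR.
have n0 : (n.+1%:R : R) != 0 by rewrite pnatr_eq0.
rewrite -[in leLHS](mulVKf n0 v) -[in leRHS](mulVKf n0 v) expRM_natl -exprMn.
rewrite lerXn2r ?nnegrE ?mulr_ge0 ?expR_ge0 ?invr_ge0 ?ler0n //.
rewrite ler_pM2l ?ltr0n // (le_trans _ (expR_ge1Dx _)) // lerDr //.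
Qed.

Lemma flat_bounded n : exists M, forall u, `|flat n u| <= M.
Proof.
exists (n%:R ^+ n) => u; rewrite ger0_norm ?flat_ge0 // /flat.
case: ifP => u0; last by rewrite exprn_ge0.
rewrite expRN ler_pdivrMr ?expR_gt0 // -exprVn.
by apply: exprn_le_expR; rewrite invr_ge0 ltW.
Qed.

(** With the boundedness of all flat functions this identity gives
flat n u = O(u ^ 2) at 0, hence a vanishing derivative there. *)
Lemma flat_sqr n u : flat n u = u ^+ 2 * flat n.+2 u.
Proof.
rewrite /flat; case: ifP => u0; last by rewrite mulr0.
have un0 : u != 0 by rewrite gt_eqF.
rewrite -(addn2 n) exprD invfM mulrA; congr (_ * _).
by rewrite mulrCA divff ?mulr1 // expf_neq0.
Qed.

Lemma is_derive_flat n x :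
  is_derive x 1 (flat n) (flat n.+2 x - n%:R * flat n.+1 x).
Proof.
have [x0|x0|->] := ltgtP x 0.
- have f0 m : flat m x = 0 by rewrite /flat ltNge (ltW x0).
  rewrite !f0 mulr0 subr0.
  apply: (@near_eq_is_derive _ _ _ (cst 0)).
  near=> y; rewrite /flat ifF //; apply/negbTE; rewrite -leNgt.
  by apply: ltW; near: y; exact: lt_nbhsl.
- apply: (@near_eq_is_derive _ _ _ (fun u => u ^- n * expR (- u^-1))).
    near=> y; rewrite /flat ifT //; near: y; exact: lt_nbhsr.
  have xn0 : x != 0 by rewrite gt_eqF.
  have xn : x ^+ n != 0 by rewrite expf_neq0.
  have fE m : flat m x = x ^- m * expR (- x^-1) by rewrite /flat x0.
  rewrite !fE.
  have dX : is_derive x 1 (fun u : R => u ^- n) (- (x ^+ n) ^- 2 * (n%:R * x ^+ n.-1)).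
    have dXn : is_derive x 1 (fun u : R => u ^+ n) (n%:R * x ^+ n.-1).
      have -> : (fun u : R => u ^+ n) = id ^+ n by rewrite exprfctE.
      by apply: is_derive_eq; rewrite /GRing.scale /= mulr1.
    exact: (@is_deriveV R (fun u => u ^+ n) x _ 1 xn dXn).
  have dV : is_derive x 1 (fun u : R => - u^-1) (x ^- 2).
    have := is_derive_oppf (@is_deriveV R id x _ 1 xn0 (is_derive_id x 1)).
    by rewrite /GRing.scale /= mulr1 opprK.
  have dE : is_derive x 1 (fun u : R => expR (- u^-1)) (expR (- x^-1) * x ^- 2).
    exact: (@is_derive1_comp R expR (fun u => - u^-1)).
  have := is_derive_mulf dX dE => H; apply: (is_derive_eq H) => {H}.
  have {}xn : x ^+ n.-1 != 0 by rewrite expf_neq0.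
  case: n {dX fE} xn => [|n] /= xn.
    by rewrite !mul0r !mulr0 mul0r add0r subr0 expr0 invr1 mul1r mulrC.
  rewrite !exprS; move: (x ^+ n) xn => y yn.
  by field; rewrite xn0 yn.
- have [M HM] := flat_bounded n.+2.
  have f0 m : flat m 0 = 0 :> R by rewrite /flat ltxx.
  rewrite !f0 mulr0 subr0.
  suff H : (fun h : R => h^-1 *: (flat n (h *: 1 + 0) - flat n 0)) @ 0^' --> (0 : R).
    by split; [apply/cvg_ex; exists 0 | exact/cvg_lim].
  apply/cvgr0Pnorm_le => e e0.
  have M0 : 0 <= M by rewrite (le_trans _ (HM 0)).
  have eM : 0 < e / (M + 1) by rewrite divr_gt0 // ltr_wpDl.
  near=> h.
  rewrite f0 subr0 /GRing.scale /= mulr1 addr0 flat_sqr.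
  have hn0 : h != 0 by near: h; exact: nbhs_dnbhs_neq.
  rewrite expr2 !mulrA mulVf // mul1r normrM.
  rewrite (@le_trans _ _ (e / (M + 1) * M)) //.
    apply: ler_pM => //.
    near: h; apply: dnbhs0_le => //.
  rewrite -mulrA ler_piMr ?(ltW e0) // mulrC ler_pdivrMr ?ltr_wpDl // mul1r.
  by rewrite lerDl.
Unshelve. all: by end_near. Qed.

End FlatExponential.

(** * Smooth bumps with compact support *)

Section Bumps.
Context {R : realType}.
Implicit Types (c d k x : R).

(** A class of functions that contains the bumps and is stable under
differentiation, so that its members are smooth. *)
Inductive flat_comb c d k : (R -> R) -> Prop :=
| flat_comb_mul m n :
    flat_comb c d k (fun x => flat m (k * (x - c)) * flat n (- k * (x - d)))
| flat_comb_scale r f : flat_comb c d k f -> flat_comb c d k (fun x => r * f x)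
| flat_comb_add f g : flat_comb c d k f -> flat_comb c d k g ->
    flat_comb c d k (fun x => f x + g x).

Lemma flat_comb_derive c d k f : flat_comb c d k f ->
  exists2 g, flat_comb c d k g & forall x, is_derive x 1 f (g x).
Proof.
elim=> [m n|r {}f _ [g gc fg]|f1 f2 _ [g1 gc1 fg1] _ [g2 gc2 fg2]]; last 2 first.
- by exists (fun x => r * g x) => [|x];
    [exact: flat_comb_scale | exact: is_derive_scalef].
- by exists (fun x => g1 x + g2 x) => [|x];
    [exact: flat_comb_add | exact: is_derive_addf].
pose F i j x := flat i (k * (x - c)) * flat j (- k * (x - d)).
exists (fun x => (k * F m.+2 n x + - (k * m%:R) * F m.+1 n x)
               + (- k * F m n.+2 x + (k * n%:R) * F m n.+1 x)) => [|x].
  by do ?apply: flat_comb_add; apply: flat_comb_scale; exact: flat_comb_mul.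
have dc e r j : is_derive x 1 (fun y => flat j (r * (y - e)))
    ((flat j.+2 (r * (x - e)) - j%:R * flat j.+1 (r * (x - e))) * r).
  exact: (@is_derive1_comp R (flat j) (fun y => r * (y - e)) x _ _
    (is_derive_flat _ _) (is_derive_affine _ _ _)).
have := is_derive_mulf (dc c k m) (dc d (- k) n) => H.
by apply: (is_derive_eq H); rewrite /F; ring.
Qed.

Lemma flat_comb_derive1n c d k f n : flat_comb c d k f ->
  flat_comb c d k (derive1n n f).
Proof.
elim: n => // n IH /IH {IH} /flat_comb_derive[g gc fg].
rewrite derive1nS; suff -> : derive1 (derive1n n f) = g by [].
by apply/funext => x; exact: is_derive_derive1.
Qed.

(** The support is [c, d].  As k grows, both factors increase to 1 inside the
support, so the same formula gives smooth approximations of the indicator of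
]c, d[. *)
Definition bump c d k x := flat 0 (k * (x - c)) * flat 0 (- k * (x - d)).

Lemma bump_out c d k x : 0 < k -> x \notin `]c, d[ -> bump c d k x = 0.
Proof.
move=> k0; rewrite in_itv /= negb_and -!leNgt /bump /flat mulNr oppr_gt0.
rewrite pmulr_rgt0 // pmulr_rlt0 // subr_gt0 subr_lt0 !ltNge.
by case/orP => ->; rewrite /= ?mul0r ?mulr0.
Qed.

Lemma bump_test_function a b c d k : a < c -> d < b -> 0 < k ->
  test_function a b (bump c d k).
Proof.
move=> ac db k0; split=> [n x|].
  have /flat_comb_derive[g _ fg] : flat_comb c d k (derive1n n (bump c d k)).
    exact/flat_comb_derive1n/flat_comb_mul.
  by have [] := fg x.
exists c, d; split=> // x xcd; apply: bump_out => //.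
by apply: contra xcd; apply: subset_itv_oo_cc.
Qed.

Lemma flat_le1 u : flat 0 u <= 1 :> R.
Proof.
rewrite /flat; case: ifP => u0 //.
rewrite expr0 invr1 mul1r -[leRHS]expR0 ler_expR oppr_le0 invr_ge0.
exact: ltW.
Qed.

Lemma bump_norm_le1 c d k x : `|bump c d k x| <= 1.
Proof.
rewrite ger0_norm ?mulr_ge0 ?flat_ge0 // /bump.
by rewrite mulr_ile1 ?flat_ge0 ?flat_le1.
Qed.

Lemma bump_cvg_indic c d x :
  bump c d n.+1%:R x @[n --> \oo] --> (\1_`]c, d[%classic x : R).
Proof.
rewrite indicE; case: (boolP (x \in `]c, d[)) => xcd; last first.
  rewrite memNset /= ; last by apply/negP.
  have -> : (fun n => bump c d n.+1%:R x) = cst 0; last exact: cvg_cst.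
  by apply/funext => n; rewrite bump_out.
rewrite mem_set //=; move: xcd; rewrite in_itv /= => /andP[cx xd].
have flat1 u : 0 < u -> flat 0 (n.+1%:R * u) @[n --> \oo] --> (1 : R).
  move=> u0.
  have -> : (fun n => flat 0 (n.+1%:R * u)) = expR \o (fun n => - (u^-1 * n.+1%:R^-1)).
    apply/funext => n /=.
    by rewrite /flat mulr_gt0 // expr0 invr1 mul1r invfM mulrC.
  rewrite -[X in _ --> X]expR0; apply: continuous_cvg; first exact: continuous_expR.
  rewrite -[X in _ --> X]oppr0 -(mulr0 u^-1); apply: cvgN; apply: cvgM; first exact: cvg_cst.
  exact: cvg_harmonic.
rewrite -[X in _ --> X]mulr1; apply: cvgM; first by apply: flat1; rewrite subr_gt0.
under eq_fun do rewrite mulNr -mulrN opprB.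
by apply: flat1; rewrite subr_gt0.
Qed.

Lemma test_function_continuous a b (z : R -> R) n : test_function a b z ->
  continuous (derive1n n z).
Proof.
by case=> zd _ x; apply/differentiable_continuous/derivable1_diffP/zd.
Qed.

End Bumps.

(** * Integration by parts and vanishing against bumps *)

Section FundamentalLemma.
Context {R : realType}.
Notation mu := (@lebesgue_measure R).
Implicit Types (a b x : R) (f g u v w z : R -> R).

Lemma continuous_integrable_oo a b f : continuous f ->
  mu.-integrable `]a, b[ (EFin \o f).
Proof.
move=> cf; apply: (@integrableS _ _ _ mu `[a, b]) => //.
  exact: subset_itv_oo_cc.
apply: continuous_compact_integrable; first exact: segment_compact.
exact: continuous_subspaceT.
Qed.

Lemma Rintegral_oo_cc a b f : mu.-integrable `]a, b[ (EFin \o f) ->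
  \int[mu]_(x in `]a, b[) f x = \int[mu]_(x in `[a, b]) f x.
Proof.
move=> intf; rewrite /Rintegral (@integral_itv_bndoo _ a b (EFin \o f) true false) //.
by case/integrableP: intf.
Qed.

Lemma Rintegral_derivative a b u w : a < b -> continuous u -> continuous w ->
  (forall x, x \in `]a, b[ -> is_derive x 1 u (w x)) ->
  \int[mu]_(x in `]a, b[) w x = u b - u a.
Proof.
move=> ab cu cw uw; rewrite Rintegral_oo_cc; last exact: continuous_integrable_oo.
rewrite /Rintegral (@continuous_FTC2 _ w u) //.
- exact: continuous_subspaceT.
- split.
  + by move=> x xab; have [] := uw x xab.
  + exact: cvg_at_right_filter (cu a).
  + exact: cvg_at_left_filter (cu b).
- by move=> x xab; exact: is_derive_derive1 (uw x xab).
Qed.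

Lemma Rintegral_by_parts_oo a b u w v z : a < b ->
  continuous u -> continuous w -> continuous v -> continuous z ->
  (forall x, x \in `]a, b[ -> is_derive x 1 u (w x)) ->
  (forall x, x \in `]a, b[ -> is_derive x 1 v (z x)) ->
  \int[mu]_(x in `]a, b[) (u x * z x) =
  u b * v b - u a * v a - \int[mu]_(x in `]a, b[) (w x * v x).
Proof.
move=> ab cu cw cv cz uw vz.
have cM f g : continuous f -> continuous g -> continuous (fun x => f x * g x).
  by move=> cf cg x; apply: continuousM; [exact: cf|exact: cg].
apply/eqP; rewrite eq_sym subr_eq eq_sym addrC -RintegralD //;
  do ?by apply: continuous_integrable_oo; exact: cM.
apply/eqP; apply: (@Rintegral_derivative a b (fun x => u x * v x)) => //.
- exact: cM.
- by move=> x; apply: cvgD; [exact: (cM _ _ cw cv)|exact: (cM _ _ cu cz)].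
- by move=> x xab; apply: is_derive_mulf; [exact: uw|exact: vz].
Qed.

Lemma Rintegral_by_parts_test a b u w z : a < b ->
  continuous u -> continuous w ->
  (forall x, x \in `]a, b[ -> is_derive x 1 u (w x)) ->
  test_function a b z ->
  \int[mu]_(x in `]a, b[) (u x * derive1 z x) =
  - \int[mu]_(x in `]a, b[) (w x * z x).
Proof.
move=> ab cu cw uw tz.
have cz : continuous z := test_function_continuous (n := 0) tz.
have cz' : continuous (derive1 z) := test_function_continuous (n := 1) tz.
have dz x : x \in `]a, b[ -> is_derive x 1 z (derive1 z x).
  by have [dz _] := tz; rewrite derive1E => _; exact/derivableP/(dz 0%N).
rewrite (Rintegral_by_parts_oo ab cu cw cz cz' uw dz).
have [_ [a' [b' [aa' b'b z0]]]] := tz.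
rewrite !z0 ?mulr0 ?subr0 ?sub0r // in_itv /= negb_and -!ltNge.
  by rewrite aa'.
by rewrite b'b orbT.
Qed.

(** Dominated convergence along the bumps shows that g has integral 0 over every
interval with rational end points.  Its primitive from a rational point then
vanishes on a dense set, hence identically, and by Lebesgue differentiation g
is almost everywhere its derivative.  Only countably many test functions occur,
which matters when each of them comes with its own exceptional null set. *)
Lemma ae_zero_of_bump_orthogonal a b g :
  mu.-integrable `]a, b[ (EFin \o g) ->
  (forall (p q : rat) (n : nat), a < ratr p -> ratr q < b ->
    \int[mu]_(x in `]a, b[) (g x * bump (ratr p) (ratr q) n.+1%:R x) = 0) ->
  {ae mu, forall x, `]a, b[%classic x -> g x = 0}.
Proof.
move=> intg ortho.
have /integrableP[mg _] := intg.
have indic0 (p q : rat) : a < ratr p -> ratr q < b ->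
    \int[mu]_(x in `]a, b[) (g x * \1_(`]ratr p, ratr q[%classic : set R) x) = 0.
  move=> ap qb.
  have [|||||intL _ cvg0] := @dominated_convergence _ _ _ mu `]a, b[%classic
    (measurable_itv _)
    (fun n x => (g x * bump (ratr p) (ratr q) n.+1%:R x)%:E)
    (fun x => (g x * \1_(`]ratr p, ratr q[%classic : set R) x)%:E)
    (fun x => `|g x|%:E).
  - move=> n; apply/measurable_EFinP/measurable_funM; first exact/measurable_EFinP.
    apply: measurable_funTS; apply: continuous_measurable_fun.
    apply: (@test_function_continuous _ (ratr p - 1) (ratr q + 1) _ 0).
    by apply: bump_test_function => //; [rewrite ltrBlDr ltrDl|rewrite ltrDl].
  - apply/measurable_EFinP/measurable_funM; first exact/measurable_EFinP.
    exact: measurable_indic.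
  - apply: aeW => x _; apply: cvg_EFin; first exact: nearW.
    by apply: cvgM; [exact: cvg_cst|exact: bump_cvg_indic].
  - exact: integrable_abse intg.
  - apply: aeW => x n _ /=; rewrite lee_fin normrM ler_piMr //.
    exact: bump_norm_le1.
  rewrite -(fineK (integrable_fin_num _ intL)) // in cvg0.
  have := fine_cvg cvg0.
  have -> : fine \o [sequence (\int[mu]_(x in `]a, b[)
      (g x * bump (ratr p) (ratr q) n.+1%:R x)%:E)%E]_n = cst 0.
    by apply/funext => n /=; rewrite -[RHS](ortho p q n ap qb).
  by move=> L; exact: (norm_cvg_unique (L _) (cvg_cst 0)).
pose h := g \_ `]a, b[.
have inth D : measurable D -> mu.-integrable D (EFin \o h).
  move=> mD; rewrite /h -restrict_EFin; apply/integrable_restrict => //.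
  by apply: integrableS intg => //; exact: measurableI.
have inthE (p q : rat) : a < ratr p -> ratr q < b ->
    \int[mu]_(x in `[ratr p, ratr q]) h x = 0.
  move=> ap qb.
  have sub : `]ratr p, ratr q[ `<=` `]a, b[.
    move=> x /=; rewrite !in_itv /= => /andP[px xq].
    by rewrite (lt_trans ap px) (lt_trans xq qb).
  rewrite -Rintegral_oo_cc; last exact: inth.
  rewrite -(indic0 p q ap qb).
  transitivity (\int[mu]_(x in `]ratr p, ratr q[) g x).
    apply: eq_Rintegral => x xpq; rewrite /h patchE mem_set //.
    by apply: sub; rewrite inE in xpq.
  rewrite -[X in Rintegral mu X g = _](setIidr sub) Rintegral_mkcondr; apply: eq_Rintegral => x _.
  by rewrite patchE indicE; case: (_ \in _); rewrite /= ?mulr1 ?mulr0.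
have := lebesgue_differentiation
  (integrable_locally_restrict (measurable_itv _) intg).
apply: filterS; first exact: (ae_filter_ringOfSetsType mu).
move=> x ptx xab.
have xab' : x \in `]a, b[ by [].
move: (xab'); rewrite in_itv /= => /andP[ax xb].
have [p] := rat_in_itvoo ax; rewrite in_itv /= => /andP[ap px].
have [q] := rat_in_itvoo xb; rewrite in_itv /= => /andP[xq qb].
pose F y := \int[mu]_(t in `[ratr p, y]) h t.
have F0 y : ratr p < y -> y < ratr q -> F y = 0.
  move=> py yq.
  have cF : {within `[ratr p, ratr q], continuous F}.
    by apply: parameterized_integral_continuous; [exact: ltW (lt_trans py yq)|exact: inth].
  have yI : y \in `]ratr p, ratr q[ by rewrite in_itv /= py.
  have cy := within_continuous_continuous (lt_trans py yq) cF yI.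
  apply/eqP/negPn/negP => Fy.
  have nF : \forall t \near y, F t != 0 by exact: (cvgr_neq0 (F y) cy Fy).
  have nI : \forall t \near y, t \in `]ratr p, ratr q[ by exact: near_in_itvoo.
  have [U] : exists2 U : set R, open_nbhs y U & U `<=` [set t | F t != 0 /\ t \in `]ratr p, ratr q[].
    have : nbhs y [set t | F t != 0 /\ t \in `]ratr p, ratr q[] by near=> t; split; near: t.
    by rewrite nbhsE.
  move=> [oU Uy] UF.
  have [t [Ut [r _ rt]]] := dense_rat (ex_intro _ y Uy : U !=set0) oU.
  have [] := UF t Ut; rewrite -rt => /negP + /[!in_itv]/= /andP[_ rq].
  by apply; apply/eqP/inthE => //; exact: lt_trans qb.
have [_ /=] := @FTC1_lebesgue_pt _ h (BLeft (ratr p)) x (ratr q) xq (inth _ (measurable_itv _)) px ptx.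
have -> : h x = g x by rewrite /h patchE mem_set.
move=> <-.
rewrite derive1E (near_eq_derive (g := cst 0)) ?derive_cst //.
near=> y; apply: F0; near: y; [exact: lt_nbhsr|exact: lt_nbhsl].
Unshelve. all: by end_near. Qed.
End FundamentalLemma.

(** * Natural boundary conditions from one weak identity *)

Section PointwiseContinuity.
Context {R : realType} {T : topologicalType}.
Implicit Types f g : T -> R.

Lemma continuous_addf f g : continuous f -> continuous g ->
  continuous (fun x => f x + g x).
Proof. by move=> cf cg x; apply: cvgD; [exact: cf|exact: cg]. Qed.

Lemma continuous_mulf f g : continuous f -> continuous g ->
  continuous (fun x => f x * g x).
Proof. by move=> cf cg x; apply: cvgM; [exact: cf|exact: cg]. Qed.

Lemma continuous_cstf (r : R) : continuous (fun _ : T => r).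
Proof. by move=> x; exact: cvg_cst. Qed.

Lemma continuous_subf f g : continuous f -> continuous g ->
  continuous (fun x => f x - g x).
Proof. by move=> cf cg x; apply: cvgB; [exact: cf|exact: cg]. Qed.

Lemma continuous_sqrf f : continuous f -> continuous (fun x => f x ^+ 2).
Proof.
move=> cf; have -> : (fun x => f x ^+ 2) = (fun x => f x * f x).
  by apply/funext => x; rewrite expr2.
exact: continuous_mulf.
Qed.

End PointwiseContinuity.

Section Clamp.
Context {R : realType}.
Implicit Types a b x : R.

(** Composition with the projection on [a, b] turns continuity on the interval
into continuity everywhere. *)
Definition clamp a b x := Num.max a (Num.min b x).

Lemma clamp_continuous a b : continuous (clamp a b).
Proof.
apply: (@max_fun_continuous _ _ R (cst a)); first by move=> x; exact: cvg_cst.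
apply: (@min_fun_continuous _ _ R (cst b) id); first by move=> x; exact: cvg_cst.
by move=> x; exact: cvg_id.
Qed.

Lemma clamp_in a b x : a <= b -> a <= clamp a b x <= b.
Proof. by move=> ab; rewrite /clamp le_max lexx /= ge_max ab ge_min lexx. Qed.

Lemma clamp_id a b x : a <= x <= b -> clamp a b x = x.
Proof. by case/andP=> ax xb; rewrite /clamp min_r // max_r. Qed.

End Clamp.

Section NaturalFlux.
Context {R : realType}.
Notation mu := (@lebesgue_measure R).
Implicit Types (a b x : R) (f g u v w z : R -> R).

(** A set of full measure meets every relatively open subset of [a, b], so
identities between continuous functions pass from almost every time to every
time. *)
Lemma ae_dense a b (P : set R) x0 (U : set R) : a < b ->
  {ae mu, forall x, `]a, b[%classic x -> P x} ->
  a <= x0 <= b -> nbhs x0 U -> exists y, [/\ a < y < b, P y & U y].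
Proof.
move=> ab aeP /andP[ax xb] /nbhs_ballP[e /= e0 eU].
pose c := Num.max a (x0 - e); pose d := Num.min b (x0 + e).
have cd : c < d.
  rewrite lt_min !gt_max ab /= !ltrBlDr (le_lt_trans xb) ?ltrDl //=.
  by rewrite (le_lt_trans ax) ?ltrDl //= -addrA ltrDl addr_gt0.
apply: contrapT => nex.
have : mu.-negligible `]c, d[.
  apply: negligibleS aeP => y /=; rewrite in_itv /= gt_max lt_min.
  move=> /andP[/andP[ay ey] /andP[yb ye]] H; apply: nex; exists y.
  have yab : a < y < b by rewrite ay.
  split=> //; first by apply: H; rewrite /= in_itv.
  by apply: eU; rewrite /ball /= ltr_norml; apply/andP; split; lra.
move=> /(negligibleP mu (measurable_itv `]c, d[)).
move=> mu0; have := etrans (esym mu0) (lebesgue_measure_itv `]c, d[).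
by rewrite /= lte_fin cd -EFinB => /eqP; rewrite eqe eq_sym subr_eq0 gt_eqF.
Qed.

(** The primitive is frozen outside [0, 1] to make it continuous on the line. *)
Lemma primitive g : continuous g -> exists G, [/\ continuous G, G 0 = 0 &
  forall x, x \in `]0, 1[ -> is_derive x 1 G (g x)].
Proof.
move=> cg; pose F y := \int[mu]_(t in `[-1, y]) g t.
have dF x : -1 < x -> is_derive x 1 F (g x).
  move=> x1; have xx : x < x + 1 by rewrite ltrDl.
  have ig : mu.-integrable `[-1, x + 1] (EFin \o g).
    apply: continuous_compact_integrable; first exact: segment_compact.
    exact: continuous_subspaceT.
  have [dF F'] := continuous_FTC1_closed xx ig x1 (cg x).
  by split => //; rewrite -derive1E.
exists (fun x => F (clamp 0 1 x) - F 0); split.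
- move=> x; apply: cvgB; last exact: cvg_cst.
  apply: (@continuous_comp _ _ _ (clamp 0 1) F); first exact: clamp_continuous.
  apply: (is_derive_continuous (dF _ _)).
  by have /andP[+ _] := @clamp_in R 0 1 x ler01; apply: lt_le_trans.
- by rewrite clamp_id ?lexx ?ler01 // subrr.
- move=> x x01; apply: (@near_eq_is_derive _ _ _ (fun y => F y + - F 0)).
    have := near_in_itvoo x01; apply: filterS => y.
    rewrite in_itv /= => /andP[y0 y1].
    by rewrite clamp_id // (ltW y0) (ltW y1).
  move: x01; rewrite in_itv /= => /andP[x0 _].
  have -> : g x = g x + 0 by rewrite addr0.
  by apply: is_derive_addf; apply: dF; exact: lt_trans x0.
Qed.

Lemma L2_continuous a b f : continuous f -> L2 mu `]a, b[%classic f.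
Proof.
move=> cf; split; first by apply: measurable_funTS; exact: continuous_measurable_fun.
apply: (@continuous_integrable_oo R a b (fun x => f x ^+ 2)).
exact: continuous_sqrf.
Qed.

Lemma H1_deriv_classical u w : continuous u -> continuous w ->
  (forall x, x \in `]0, 1[ -> is_derive x 1 u (w x)) -> H1_deriv u w.
Proof.
move=> cu cw uw; split; [exact: L2_continuous..|move=> z tz].
exact: Rintegral_by_parts_test tz.
Qed.

Lemma Rintegral_sqr_eq0 (q : R -> R) : continuous q ->
  \int[mu]_(x in `]0, 1[) (q x ^+ 2) = 0 -> forall x, 0 <= x <= 1 -> q x = 0.
Proof.
move=> cq q0 x x01.
have cq2 := continuous_sqrf cq.
have iq := @continuous_integrable_oo R 0 1 _ cq2.
have aeq : {ae mu, forall x, `]0, 1[%classic x -> (q x ^+ 2)%:E = 0%:E}.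
  apply/(ae_eq_integral_abs mu (measurable_itv `]0, 1[) (measurable_int mu iq)).
  under eq_integral do rewrite /= ger0_norm ?sqr_ge0 //.
  by rewrite -(fineK (integrable_fin_num _ iq)) // [fine _]q0.
apply/eqP/negPn/negP => qx.
have nq : nbhs x [set y | q y != 0] by exact: (cvgr_neq0 (q x) (cq x) qx).
have [y [_ + /=]] := ae_dense ltr01 aeq x01 nq.
by case=> /eqP; rewrite sqrf_eq0 => ->.
Qed.

(** Let G be the primitive of g that vanishes at 0.  The test function 1 gives
G 1 = 0, and the test function Q with Q' = f - G then gives, after one
integration by parts, that the square of f - G has integral 0.  Hence f = G,
which contains both the equation f' = g and the boundary conditions. *)
Lemma natural_flux f g : continuous f -> continuous g ->
  (forall phi dphi, H1_deriv phi dphi ->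
     \int[mu]_(x in Omega) (g x * phi x) +
     \int[mu]_(x in Omega) (f x * dphi x) = 0) ->
  [/\ f 0 = 0, f 1 = 0 & forall x1 x2, 0 <= x1 -> x1 < x2 -> x2 <= 1 ->
    exists2 y, x1 < y < x2 & f x2 - f x1 = g y * (x2 - x1)].
Proof.
move=> cf cg weak.
have [G [cG G0 dG]] := primitive cg.
have G1 : G 1 = 0.
  have H1 : H1_deriv (cst 1 : R -> R) (cst 0).
    by apply: H1_deriv_classical; exact: continuous_cstf.
  have := weak _ _ H1.
  have -> : \int[mu]_(x in Omega) (g x * cst 1 x) = \int[mu]_(x in `]0, 1[) g x.
    by apply: eq_Rintegral => x _; rewrite /= mulr1.
  have -> : \int[mu]_(x in Omega) (f x * cst 0 x) = \int[mu]_(x in `]0, 1[) 0.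
    by apply: eq_Rintegral => x _; rewrite /= mulr0.
  by rewrite (Rintegral_derivative ltr01 cG cg dG) Rintegral_cst // mul0r addr0
    G0 subr0.
pose q x := f x - G x.
have cq : continuous q by move=> x; apply: cvgB; [exact: cf|exact: cG].
have [Q [cQ Q0 dQ]] := primitive cq.
have q0x : forall x, 0 <= x <= 1 -> q x = 0.
  apply: Rintegral_sqr_eq0 => //.
  have := weak _ _ (H1_deriv_classical cQ cq dQ).
  have cM u v : continuous u -> continuous v -> continuous (fun x => u x * v x).
    by move=> cu cv x; apply: continuousM; [exact: cu|exact: cv].
  have -> : \int[mu]_(x in Omega) (g x * Q x) = \int[mu]_(x in `]0, 1[) (Q x * g x).
    by apply: eq_Rintegral => x _; rewrite mulrC.
  rewrite (Rintegral_by_parts_oo ltr01 cQ cq cG cg dQ dG).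
  rewrite G1 G0 !mulr0 subrr sub0r addrC -RintegralB //;
    do ?by apply: continuous_integrable_oo; exact: cM.
  2: exact: measurable_itv.
  move=> fqG; rewrite -[RHS]fqG; apply: eq_Rintegral => x _.
  by rewrite [q x * G x]mulrC -mulrBl -/(q x) expr2.
have fG x : 0 <= x <= 1 -> f x = G x by move/q0x/eqP; rewrite subr_eq0 => /eqP.
split; rewrite ?fG ?lexx ?ler01 //.
move=> x1 x2 x10 x12 x21.
have dG' y : y \in `]x1, x2[ -> is_derive y 1 G (g y).
  rewrite in_itv /= => /andP[y1 y2]; apply: dG.
  by rewrite in_itv /= (le_lt_trans x10 y1) (lt_le_trans y2 x21).
have cG' : {within `[x1, x2], continuous G} by exact: continuous_subspaceT.
have [y yI E] := @MVT R G g x1 x2 x12 dG' cG'.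
exists y; first by move: yI; rewrite in_itv.
by rewrite !fG // ?x10 ?x21 ?andbT /=; lra.
Qed.

End NaturalFlux.

(** * Null sets in space-time *)

Section WeakTimeDerivative.
Context {R : realType}.
Notation mu := (@lebesgue_measure R).
Notation RR := (measurableTypeR R * measurableTypeR R)%type.

(** An open set of the plane is the union of the rational boxes that it contains. *)
Lemma open_measurable_prod (U : set (R * R)) : open U -> measurable (U : set RR).
Proof.
move=> oU.
pose box (p q r s : rat) : set (R * R) := `]ratr p, ratr q[ `*` `]ratr r, ratr s[.
have -> : U = \bigcup_p \bigcup_q \bigcup_r \bigcup_s
    (if `[< box p q r s `<=` U >] then box p q r s else set0).
  apply/seteqP; split=> [[x y] Uxy|[x y]]; last first.
    by move=> [p _ [q _ [r _ [s _ /=]]]]; case: asboolP => // sub; exact: sub.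
  move: oU; rewrite openE => /(_ _ Uxy) /nbhs_ballP[e /= e0 sub].
  have xe : x - e < x by rewrite ltrBlDr ltrDl.
  have xe' : x < x + e by rewrite ltrDl.
  have ye : y - e < y by rewrite ltrBlDr ltrDl.
  have ye' : y < y + e by rewrite ltrDl.
  have [p] := rat_in_itvoo xe; rewrite in_itv /= => /andP[p1 p2].
  have [q] := rat_in_itvoo xe'; rewrite in_itv /= => /andP[q1 q2].
  have [r] := rat_in_itvoo ye; rewrite in_itv /= => /andP[r1 r2].
  have [s] := rat_in_itvoo ye'; rewrite in_itv /= => /andP[s1 s2].
  exists p => //; exists q => //; exists r => //; exists s => //.
  rewrite asboolT; first by split; rewrite /= in_itv /= ?p2 ?q1 ?r2 ?s1.
  move=> [a b] [/=]; rewrite !in_itv /= => /andP[a1 a2] /andP[b1 b2].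
  by apply: sub; split; rewrite /= /ball /= ltr_norml; apply/andP; split; lra.
do 4 (apply: bigcupT_measurable_rat => ?).
case: ifP => _; last exact: measurable0.
by apply: measurableX; exact: measurable_itv.
Qed.

Lemma continuous_measurable_prod (f : R * R -> R) : continuous f ->
  measurable_fun [set: RR] f.
Proof.
move=> /continuousP cf; apply: (measurability _ (RGenOpens.measurableE R)).
move=> _ [_ [a [b ->] <-]]; rewrite setTI; apply: open_measurable_prod.
exact/cf/interval_open.
Qed.

Lemma ae_forall_count (I : countType) (P : I -> R -> Prop) :
  (forall i, {ae mu, forall x, P i x}) -> {ae mu, forall x, forall i, P i x}.
Proof.
move=> aeP.
pose Q n x := if unpickle n is Some i then P i x else True.
have aeQ : {ae mu, forall x, forall n, Q n x}.
  by apply: ae_foralln => n; rewrite /Q; case: unpickle => [i|];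
    [exact: aeP|exact: aeW].
apply: filterS aeQ; first exact: (ae_filter_ringOfSetsType mu).
by move=> x Qx i; have := Qx (pickle i); rewrite /Q pickleK.
Qed.

(** Tonelli for the indicator of A. *)
Lemma ae_prod_swap (A : set RR) : measurable A ->
  {ae mu, forall x, {ae mu, forall t, ~ A (t, x)}} ->
  {ae mu, forall t, {ae mu, forall x, ~ A (t, x)}}.
Proof.
move=> mA aeA.
have intA : (\int[mu]_t mu (xsection A t) = 0)%E.
  transitivity (\int[mu]_t fubini_F mu (EFin \o \1_A) t)%E.
    by rewrite indic_fubini_tonelli_FE.
  rewrite (indic_fubini_tonelli mu mu mA).
  rewrite indic_fubini_tonelli_GE //.
  have ae0 : {ae mu, forall x, setT x -> (mu \o ysection A) x = cst 0%E x}.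
    move: aeA; apply: filterS.
    move=> x aex _ /=; apply/negligibleP; first exact: measurable_ysection.
    by apply: negligibleS aex => t /=; rewrite /ysection /= inE => At; apply.
  have mu_y : measurable_fun setT (mu \o ysection A) by exact: measurable_fun_ysection.
  by rewrite (@ae_eq_integral _ _ _ mu setT (cst 0%E) _ measurableT mu_y (measurable_cst _) ae0) integral0.
have : {ae mu, forall t, setT t -> mu (xsection A t) = 0%E}.
  apply/(ae_eq_integral_abs mu measurableT (measurable_fun_xsection mu mA)).
  by under eq_integral do rewrite /= gee0_abs //.
apply: filterS.
move=> t /(_ I) mu0.
have : mu.-negligible (xsection A t).
  by apply/negligibleP => //; exact: measurable_xsection.
by apply: negligibleS => x /= /contrapT; rewrite /xsection /= inE.
Qed.

End WeakTimeDerivative.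

(** * Weak derivatives of regular functions are the classical ones *)

Section Slices.
Context {R : realType}.
Implicit Type f : R * R -> R.

Lemma continuous_slice1 f (x : R) : continuous f -> continuous (fun t => f (t, x)).
Proof.
move=> cf t; apply: (@continuous_comp _ _ _ (fun t : R => (t, x)) f); last exact: cf.
apply: (cvg_pair (F := nbhs t) (G := nbhs t) (H := nbhs x) (f := id) (g := cst x)).
  exact: cvg_id.
exact: cvg_cst.
Qed.

Lemma continuous_slice2 f (t : R) : continuous f -> continuous (fun x => f (t, x)).
Proof.
move=> cf x; apply: (@continuous_comp _ _ _ (fun x : R => (t, x)) f); last exact: cf.
apply: (cvg_pair (F := nbhs x) (G := nbhs t) (H := nbhs x) (f := cst t) (g := id)).
  exact: cvg_cst.
exact: cvg_id.
Qed.

End Slices.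

Section WeakIsClassical.
Context {R : realType}.
Notation mu := (@lebesgue_measure R).
Notation RR := (measurableTypeR R * measurableTypeR R)%type.
Implicit Types (a b x : R) (f u uc v w z : R -> R).

Lemma ae_imp (P Q : R -> Prop) : (forall x, P x -> Q x) ->
  {ae mu, forall x, P x} -> {ae mu, forall x, Q x}.
Proof.
by move=> PQ; apply: negligibleS => x nQ /= Px; apply: nQ; exact: PQ.
Qed.

Lemma L2_integrable a b f : L2 mu `]a, b[%classic f ->
  mu.-integrable `]a, b[ (EFin \o f).
Proof.
move=> [mf if2].
have i1 : mu.-integrable `]a, b[ (fun x => (1 + f x ^+ 2)%:E).
  rewrite (_ : (fun x => _) = (fun x => 1%:E + (f x ^+ 2)%:E)%E) //.
  apply: integrableD => //.
  by apply: (@continuous_integrable_oo R a b (cst 1)); exact: continuous_cstf.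
apply: le_integrable i1 => //; first exact/measurable_EFinP.
move=> x _ /=; rewrite lee_fin [leRHS]ger0_norm ?addr_ge0 ?sqr_ge0 //.
have := sqr_ge0 (`|f x| - 1); rewrite -(real_normK (num_real (f x))).
by have := normr_ge0 (f x); nra.
Qed.

Lemma integrable_mul_bounded a b (K : R) f z :
  mu.-integrable `]a, b[ (EFin \o f) -> continuous z ->
  (forall x, `|z x| <= K) ->
  mu.-integrable `]a, b[ (EFin \o (fun x => f x * z x)).
Proof.
move=> intf cz zK.
apply: (le_integrable _ _ _ (integrableZl _ K intf)) => //.
  apply/measurable_EFinP; apply: measurable_funM.
    by apply/measurable_EFinP; exact: measurable_int intf.
  by apply: measurable_funTS; exact: continuous_measurable_fun.
move=> x _ /=; rewrite lee_fin !normrM mulrC ler_wpM2r //.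
exact: le_trans (ler_norm K).
Qed.

(** Integration by parts against each bump shows that v - w is orthogonal to it. *)
Lemma weak_derivative_ae a b u uc v w : a < b ->
  mu.-integrable `]a, b[ (EFin \o v) -> continuous uc -> continuous w ->
  (forall x, x \in `]a, b[ -> u x = uc x) ->
  (forall x, x \in `]a, b[ -> is_derive x 1 uc (w x)) ->
  (forall (p q : rat) (n : nat), a < ratr p -> ratr q < b ->
    let z := bump (ratr p) (ratr q) n.+1%:R in
    \int[mu]_(x in `]a, b[) (u x * derive1 z x) =
    - \int[mu]_(x in `]a, b[) (v x * z x)) ->
  {ae mu, forall x, `]a, b[%classic x -> v x = w x}.
Proof.
move=> ab intv cuc cw uE ucw weak.
have intw := @continuous_integrable_oo R a b w cw.
suff : {ae mu, forall x, `]a, b[%classic x -> v x - w x = 0}.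
  apply: ae_imp.
  by move=> x H /H /eqP; rewrite subr_eq0 => /eqP.
apply: ae_zero_of_bump_orthogonal.
  rewrite (_ : EFin \o _ = (fun x => (v x)%:E - (w x)%:E)%E) //.
  exact: integrableB.
move=> p q n ap qb; set z := bump _ _ _.
have tz : test_function a b z by exact: bump_test_function.
have cz : continuous z := test_function_continuous (n := 0) tz.
have zle1 x : `|z x| <= 1 by exact: bump_norm_le1.
transitivity (\int[mu]_(x in `]a, b[) (v x * z x) -
              \int[mu]_(x in `]a, b[) (w x * z x)).
  rewrite -RintegralB //; try exact: (integrable_mul_bounded (K := 1)).
  by apply: eq_Rintegral => x _; rewrite mulrBl.
apply/eqP; rewrite subr_eq0 -eqr_opp; apply/eqP.
rewrite -(Rintegral_by_parts_test ab cuc cw ucw tz) -(weak p q n ap qb).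
by apply: eq_Rintegral => x; rewrite inE => xab; rewrite uE.
Qed.

Lemma H1_deriv_ae u uc v w : H1_deriv u v -> continuous uc -> continuous w ->
  (forall x, x \in `]0, 1[ -> u x = uc x) ->
  (forall x, x \in `]0, 1[ -> is_derive x 1 uc (w x)) ->
  {ae mu, forall x, Omega x -> v x = w x}.
Proof.
move=> [_ L2v weak] cuc cw uE ucw.
apply: (weak_derivative_ae ltr01 (L2_integrable L2v) cuc cw uE ucw).
by move=> p q n p0 q1 z; apply: weak; exact: bump_test_function.
Qed.

(** The weak time derivative is known for almost every x, with a null set that
depends on the test function, while the weak equations hold for almost every t.
Countably many bumps give equality for almost every x at almost every t, and
Tonelli exchanges the two quantifiers. *)
Lemma W12_L2_ae T (u ut uc wt : R * R -> R) : 0 < T ->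
  continuous uc -> continuous wt ->
  (forall p, Qopen T p -> u p = uc p) ->
  (forall t x, t \in `]0, T[ -> x \in `]0, 1[ ->
     is_derive t 1 (fun s => uc (s, x)) (wt (t, x))) ->
  W12_L2 T u ut ->
  {ae mu, forall t, `]0, T[%classic t ->
    {ae mu, forall x, Omega x -> ut (t, x) = wt (t, x)}}.
Proof.
move=> T0 cuc cwt uE duc [_ [mut iut2] weak].
have mQ : measurable (Qopen T : set RR) by apply: measurableX; exact: measurable_itv.
pose A : set RR := Qopen T `&` (fun p => ut p - wt p) @^-1` (~` [set 0]).
have mA : measurable A.
  have mg : measurable_fun (Qopen T : set RR) (fun p => ut p - wt p).
    apply: measurable_funB => //.
    by apply: measurable_funTS; exact: continuous_measurable_prod.
  by apply: mg => //; apply: measurableC; exact: measurable_set1.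
have ae1 : {ae mu, forall x, Omega x ->
    mu.-integrable `]0, T[ (fun t => (ut (t, x) ^+ 2)%:E)}.
  have : (mu \x mu)%E.-integrable [set: RR]
      ((fun p => (ut p ^+ 2)%:E) \_ (Qopen T)).
    by apply/(integrable_restrict _ mQ measurableT); rewrite setTI.
  move=> /ae_integrable2; apply: ae_imp.
  move=> x ix Ox.
  have := @integrableS _ _ _ mu setT `]0, T[%classic _ measurableT (measurable_itv _) (@subsetT _ _) ix.
  apply: eq_integrable => // t; rewrite inE => tT.
  by rewrite patchE mem_set.
have ae2 : {ae mu, forall x, forall i : rat * rat * nat,
    0 < ratr i.1.1 :> R -> ratr i.1.2 < T -> Omega x ->
    let z := bump (ratr i.1.1) (ratr i.1.2) i.2.+1%:R in
    \int[mu]_(t in `]0, T[) (u (t, x) * derive1 z t) =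
    - \int[mu]_(t in `]0, T[) (ut (t, x) * z t)}.
  apply: ae_forall_count => -[[p q] n] /=.
  have [p0|p0] := boolP (0 < ratr p :> R); last by apply: aeW.
  have [q0|q0] := boolP (ratr q < T); last by apply: aeW.
  have := weak _ (bump_test_function p0 q0 (ltr0Sn R n)).
  apply: ae_imp.
  by move=> x H _ _ Ox; exact: H.
have : {ae mu, forall x, {ae mu, forall t, ~ A (t, x)}}.
  have : {ae mu, forall x, Omega x -> mu.-integrable `]0, T[ (fun t => (ut (t, x) ^+ 2)%:E) /\
      forall i : rat * rat * nat,
    0 < ratr i.1.1 :> R -> ratr i.1.2 < T ->
    let z := bump (ratr i.1.1) (ratr i.1.2) i.2.+1%:R in
    \int[mu]_(t in `]0, T[) (u (t, x) * derive1 z t) =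
    - \int[mu]_(t in `]0, T[) (ut (t, x) * z t)}.
    move: ae1 ae2; apply: filterS2; first exact: (ae_filter_ringOfSetsType mu).
    by move=> x h1 h2 Ox; split; [exact: h1|move=> i i1 i2; exact: h2].
  apply: ae_imp.
  move=> x H.
  have [Ox|nOx] := pselect (Omega x); last first.
    by apply: aeW => t [[_ Ox]].
  have [i2 wk] := H Ox.
  have m1 : measurable_fun `]0, T[ (fun t => ut (t, x)).
    apply: (measurable_comp mQ _ mut); last first.
      by apply: measurable_funTS; exact: pair2_measurable.
    by move=> _ [t tT <-].
  have : {ae mu, forall t, `]0, T[%classic t -> ut (t, x) = wt (t, x)}.
    apply: (@weak_derivative_ae 0 T (fun t => u (t, x)) (fun t => uc (t, x)) _ (fun t => wt (t, x))) => //.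
    - exact: L2_integrable.
    - exact: continuous_slice1.
    - exact: continuous_slice1.
    - by move=> t tT; apply: uE.
    - by move=> t tT; apply: duc.
    - by move=> p q n p0 qT; exact: (wk (p, q, n)).
  apply: ae_imp.
  by move=> t E [[/= tT _] /=]; rewrite E // subrr; apply.
move=> /(ae_prod_swap mA); apply: ae_imp.
move=> t aet tT; move: aet; apply: ae_imp.
move=> x nA Ox; apply: contrapT => ne; apply: nA; split => //= /eqP.
by rewrite subr_eq0 => /eqP.
Qed.

End WeakIsClassical.

(** * Bounds on the closed space-time cylinder *)

Section Shrink.
Context {R : realType}.
Implicit Types a b t x : R.

(** A homothety of centre (a + b) / 2 that moves [a, b] into ]a, b[ and tends to
the identity; being a contraction, it lets estimates on the open cylinder pass
to the closed one. *)
Definition shrink a b (n : nat) t := t + n.+1%:R^-1 / 2 * ((a + b) / 2 - t).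

Lemma shrink_weight (n : nat) : 0 < (n.+1%:R^-1 / 2 : R) <= 1 / 2.
Proof.
have n0 : 0 < n.+1%:R^-1 :> R by rewrite invr_gt0 ltr0n.
have n1 : n.+1%:R^-1 <= 1 :> R by rewrite invf_le1 ?ltr0n // ler1n.
by move: n0 n1; move: (_^-1) => l n0 n1; apply/andP; split; lra.
Qed.

Lemma shrink_in a b n t : a < b -> a <= t <= b -> shrink a b n t \in `]a, b[.
Proof.
move=> ab /andP[at_ tb]; rewrite in_itv /= /shrink.
have /andP[] := shrink_weight n; move: (_ / _) => l l0 l1.
by apply/andP; split; nra.
Qed.

Lemma shrinkB a b n t t' :
  shrink a b n t' - shrink a b n t = (1 - n.+1%:R^-1 / 2) * (t' - t).
Proof. by rewrite /shrink; ring. Qed.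

Lemma shrink_le a b n t t' : t <= t' -> shrink a b n t <= shrink a b n t'.
Proof.
move=> tt'; rewrite -subr_ge0 shrinkB.
have /andP[] := shrink_weight n; move: (_ / _) => l l0 l1; nra.
Qed.

Lemma shrink_dist a b n t t' :
  `|shrink a b n t' - shrink a b n t| <= `|t' - t|.
Proof.
rewrite shrinkB normrM ler_piMl //.
have /andP[] := shrink_weight n; move: (_ / _) => l l0 l1.
by rewrite ger0_norm; lra.
Qed.

Lemma shrink_cvg a b t : shrink a b n t @[n --> \oo] --> t.
Proof.
rewrite -[X in _ --> X]addr0; apply: cvgD; first exact: cvg_cst.
rewrite -(mul0r ((a + b) / 2 - t)) -(mul0r (2^-1 : R)).
apply: cvgM; last exact: cvg_cst; apply: cvgM; last exact: cvg_cst.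
exact: cvg_harmonic.
Qed.

Lemma shrink_cvg2 (f : R * R -> R) a b a' b' t x : continuous f ->
  f (shrink a b n t, shrink a' b' n x) @[n --> \oo] --> f (t, x).
Proof.
move=> cf.
have p : (shrink a b n t, shrink a' b' n x) @[n --> \oo] --> (t, x).
  apply: (cvg_pair (F := \oo) (G := nbhs t) (H := nbhs x)
    (f := fun n => shrink a b n t) (g := fun n => shrink a' b' n x)).
    exact: shrink_cvg.
  exact: shrink_cvg.
exact: (cvg_comp _ _ p (cf (t, x))).
Qed.

Lemma norm_lim_le (v : nat -> R) (l B : R) : v n @[n --> \oo] --> l ->
  (forall n, `|v n| <= B) -> `|l| <= B.
Proof.
move=> vl vB; have := ler_cvg_to (cvg_norm vl) (cvg_cst B); apply.
exact: nearW.
Qed.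

End Shrink.

Section ClampDomain.
Context {R : realType}.
Variable T : R.
Hypothesis T0 : 0 < T.

Definition clampQ (p : R * R) := (clamp 0 T p.1, clamp 0 1 p.2).

Lemma clampQ_in p : Qbar T (clampQ p).
Proof.
by split; rewrite /= in_itv /=; apply: clamp_in; [exact: ltW|exact: ler01].
Qed.

Lemma clampQ_id p : Qbar T p -> clampQ p = p.
Proof.
case: p => t x [/=]; rewrite !in_itv /= => ht hx.
by rewrite /clampQ /= !clamp_id.
Qed.

Lemma clampQ_continuous : continuous clampQ.
Proof.
move=> [t x].
apply: (cvg_pair (F := nbhs (t, x)) (G := nbhs (clamp 0 T t)) (H := nbhs (clamp 0 1 x))
  (f := fun p => clamp 0 T p.1) (g := fun p => clamp 0 1 p.2)).
  apply: (cvg_comp fst (clamp 0 T) (G := nbhs t)); first exact: cvg_fst.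
  exact: clamp_continuous.
apply: (cvg_comp snd (clamp 0 1) (G := nbhs x)); first exact: cvg_snd.
exact: clamp_continuous.
Qed.

Lemma continuous_comp_clampQ (w : R * R -> R) : {within Qbar T, continuous w} ->
  continuous (w \o clampQ).
Proof.
move=> /subspace_continuousP cw p.
apply: (@cvg_comp _ _ _ clampQ w (nbhs p) (within (Qbar T) (nbhs (clampQ p)))); last first.
  exact: cw (clampQ_in p).
move=> U /= wU; have := clampQ_continuous wU.
by apply: (@filterS _ (nbhs p)) => q /=; apply; exact: clampQ_in.
Qed.

Lemma comp_clampQ_bounded (w : R * R -> R) : {within Qbar T, continuous w} ->
  exists2 M, 0 <= M & forall p, `|w (clampQ p)| <= M.
Proof.
move=> cw.
have cQ : compact (Qbar T) by apply: compact_setX; exact: segment_compact.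
have [M [Mr HM]] := compact_bounded (continuous_compact cw cQ).
exists (`|M| + 1); first by rewrite addr_ge0.
move=> p; apply: (HM (`|M| + 1)).
  by rewrite (le_lt_trans (ler_norm M)) // ltrDl.
by exists (clampQ p) => //; exact: clampQ_in.
Qed.

Lemma Qopen_Qbar p : Qopen T p -> Qbar T p.
Proof. by case=> h1 h2; split; exact: subset_itv_oo_cc. Qed.

Lemma is_derive_pdt (f g : R * R -> R) t x : (forall p, Qopen T p -> g p = f p) ->
  t \in `]0, T[ -> x \in `]0, 1[ -> derivable (fun s => f (s, x)) t 1 ->
  is_derive t 1 (fun s => g (s, x)) (pdt f (t, x)).
Proof.
move=> gf tT x1 df; apply: (@near_eq_is_derive _ _ _ (fun s => f (s, x))).
  by have := near_in_itvoo tT; apply: filterS => s sT; rewrite gf //; split.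
by rewrite /pdt /= derive1E; exact: derivableP.
Qed.

Lemma is_derive_pdx (f g : R * R -> R) t x : (forall p, Qopen T p -> g p = f p) ->
  t \in `]0, T[ -> x \in `]0, 1[ -> derivable (fun y => f (t, y)) x 1 ->
  is_derive x 1 (fun y => g (t, y)) (pdx f (t, x)).
Proof.
move=> gf tT x1 df; apply: (@near_eq_is_derive _ _ _ (fun y => f (t, y))).
  by have := near_in_itvoo x1; apply: filterS => s sT; rewrite gf //; split.
by rewrite /pdx /= derive1E; exact: derivableP.
Qed.

End ClampDomain.

Section RegularData.
Context {R : realType}.
Variables (T sigma M : R).

(** The quantitative content of the regularity hypotheses: u is the solution
component continued outside the cylinder by clamping, ut and ux are the
continuous continuations of its first derivatives, and one constant M serves in
all Taylor estimates. *)
Record regular_data (u ut ux : R * R -> R) : Prop := RegularData {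
  rd_cu : continuous u;
  rd_cut : continuous ut;
  rd_cux : continuous ux;
  rd_dt : forall t x : R, t \in `]0, T[ -> x \in `]0, 1[ ->
    is_derive t 1 (fun s => u (s, x)) (ut (t, x));
  rd_dx : forall t x : R, t \in `]0, T[ -> x \in `]0, 1[ ->
    is_derive x 1 (fun y => u (t, y)) (ux (t, x));
  rd_ge0 : 0 <= M;
  rd_u : forall p, `|u p| <= M;
  rd_ut : forall p, `|ut p| <= M;
  rd_ux : forall p, `|ux p| <= M;
  rd_u_t : forall t t' x : R, 0 <= t -> t <= t' -> t' <= T -> 0 <= x <= 1 ->
    `|u (t', x) - u (t, x) - (t' - t) * ut (t', x)|
      <= M * ((t' - t) * (t' - t) `^ sigma);
  rd_ut_x : forall t x x' : R, 0 <= t <= T -> 0 <= x <= 1 -> 0 <= x' <= 1 ->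
    `|ut (t, x') - ut (t, x)| <= M * `|x' - x| `^ sigma;
  rd_u_x : forall t x x' : R, 0 <= t <= T -> 0 <= x -> x <= x' -> x' <= 1 ->
    `|u (t, x') - u (t, x)| <= M * (x' - x);
  rd_u_xx : forall t x y x' : R, 0 <= t <= T -> 0 <= x -> x <= y -> y <= x' -> x' <= 1 ->
    `|u (t, x') - u (t, x) - (x' - x) * ux (t, y)| <= M * (x' - x) ^+ 2;
  rd_ux_t : forall t t' x : R, 0 <= t -> t <= t' -> t' <= T -> 0 <= x <= 1 ->
    `|ux (t', x) - ux (t, x)| <= M * (t' - t) }.

End RegularData.

Section RegularDataExists.
Context {R : realType}.

Lemma mvt_closed (f df : R -> R) (a b : R) : a <= b -> continuous f ->
  (forall x, x \in `]a, b[ -> is_derive x 1 f (df x)) ->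
  exists2 y, a <= y <= b & f b - f a = df y * (b - a).
Proof.
move=> ab cf fdf; have cf' : {within `[a, b], continuous f}.
  exact: continuous_subspaceT.
have [y yab E] := @MVT_segment R f df a b ab fdf cf'.
by exists y => //; move: yab; rewrite in_itv.
Qed.

Lemma dist2_slice1 (t t' x : R) : dist2 (t, x) (t', x) = `|t - t'|.
Proof. by rewrite /dist2 /= subrr expr0n addr0 sqrtr_sqr. Qed.

Lemma dist2_slice2 (t x x' : R) : dist2 (t, x) (t, x') = `|x - x'|.
Proof. by rewrite /dist2 /= subrr expr0n add0r sqrtr_sqr. Qed.

Lemma itv_sub (a b c d x : R) : c \in `]a, b[ -> d \in `]a, b[ ->
  c <= x <= d -> x \in `]a, b[.
Proof.
rewrite !in_itv /= => /andP[ac cb] /andP[ad db] /andP[cx xd].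
by rewrite (lt_le_trans ac cx) (le_lt_trans xd db).
Qed.

Lemma itv_oo_sub (a b c d x : R) : c \in `]a, b[ -> d \in `]a, b[ ->
  x \in `]c, d[ -> x \in `]a, b[.
Proof.
move=> ci di; rewrite in_itv /= => /andP[cx xd].
by apply: (itv_sub ci di); rewrite !ltW.
Qed.

Variables (T sigma M : R) (u ut ux uxx utx : R * R -> R).
Hypotheses (T0 : 0 < T) (sigma0 : 0 < sigma) (M0 : 0 <= M).
Hypotheses (cu : continuous u) (cut : continuous ut) (cux : continuous ux).
Hypothesis dt_u : forall t x : R, t \in `]0, T[ -> x \in `]0, 1[ ->
  is_derive t 1 (fun s => u (s, x)) (ut (t, x)).
Hypothesis dx_u : forall t x : R, t \in `]0, T[ -> x \in `]0, 1[ ->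
  is_derive x 1 (fun y => u (t, y)) (ux (t, x)).
Hypothesis dx_ux : forall t x : R, t \in `]0, T[ -> x \in `]0, 1[ ->
  is_derive x 1 (fun y => ux (t, y)) (uxx (t, x)).
Hypothesis dt_ux : forall t x : R, t \in `]0, T[ -> x \in `]0, 1[ ->
  is_derive t 1 (fun s => ux (s, x)) (utx (t, x)).
Hypotheses (bu : forall p, `|u p| <= M) (but : forall p, `|ut p| <= M).
Hypotheses (bux : forall p, `|ux p| <= M) (buxx : forall p, `|uxx p| <= M).
Hypothesis butx : forall p, `|utx p| <= M.
Hypothesis ut_hoelder : forall p q, Qopen T p -> Qopen T q ->
  `|ut p - ut q| <= M * dist2 p q `^ sigma.

Let mvt_t (f ft : R * R -> R) (a b x : R) : continuous f ->
  (forall t x : R, t \in `]0, T[ -> x \in `]0, 1[ ->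
    is_derive t 1 (fun s => f (s, x)) (ft (t, x))) ->
  a \in `]0, T[ -> b \in `]0, T[ -> x \in `]0, 1[ -> a <= b ->
  exists2 s, a <= s <= b & f (b, x) - f (a, x) = ft (s, x) * (b - a).
Proof.
move=> cf df aI bI xI ab.
have d s : s \in `]a, b[ -> is_derive s 1 (fun s => f (s, x)) (ft (s, x)).
  by move=> sI; apply: df => //; exact: itv_oo_sub aI bI sI.
exact: (@mvt_closed _ (fun s => ft (s, x)) a b ab (continuous_slice1 cf) d).
Qed.

Let mvt_x (f fx : R * R -> R) (t a b : R) : continuous f ->
  (forall t x : R, t \in `]0, T[ -> x \in `]0, 1[ ->
    is_derive x 1 (fun y => f (t, y)) (fx (t, x))) ->
  t \in `]0, T[ -> a \in `]0, 1[ -> b \in `]0, 1[ -> a <= b ->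
  exists2 y, a <= y <= b & f (t, b) - f (t, a) = fx (t, y) * (b - a).
Proof.
move=> cf df tI aI bI ab.
have d y : y \in `]a, b[ -> is_derive y 1 (fun y => f (t, y)) (fx (t, y)).
  by move=> yI; apply: df => //; exact: itv_oo_sub aI bI yI.
exact: (@mvt_closed _ (fun y => fx (t, y)) a b ab (continuous_slice2 cf) d).
Qed.

Let ler_powR_sigma (a b : R) : 0 <= a -> a <= b -> a `^ sigma <= b `^ sigma.
Proof.
move=> a0 ab; apply: ge0_ler_powR => //; first exact: ltW.
exact: le_trans ab.
Qed.

Implicit Types t x y : R.

Let close t x n := (shrink 0 T n t, shrink 0 1 n x).

Let in_t t n : 0 <= t <= T -> shrink 0 T n t \in `]0, T[.
Proof. exact: shrink_in. Qed.

Let in_x x n : 0 <= x <= 1 -> shrink 0 1 n x \in `]0, 1[.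
Proof. exact: shrink_in. Qed.

Let u_t (t t' x : R) : 0 <= t -> t <= t' -> t' <= T -> 0 <= x <= 1 ->
  `|u (t', x) - u (t, x) - (t' - t) * ut (t', x)|
      <= M * ((t' - t) * (t' - t) `^ sigma).
Proof.
move=> t0 tt' t'T x01.
have tI : 0 <= t <= T by rewrite t0 (le_trans tt').
have tI' : 0 <= t' <= T by rewrite t'T (le_trans t0).
apply: (@norm_lim_le _ (fun n => u (close t' x n) - u (close t x n) -
    (shrink 0 T n t' - shrink 0 T n t) * ut (close t' x n))).
  apply: cvgB; first by apply: cvgB; exact: shrink_cvg2.
  by apply: cvgM; [apply: cvgB; exact: shrink_cvg|exact: shrink_cvg2].
move=> n; have sn := shrink_le 0 T n tt'.
have [y yI E] := mvt_t cu dt_u (in_t n tI) (in_t n tI') (in_x n x01) sn.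
rewrite /close E [X in _ - X]mulrC -mulrBl normrM.
have dle := shrink_dist 0 T n t t'.
rewrite (ger0_norm (x := t' - t)) ?subr_ge0 // in dle.
rewrite [leRHS]mulrA [leRHS]mulrAC; apply: ler_pM => //.
apply: le_trans (ut_hoelder _ _) _.
- by split; [exact: itv_sub (in_t n tI) (in_t n tI') yI|exact: in_x].
- by split; [exact: in_t|exact: in_x].
rewrite dist2_slice1 ler_wpM2l // ler_powR_sigma //.
apply: le_trans dle; case/andP: yI => y1 y2.
by rewrite distrC !ger0_norm ?subr_ge0 //; lra.
Qed.

Let ut_x (t x x' : R) : 0 <= t <= T -> 0 <= x <= 1 -> 0 <= x' <= 1 ->
  `|ut (t, x') - ut (t, x)| <= M * `|x' - x| `^ sigma.
Proof.
move=> tI xI xI'.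
apply: (@norm_lim_le _ (fun n => ut (close t x' n) - ut (close t x n))).
  by apply: cvgB; exact: shrink_cvg2.
move=> n; apply: le_trans (ut_hoelder _ _) _.
- by split; [exact: in_t|exact: in_x].
- by split; [exact: in_t|exact: in_x].
by rewrite dist2_slice2 ler_wpM2l // ler_powR_sigma // shrink_dist.
Qed.

Let u_x (t x x' : R) : 0 <= t <= T -> 0 <= x -> x <= x' -> x' <= 1 ->
  `|u (t, x') - u (t, x)| <= M * (x' - x).
Proof.
move=> tI x0 xx' x'1.
have xI : 0 <= x <= 1 by rewrite x0 (le_trans xx').
have xI' : 0 <= x' <= 1 by rewrite x'1 (le_trans x0).
apply: (@norm_lim_le _ (fun n => u (close t x' n) - u (close t x n))).
  by apply: cvgB; exact: shrink_cvg2.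
move=> n; have sn := shrink_le 0 1 n xx'.
have [y yI E] := mvt_x cu dx_u (in_t n tI) (in_x n xI) (in_x n xI') sn.
rewrite /close E normrM; apply: ler_pM => //.
by apply: le_trans (shrink_dist _ _ _ _ _) _; rewrite ger0_norm ?subr_ge0.
Qed.

Let u_xx (t x y x' : R) : 0 <= t <= T -> 0 <= x -> x <= y -> y <= x' -> x' <= 1 ->
  `|u (t, x') - u (t, x) - (x' - x) * ux (t, y)| <= M * (x' - x) ^+ 2.
Proof.
move=> tI x0 xy yx' x'1.
have xx' := le_trans xy yx'.
have xI : 0 <= x <= 1 by rewrite x0 (le_trans xx').
have xI' : 0 <= x' <= 1 by rewrite x'1 (le_trans x0).
have yI : 0 <= y <= 1 by rewrite (le_trans x0 xy) (le_trans yx').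
apply: (@norm_lim_le _ (fun n => u (close t x' n) - u (close t x n) -
    (shrink 0 1 n x' - shrink 0 1 n x) * ux (close t y n))).
  apply: cvgB; first by apply: cvgB; exact: shrink_cvg2.
  by apply: cvgM; [apply: cvgB; exact: shrink_cvg|exact: shrink_cvg2].
move=> n; have sn := shrink_le 0 1 n xx'.
have [z zI E] := mvt_x cu dx_u (in_t n tI) (in_x n xI) (in_x n xI') sn.
rewrite /close E [X in _ - X]mulrC -mulrBl normrM.
have dle := shrink_dist 0 1 n x x'.
rewrite (ger0_norm (x := x' - x)) ?subr_ge0 // in dle.
rewrite expr2 mulrA; apply: ler_pM => //.
have sy1 := shrink_le 0 1 n xy.
have sy2 := shrink_le 0 1 n yx'.
have mono a b : a <= b -> shrink 0 1 n x <= a -> b <= shrink 0 1 n x' ->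
    `|ux (shrink 0 T n t, b) - ux (shrink 0 T n t, a)| <= M * (x' - x).
  move=> ab xa bx'.
  have ai := itv_sub (in_x n xI) (in_x n xI') (introT andP (conj xa (le_trans ab bx'))).
  have bi := itv_sub (in_x n xI) (in_x n xI') (introT andP (conj (le_trans xa ab) bx')).
  have [w wI ->] := mvt_x cux dx_ux (in_t n tI) ai bi ab.
  rewrite normrM; apply: ler_pM => //.
  by rewrite ger0_norm ?subr_ge0 //; apply: le_trans dle; rewrite ger0_norm ?subr_ge0 //; lra.
case/andP: zI => z1 z2.
have [zy|/ltW yz] := leP z (shrink 0 1 n y).
  by rewrite distrC; exact: mono.
exact: mono.
Qed.

Let ux_t (t t' x : R) : 0 <= t -> t <= t' -> t' <= T -> 0 <= x <= 1 ->
  `|ux (t', x) - ux (t, x)| <= M * (t' - t).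
Proof.
move=> t0 tt' t'T x01.
have tI : 0 <= t <= T by rewrite t0 (le_trans tt').
have tI' : 0 <= t' <= T by rewrite t'T (le_trans t0).
apply: (@norm_lim_le _ (fun n => ux (close t' x n) - ux (close t x n))).
  by apply: cvgB; exact: shrink_cvg2.
move=> n; have sn := shrink_le 0 T n tt'.
have [y yI E] := mvt_t cux dt_ux (in_t n tI) (in_t n tI') (in_x n x01) sn.
rewrite /close E normrM; apply: ler_pM => //.
by apply: le_trans (shrink_dist _ _ _ _ _) _; rewrite ger0_norm ?subr_ge0.
Qed.

(** Each estimate holds at shrunk points by the mean value theorem and passes to
the limit. *)
Lemma regular_data_of_derivatives : regular_data T sigma M u ut ux.
Proof. by []. Qed.

End RegularDataExists.

Lemma regular_data_exists (R : realType) (T sigma : R) (u : R * R -> R) :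
  0 < T -> 0 < sigma -> regular_Qbar T u ->
  hoelder_continuous sigma (Qopen T) (pd 1 0 u) ->
  exists M ut ux, regular_data T sigma M (u \o clampQ T) ut ux.
Proof.
move=> T0 s0 [cu reg] [L hoel].
have [hd10 [wt [cwt wtE]]] := reg 1%N 0%N isT isT isT.
have [_ [wx [cwx wxE]]] := reg 0%N 1%N isT isT isT.
have [hd02 [wxx [cwxx wxxE]]] := reg 0%N 2%N isT isT isT.
have [hd11 [wtx [cwtx wtxE]]] := reg 1%N 1%N isT isT isT.
have [Mu Mu0 bu] := comp_clampQ_bounded T0 cu.
have [Mt Mt0 bt] := comp_clampQ_bounded T0 cwt.
have [Mx Mx0 bx] := comp_clampQ_bounded T0 cwx.
have [Mxx Mxx0 bxx] := comp_clampQ_bounded T0 cwxx.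
have [Mtx Mtx0 btx] := comp_clampQ_bounded T0 cwtx.
have clE (w f : R * R -> R) : (forall p, Qopen T p -> w p = f p) ->
    forall p, Qopen T p -> (w \o clampQ T) p = f p.
  by move=> wf p Qp /=; rewrite clampQ_id ?wf //; exact: Qopen_Qbar.
pose M := Mu + Mt + Mx + Mxx + Mtx + `|L|.
have L0 := normr_ge0 L.
exists M, (wt \o clampQ T), (wx \o clampQ T).
apply: (@regular_data_of_derivatives _ T sigma M _ _ _ (wxx \o clampQ T) (wtx \o clampQ T)) => //.
- by rewrite /M; lra.
- exact: continuous_comp_clampQ.
- exact: continuous_comp_clampQ.
- exact: continuous_comp_clampQ.
- move=> t x tT x1; have Q : Qopen T (t, x) by [].
  rewrite (clE _ _ wtE) //; apply: (is_derive_pdt (T := T)) => //; first exact: clE.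
  by have [_ /(_ 0%N isT)] := hd10 _ Q.
- move=> t x tT x1; have Q : Qopen T (t, x) by [].
  rewrite (clE _ _ wxE) //; apply: (is_derive_pdx (T := T)) => //; first exact: clE.
  by have [/(_ 0%N isT)] := hd02 _ Q.
- move=> t x tT x1; have Q : Qopen T (t, x) by [].
  rewrite (clE _ _ wxxE) //; apply: (is_derive_pdx (T := T)) => //; first exact: clE.
  by have [/(_ 1%N isT)] := hd02 _ Q.
- move=> t x tT x1; have Q : Qopen T (t, x) by [].
  rewrite (clE _ _ wtxE) //; apply: (is_derive_pdt (T := T)) => //; first exact: clE.
  by have [_ /(_ 0%N isT)] := hd11 _ Q.
- by move=> p; apply: le_trans (bu p) _; rewrite /M; lra.
- by move=> p; apply: le_trans (bt p) _; rewrite /M; lra.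
- by move=> p; apply: le_trans (bx p) _; rewrite /M; lra.
- by move=> p; apply: le_trans (bxx p) _; rewrite /M; lra.
- by move=> p; apply: le_trans (btx p) _; rewrite /M; lra.
- move=> p q Qp Qq; rewrite !(clE _ _ wtE) //.
  apply: le_trans (hoel p q Qp Qq) _.
  rewrite ler_wpM2r ?powR_ge0 //; apply: le_trans (ler_norm L) _.
  by rewrite /M; lra.
Qed.

(** * The nonlinearity gamma and its derivative *)

Section Constitutive.
Context {R : realType}.
Variable eps : R.
Hypothesis eps0 : 0 < eps.
Implicit Types v w : R.

Let gamE v : gam eps v = Num.sqrt (eps ^+ 2 + v ^+ 2).
Proof. by rewrite /gam real_normK ?num_real. Qed.

Lemma gam_sqr v : gam eps v ^+ 2 = eps ^+ 2 + v ^+ 2.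
Proof. by rewrite gamE sqr_sqrtr // addr_ge0 ?sqr_ge0. Qed.

Lemma gam_ge v : eps <= gam eps v.
Proof.
rewrite gamE -[leLHS](ger0_norm (ltW eps0)) -sqrtr_sqr ler_sqrt ?addr_ge0 ?sqr_ge0 //.
by rewrite lerDl sqr_ge0.
Qed.

Lemma gam_gt0 v : 0 < gam eps v.
Proof. exact: lt_le_trans (gam_ge v). Qed.

Lemma norm_le_gam v : `|v| <= gam eps v.
Proof. by rewrite gamE -sqrtr_sqr ler_sqrt ?addr_ge0 ?sqr_ge0 // lerDr sqr_ge0. Qed.

Lemma gam_even v : gam eps (- v) = gam eps v.
Proof. by rewrite !gamE sqrrN. Qed.

(** The difference of squares of gam eps at v and w is v ^+ 2 - w ^+ 2, and gam eps
dominates the absolute value. *)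
Lemma gam_lipschitz v w : `|gam eps v - gam eps w| <= `|v - w|.
Proof.
have gv := gam_gt0 v; have gw := gam_gt0 w.
have E : (gam eps v - gam eps w) * (gam eps v + gam eps w) = (v - w) * (v + w).
  have := gam_sqr v; have := gam_sqr w; nra.
have s0 : 0 < gam eps v + gam eps w by rewrite addr_gt0.
rewrite -(ler_pM2r s0) -[X in _ * X <= _](gtr0_norm s0) -normrM E normrM.
apply: ler_wpM2l => //; apply: le_trans (ler_normD _ _) _.
by apply: lerD; exact: norm_le_gam.
Qed.

Lemma gam_le v : gam eps v <= eps + `|v|.
Proof.
have := gam_lipschitz v 0; rewrite subr0.
have -> : gam eps 0 = eps by rewrite gamE expr0n addr0 sqrtr_sqr gtr0_norm.
by move=> /(le_trans (ler_norm _)); lra.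
Qed.

Lemma derive1_gam v : derive1 (gam eps) v = v / gam eps v.
Proof.
have -> : gam eps = fun u => Num.sqrt (eps ^+ 2 + u * u).
  by apply/funext => u; rewrite gamE expr2.
have p0 : 0 < eps ^+ 2 + v * v by rewrite ltr_wpDr ?exprn_gt0 // -expr2 sqr_ge0.
have d1 : is_derive v 1 (fun u : R => eps ^+ 2 + u * u) (0 + (1 * v + v * 1)).
  exact: (is_derive_addf (is_derive_cst _ _ _)
    (is_derive_mulf (is_derive_id _ _) (is_derive_id _ _))).
have d2 := @is_derive1_comp R Num.sqrt _ v _ _ (is_derive1_sqrt p0) d1.
rewrite (is_derive_derive1 d2).
have s0 : Num.sqrt (eps ^+ 2 + v * v) != 0 by rewrite gt_eqF // sqrtr_gt0.
by field.
Qed.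

(** The derivative of gam eps. *)
Definition dgam v := v / gam eps v.

Lemma dgam_norm_le1 v : `|dgam v| <= 1.
Proof.
rewrite /dgam normrM normfV (gtr0_norm (gam_gt0 v)).
by rewrite ler_pdivrMr ?gam_gt0 // mul1r norm_le_gam.
Qed.

(** Convexity of gam eps. *)
Lemma dgam_monotone v w : 0 <= (dgam v - dgam w) * (v - w).
Proof.
have gv := gam_gt0 v; have gw := gam_gt0 w.
have -> : (dgam v - dgam w) * (v - w) =
    (v ^+ 2 * gam eps w + w ^+ 2 * gam eps v - v * w * (gam eps v + gam eps w)) /
    (gam eps v * gam eps w).
  by rewrite /dgam; field; rewrite !gt_eqF.
rewrite divr_ge0 ?mulr_ge0 ?(ltW gv) ?(ltW gw) //.
have := gam_sqr v; have := gam_sqr w.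
move: gv gw; set p := gam eps v; set q := gam eps w => p0 q0 qE pE.
(* Cauchy-Schwarz for the plane vectors (v, eps) and (w, eps), whose lengths
   are p and q; with v ^+ 2 = p ^+ 2 - eps ^+ 2 it settles the sign. *)
have cs : v * w + eps ^+ 2 <= p * q.
  rewrite leNgt; apply/negP => h.
  have : (p * q) ^+ 2 < (v * w + eps ^+ 2) ^+ 2.
    by rewrite ltrXn2r // ?nnegrE ?mulr_ge0 ?(ltW p0) ?(ltW q0) // (le_trans _ (ltW h)) // mulr_ge0 // ltW.
  rewrite exprMn qE pE; have := sqr_ge0 (eps * (v - w)); nra.
have -> : v ^+ 2 = p ^+ 2 - eps ^+ 2 by rewrite pE; ring.
have -> : w ^+ 2 = q ^+ 2 - eps ^+ 2 by rewrite qE; ring.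
have : v * w * (p + q) <= (p * q - eps ^+ 2) * (p + q).
  by rewrite ler_wpM2r ?addr_ge0 ?(ltW p0) ?(ltW q0) // lerBrDr.
lra.
Qed.

Lemma dgam_lipschitz v w : `|dgam v - dgam w| <= 2 / eps * `|v - w|.
Proof.
have gv := gam_gt0 v; have gw := gam_gt0 w.
have -> : dgam v - dgam w = (v - w) / gam eps v
    + dgam w * ((gam eps w - gam eps v) / gam eps v).
  by rewrite /dgam; field; rewrite !gt_eqF.
have giv : `|(gam eps v)^-1| <= eps^-1.
  by rewrite gtr0_norm ?invr_gt0 // lef_pV2 ?posrE // gam_ge.
apply: le_trans (ler_normD _ _) _.
have -> : 2 / eps * `|v - w| = `|v - w| * eps^-1 + 1 * (`|v - w| * eps^-1) by ring.
apply: lerD; first by rewrite normrM ler_wpM2l.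
rewrite normrM; apply: ler_pM => //; first exact: dgam_norm_le1.
rewrite normrM.
by apply: ler_pM => //; rewrite distrC gam_lipschitz.
Qed.

Lemma lipschitz_continuous (K : R) (f : R -> R) :
  (forall v w, `|f v - f w| <= K * `|v - w|) -> continuous f.
Proof.
move=> lip v; apply/cvgrPdist_le => e e0.
have K1 : 0 < `|K| + 1 by rewrite ltr_wpDl.
near=> w.
apply: le_trans (lip v w) _.
apply: (@le_trans _ _ ((`|K| + 1) * `|v - w|)).
  by rewrite ler_wpM2r // (le_trans (ler_norm K)) // lerDl.
rewrite mulrC -ler_pdivlMr //; near: w.
exact/cvgr_dist_le/divr_gt0.
Unshelve. all: by end_near. Qed.

Lemma gam_continuous : continuous (gam eps).
Proof. by apply: (@lipschitz_continuous 1) => v w; rewrite mul1r gam_lipschitz. Qed.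

Lemma dgam_continuous : continuous dgam.
Proof. exact: lipschitz_continuous dgam_lipschitz. Qed.

Lemma derive1_alp (d v : R) : derive1 (alp d) v = v.
Proof.
have -> : alp d = fun u => 2^-1 * (u * u) + d.
  by apply/funext => u; rewrite /alp expr2 mulrC.
have d1 : is_derive v 1 (fun u : R => 2^-1 * (u * u) + d) (2^-1 * (1 * v + v * 1) + 0).
  exact: (is_derive_addf (is_derive_scalef _
    (is_derive_mulf (is_derive_id _ _) (is_derive_id _ _)))
    (is_derive_cst _ _ _)).
by rewrite (is_derive_derive1 d1); field.
Qed.

End Constitutive.

(** * Flux balances of the solution *)

Section FluxBalance.
Context {R : realType}.
Notation mu := (@lebesgue_measure R).

(** The conservation law F_x = G in integrated form, with zero flux through both
end points.  The source is frozen at a point y of the cell, at the price of a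
Hoelder error; the form is stable under limits in t. *)
Definition flux_balance (T B sigma : R) (F G : R * R -> R) : Prop :=
  forall t : R, 0 <= t <= T ->
    [/\ F (t, 0) = 0, F (t, 1) = 0 &
      forall x y x' : R, 0 <= x -> x <= y -> y <= x' -> x' <= 1 ->
        `|F (t, x') - F (t, x) - (x' - x) * G (t, y)|
          <= B * ((x' - x) `^ sigma + (x' - x)) * (x' - x)].

Lemma ae_le_closure (T c : R) (f : R -> R) : 0 < T -> continuous f ->
  {ae mu, forall t, `]0, T[%classic t -> f t <= c} ->
  forall t, 0 <= t <= T -> f t <= c.
Proof.
move=> T0 cf aef t tI; rewrite leNgt; apply/negP => ct.
have nU : nbhs t [set s | c < f s] by exact: (cvgr_gt (f t) (cf t) c ct).
have [s [_ fs /=]] := ae_dense T0 aef tI nU.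
by rewrite ltNge fs.
Qed.

(** The mean value form of the balance holds at almost every time; the inequality
that it implies is between continuous functions of time. *)
Lemma flux_balance_closure (T B sigma : R) (F G : R * R -> R) :
  0 < T -> 0 <= B -> 0 < sigma -> continuous F -> continuous G ->
  (forall t x y : R, 0 <= t <= T -> 0 <= x <= 1 -> 0 <= y <= 1 ->
     `|G (t, y) - G (t, x)| <= B * (`|y - x| `^ sigma + `|y - x|)) ->
  {ae mu, forall t, `]0, T[%classic t ->
    [/\ F (t, 0) = 0, F (t, 1) = 0 &
      forall x x', 0 <= x -> x < x' -> x' <= 1 ->
        exists2 y, x < y < x' & F (t, x') - F (t, x) = G (t, y) * (x' - x)]} ->
  flux_balance T B sigma F G.
Proof.
move=> T0 B0 s0 cF cG hG aeF t tI.
have c1 x := continuous_slice1 (x := x) cF.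
have abs0 x : {ae mu, forall t, `]0, T[%classic t -> F (t, x) = 0} -> F (t, x) = 0.
  move=> aex; apply/eqP; rewrite -normr_le0.
  apply: (@ae_le_closure T 0 (fun t => `|F (t, x)|)) => //.
    by move=> s; apply: cvg_norm; exact: c1.
  by apply: ae_imp aex => s + sT => -> //; rewrite normr0.
split.
- by apply: abs0; apply: ae_imp aeF => s + sT => -[].
- by apply: abs0; apply: ae_imp aeF => s + sT => -[].
move=> x y x' x0 xy yx' x'1.
apply: (@ae_le_closure T _ (fun t => `|F (t, x') - F (t, x) - (x' - x) * G (t, y)|)) => //.
  move=> s; apply: cvg_norm; apply: cvgB; first by apply: cvgB; exact: c1.
  by apply: cvgM; [exact: cvg_cst|exact: continuous_slice1].
apply: ae_imp aeF => s + sT => /(_ sT) [_ _ mvt].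
have sI : 0 <= s <= T.
  by move: sT; rewrite /= in_itv /= => /andP[s1 s2]; rewrite !ltW.
have := le_trans xy yx'; rewrite le_eqVlt => /predU1P[xx'|xx'].
  by rewrite -xx' !subrr mul0r subr0 normr0 mulr0.
have [z /andP[xz zx'] ->] := mvt _ _ x0 xx' x'1.
rewrite [X in _ - X]mulrC -mulrBl normrM (gtr0_norm (x := x' - x)) ?subr_gt0 //.
rewrite ler_pM2r ?subr_gt0 //; apply: le_trans (hG s y z sI _ _) _.
- by rewrite (le_trans x0 xy) (le_trans yx').
- by rewrite (le_trans x0 (ltW xz)) (le_trans (ltW zx')).
have zy : `|z - y| <= x' - x by rewrite ler_norml; apply/andP; split; lra.
rewrite ler_wpM2l // lerD //; apply: ge0_ler_powR => //; rewrite ?nnegrE //.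
  exact: ltW.
by rewrite subr_ge0 ltW.
Qed.

End FluxBalance.

Section RegularDataExtra.
Context {R : realType}.
Variables (T sigma M : R) (u ut ux : R * R -> R).
Hypothesis rd : regular_data T sigma M u ut ux.

Lemma rd_u_lip (t x x' : R) : 0 <= t <= T -> 0 <= x <= 1 -> 0 <= x' <= 1 ->
  `|u (t, x') - u (t, x)| <= M * `|x' - x|.
Proof.
move=> tI /andP[x0 x1] /andP[x'0 x'1].
have [xx'|/ltW x'x] := leP x x'.
  by rewrite [in leRHS]ger0_norm ?subr_ge0 //; exact: (rd_u_x rd).
by rewrite distrC [in leRHS]distrC [in leRHS]ger0_norm ?subr_ge0 //; exact: (rd_u_x rd).
Qed.

(** Comparison of the Taylor estimates based at both end points. *)
Lemma rd_ux_x (t x x' : R) : 0 <= t <= T -> 0 <= x <= 1 -> 0 <= x' <= 1 ->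
  `|ux (t, x') - ux (t, x)| <= 2 * M * `|x' - x|.
Proof.
have core y y' : 0 <= t <= T -> 0 <= y -> y < y' -> y' <= 1 ->
    `|ux (t, y') - ux (t, y)| <= 2 * M * (y' - y).
  move=> tI y0 yy' y'1.
  have h0 : 0 < y' - y by rewrite subr_gt0.
  have H1 := rd_u_xx rd tI y0 (lexx y) (ltW yy') y'1.
  have H2 := rd_u_xx rd tI y0 (ltW yy') (lexx y') y'1.
  rewrite -(ler_pM2l h0) -[X in X * `|_|](gtr0_norm h0) -normrM.
  have -> : (y' - y) * (ux (t, y') - ux (t, y)) =
    (u (t, y') - u (t, y) - (y' - y) * ux (t, y)) -
    (u (t, y') - u (t, y) - (y' - y) * ux (t, y')) by ring.
  apply: le_trans (ler_normB _ _) _.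
  have -> : (y' - y) * (2 * M * (y' - y)) = M * (y' - y) ^+ 2 + M * (y' - y) ^+ 2 by ring.
  exact: lerD.
move=> tI /andP[x0 x1] /andP[x'0 x'1].
have [xx'|x'x|->] := ltgtP x x'.
- by rewrite [in leRHS]gtr0_norm ?subr_gt0 //; exact: core.
- by rewrite distrC [in leRHS]distrC [in leRHS]gtr0_norm ?subr_gt0 //; exact: core.
- by rewrite !subrr normr0 mulr0.
Qed.

End RegularDataExtra.

Lemma norm_mulB (R : realDomainType) (a b a' b' : R) :
  `|a * b - a' * b'| <= `|a - a'| * `|b| + `|a'| * `|b - b'|.
Proof.
have -> : a * b - a' * b' = (a - a') * b + a' * (b - b') by ring.
by apply: le_trans (ler_normD _ _) _; rewrite !normrM.
Qed.

Section LipschitzClosure.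
Context {R : realType}.
Variables (T L delta0 : R) (alpha0 : R * R -> R).
Hypothesis T0 : 0 < T.
Hypothesis lip : lipschitz_with L (Qopen T) alpha0.
Hypothesis cont : {within Qbar T, continuous alpha0}.
Hypothesis inf_alpha0 : inf (alpha0 @` Qopen T) = delta0.

Let a0 := alpha0 \o clampQ T.

Let ca0 : continuous a0. Proof. exact: continuous_comp_clampQ. Qed.

Let a0E p : Qopen T p -> a0 p = alpha0 p.
Proof. by move=> Qp; rewrite /a0 /= clampQ_id //; exact: Qopen_Qbar. Qed.

Let in_Q n t x : 0 <= t <= T -> 0 <= x <= 1 ->
  Qopen T (shrink 0 T n t, shrink 0 1 n x).
Proof. by move=> tI xI; split; [exact: shrink_in|exact: shrink_in]. Qed.

Lemma lipschitz_closure_x (t x x' : R) : 0 <= L ->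
  0 <= t <= T -> 0 <= x <= 1 -> 0 <= x' <= 1 ->
  `|a0 (t, x') - a0 (t, x)| <= L * `|x' - x|.
Proof.
move=> L0 tI xI xI'.
apply: (@norm_lim_le _ (fun n => a0 (shrink 0 T n t, shrink 0 1 n x')
    - a0 (shrink 0 T n t, shrink 0 1 n x))).
  by apply: cvgB; exact: shrink_cvg2.
move=> n; rewrite !a0E; try exact: in_Q.
apply: le_trans (lip (in_Q _ tI xI') (in_Q _ tI xI)) _.
by rewrite dist2_slice2 ler_wpM2l // shrink_dist.
Qed.

Lemma lipschitz_closure_t (t t' x : R) : 0 <= L ->
  0 <= t <= T -> 0 <= t' <= T -> 0 <= x <= 1 ->
  `|a0 (t', x) - a0 (t, x)| <= L * `|t' - t|.
Proof.
move=> L0 tI tI' xI.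
apply: (@norm_lim_le _ (fun n => a0 (shrink 0 T n t', shrink 0 1 n x)
    - a0 (shrink 0 T n t, shrink 0 1 n x))).
  by apply: cvgB; exact: shrink_cvg2.
move=> n; rewrite !a0E; try exact: in_Q.
apply: le_trans (lip (in_Q _ tI' xI) (in_Q _ tI xI)) _.
by rewrite dist2_slice1 ler_wpM2l // shrink_dist.
Qed.

Lemma inf_le_closure (t x : R) : 0 <= t <= T -> 0 <= x <= 1 -> delta0 <= a0 (t, x).
Proof.
move=> tI xI.
have [A _ bA] := comp_clampQ_bounded T0 cont.
have cv : a0 (shrink 0 T n t, shrink 0 1 n x) @[n --> \oo] --> a0 (t, x).
  exact: shrink_cvg2.
have := ler_cvg_to (cvg_cst delta0) cv; apply; apply: nearW => n.
rewrite a0E; last exact: in_Q.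
rewrite -inf_alpha0; apply: ge_inf; last by exists (shrink 0 T n t, shrink 0 1 n x) => //; exact: in_Q.
exists (- A) => _ [q Qq <-].
have := bA q; rewrite clampQ_id; last exact: Qopen_Qbar.
by rewrite ler_norml => /andP[].
Qed.

End LipschitzClosure.

Section WeakToFlux.
Context {R : realType}.
Notation mu := (@lebesgue_measure R).
Notation RR := (measurableTypeR R * measurableTypeR R)%type.

Lemma regular_data_mono (T sigma M M' : R) (u ut ux : R * R -> R) : M <= M' ->
  regular_data T sigma M u ut ux -> regular_data T sigma M' u ut ux.
Proof.
move=> MM' [cu cut cux dt dx M0 bu but bux h1 h2 h3 h4 h5].
split => //; first exact: le_trans MM'.
- by move=> p; exact: le_trans (bu p) MM'.
- by move=> p; exact: le_trans (but p) MM'.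
- by move=> p; exact: le_trans (bux p) MM'.
- move=> t t' x a b d e; apply: le_trans (h1 t t' x a b d e) _.
  by rewrite ler_wpM2r // mulr_ge0 ?subr_ge0 ?powR_ge0.
- move=> t x x' a b d; apply: le_trans (h2 t x x' a b d) _.
  by rewrite ler_wpM2r // powR_ge0.
- move=> t x x' a b d e; apply: le_trans (h3 t x x' a b d e) _.
  by rewrite ler_wpM2r // subr_ge0.
- move=> t x y x' a b d e f; apply: le_trans (h4 t x y x' a b d e f) _.
  by rewrite ler_wpM2r // sqr_ge0.
- move=> t t' x a b d e; apply: le_trans (h5 t t' x a b d e) _.
  by rewrite ler_wpM2r // subr_ge0.
Qed.

Lemma Rintegral_ae_eq (f g : R -> R) : measurable_fun Omega f ->
  measurable_fun Omega g -> {ae mu, forall x, Omega x -> f x = g x} ->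
  \int[mu]_(x in Omega) f x = \int[mu]_(x in Omega) g x.
Proof.
move=> mf mg fg; rewrite /Rintegral; congr fine.
apply: ae_eq_integral; [exact: measurable_itv|exact/measurable_EFinP..|].
by apply: ae_imp fg => x H Ox; rewrite H.
Qed.

Lemma measurable_slice (T t : R) (f : R * R -> R) : `]0, T[%classic t ->
  measurable_fun (Qopen T : set RR) f -> measurable_fun Omega (fun x => f (t, x)).
Proof.
move=> tT mf.
have mQ : measurable (Qopen T : set RR) by apply: measurableX; exact: measurable_itv.
apply: (measurable_comp mQ _ mf); last by apply: measurable_funTS; exact: pair1_measurable.
by move=> _ [x xO <-].
Qed.

Lemma ae_and (P Q : R -> Prop) : {ae mu, forall t, P t} -> {ae mu, forall t, Q t} ->
  {ae mu, forall t, P t /\ Q t}.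
Proof.
move=> aP aQ; have := negligibleU aP aQ; apply: negligibleS => t /= n.
by apply: contrapT => /not_orP[/contrapT Pt /contrapT Qt]; apply: n.
Qed.

End WeakToFlux.

Section FluxOfSolution.
Context {R : realType}.
Notation mu := (@lebesgue_measure R).
Notation RR := (measurableTypeR R * measurableTypeR R)%type.
Variables (T eps delta0 c kappa0 kappa nu L sigma M : R).
Variables (alpha0 : R * R -> R) (eta0 theta0 : R -> R) (eta theta : R * R -> R).
Variables (et ex tt tx : R * R -> R).
Hypotheses (T0 : 0 < T) (eps0 : 0 < eps) (sigma0 : 0 < sigma) (L0 : 0 <= L).
Hypothesis lip : lipschitz_with L (Qopen T) alpha0.
Hypothesis cont : {within Qbar T, continuous alpha0}.
Hypothesis sol : solution_S T eps delta0 c kappa0 kappa nu alpha0 eta0 theta0 eta theta.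
Hypothesis rde : regular_data T sigma M (eta \o clampQ T) et ex.
Hypothesis rdt : regular_data T sigma M (theta \o clampQ T) tt tx.

Let e := eta \o clampQ T.
Let th := theta \o clampQ T.
Let a0 := alpha0 \o clampQ T.

(** Flux and source of the two equations, in the form F_x = G; the source of the
first one contains the time derivative and the reaction terms. *)
Definition eta_flux (p : R * R) := kappa0 ^+ 2 * ex p.
Definition eta_source (p : R * R) :=
  et p + c * (e p - 1) + kappa * e p * gam eps (tx p).
Definition theta_flux (p : R * R) :=
  kappa * alp delta0 (e p) * dgam eps (tx p) + nu ^+ 2 * tx p.
Definition theta_source (p : R * R) := a0 p * tt p.

Let clE (f : R * R -> R) p : Qopen T p -> f p = (f \o clampQ T) p.
Proof. by move=> Qp /=; rewrite clampQ_id //; exact: Qopen_Qbar. Qed.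

Let ca0 : continuous a0. Proof. exact: continuous_comp_clampQ. Qed.
Let ce : continuous e. Proof. exact: rd_cu rde. Qed.
Let cg : continuous (fun p => gam eps (tx p)).
Proof.
move=> p; apply: (@continuous_comp _ _ _ tx (gam eps)); first exact: (rd_cux rdt).
exact: gam_continuous.
Qed.
Let cdg : continuous (fun p => dgam eps (tx p)).
Proof.
move=> p; apply: (@continuous_comp _ _ _ tx (dgam eps)); first exact: (rd_cux rdt).
exact: dgam_continuous.
Qed.

Lemma eta_flux_continuous : continuous eta_flux.
Proof. by apply: continuous_mulf; [exact: continuous_cstf|exact: rd_cux rde]. Qed.

Lemma eta_source_continuous : continuous eta_source.
Proof.
apply: continuous_addf; last by do ?apply: continuous_mulf => //; exact: continuous_cstf.
apply: continuous_addf; first exact: rd_cut rde.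
apply: continuous_mulf; first exact: continuous_cstf.
by apply: continuous_subf => //; exact: continuous_cstf.
Qed.

Lemma theta_flux_continuous : continuous theta_flux.
Proof.
apply: continuous_addf; last first.
  by apply: continuous_mulf; [exact: continuous_cstf|exact: rd_cux rdt].
apply: continuous_mulf => //; apply: continuous_mulf; first exact: continuous_cstf.
apply: continuous_addf; last exact: continuous_cstf.
by apply: continuous_mulf; [exact: continuous_sqrf|exact: continuous_cstf].
Qed.

Lemma theta_source_continuous : continuous theta_source.
Proof. by apply: continuous_mulf => //; exact: rd_cut rdt. Qed.

Let natural (F G : R * R -> R) t := [/\ F (t, 0) = 0, F (t, 1) = 0 &
  forall x x', 0 <= x -> x < x' -> x' <= 1 ->
    exists2 y, x < y < x' & F (t, x') - F (t, x) = G (t, y) * (x' - x)].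

Let ae_dt (u ut uc wt ux : R * R -> R) : (forall p, Qopen T p -> u p = uc p) ->
  regular_data T sigma M uc wt ux -> W12_L2 T u ut ->
  {ae mu, forall t, `]0, T[%classic t ->
    {ae mu, forall x, Omega x -> ut (t, x) = wt (t, x)}}.
Proof.
move=> uE rd; apply: (W12_L2_ae T0 (rd_cu rd) (rd_cut rd) uE).
exact: rd_dt rd.
Qed.

Let ae_dx (u ux uc wt wx : R * R -> R) : (forall p, Qopen T p -> u p = uc p) ->
  regular_data T sigma M uc wt wx -> Linfty_H1 T u ux ->
  {ae mu, forall t, `]0, T[%classic t ->
    {ae mu, forall x, Omega x -> ux (t, x) = wx (t, x)}}.
Proof.
move=> uE rd [_ _ [K]]; apply: ae_imp => t H tT.
have [H1u _] := H tT.
apply: (H1_deriv_ae H1u (continuous_slice2 (t := t) (rd_cu rd))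
  (continuous_slice2 (t := t) (rd_cux rd))).
  by move=> x xI; apply: uE.
by move=> x xI; exact: (rd_dx rd tT xI).
Qed.

Let meas_cont (f : R * R -> R) t : continuous f -> measurable_fun Omega (fun x => f (t, x)).
Proof.
by move=> cf; apply: measurable_funTS; apply: continuous_measurable_fun;
  exact: continuous_slice2.
Qed.

(** For almost every t the weak derivatives may be replaced by the continuous
classical ones in the weak equation. *)
Lemma eta_natural_flux : {ae mu, forall t, `]0, T[%classic t -> natural eta_flux eta_source t}.
Proof.
have [etat [etax [thetat [thetax [[W1 W2] [Li1 Li2] _ weak _]]]]] := sol.
have A1 := ae_dt (@clE eta) rde W1.
have A2 := ae_dx (@clE eta) rde Li1.
have A3 := ae_dx (@clE theta) rdt Li2.
have := ae_and (ae_and A1 A2) (ae_and A3 weak).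
apply: ae_imp => t [[H1 H2] [H3 H4]] tT.
move: (H1 tT) (H2 tT) (H3 tT) (H4 tT) => {}H1 {}H2 {}H3 {}H4.
have [_ [met _] _] := W1; have [_ mex _] := Li1; have [meta _ _] := Li1.
have [_ mtx _] := Li2.
apply: (@natural_flux R (fun x => eta_flux (t, x)) (fun x => eta_source (t, x))).
- by apply: continuous_slice2; exact: eta_flux_continuous.
- by apply: continuous_slice2; exact: eta_source_continuous.
move=> phi dphi H1phi; have [[mphi _] L2d _] := H1phi.
have mdphi : measurable_fun Omega dphi by have [] := L2d.
rewrite -(H4 phi dphi H1phi); congr (_ + _).
  apply: Rintegral_ae_eq.
  - apply: measurable_funM => //; apply: meas_cont; exact: eta_source_continuous.
  - apply: measurable_funM => //; apply: measurable_funD; last first.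
      apply: measurable_funM; last first.
        apply: (@measurableT_comp _ _ _ _ _ _ (gam eps)).
          by apply: continuous_measurable_fun; exact: gam_continuous.
        exact: measurable_slice tT mtx.
      apply: measurable_funM => //.
      have -> : (fun x => derive1 (alp delta0) (eta (t, x))) = (fun x => eta (t, x)).
        by apply/funext => x; rewrite derive1_alp.
      exact: measurable_slice tT meta.
    apply: measurable_funD; first exact: measurable_slice tT met.
    apply: measurable_funM => //; apply: measurable_funB => //.
    exact: measurable_slice tT meta.
  have := ae_and H1 H3; apply: ae_imp => x [h1 h3] Ox.
  rewrite /eta_source derive1_alp h1 // h3 //.
  by rewrite [eta (t, x)]clE //; split.
transitivity (\int[mu]_(x in Omega) (kappa0 ^+ 2 * (dphi x * ex (t, x)))).
  by apply: eq_Rintegral => x _; rewrite /eta_flux; ring.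
rewrite RintegralZl //; last 2 first.
- exact: measurable_itv.
- apply: (integrable_mul_bounded (K := M)); first exact: L2_integrable.
    by apply: continuous_slice2; exact: rd_cux rde.
  by move=> x; exact: rd_ux rde _.
congr (_ * _); apply: Rintegral_ae_eq.
- by apply: measurable_funM => //; apply: meas_cont; exact: rd_cux rde.
- by apply: measurable_funM => //; exact: measurable_slice tT mex.
by apply: ae_imp H2 => x h Ox; rewrite h // mulrC.
Qed.

Lemma theta_natural_flux :
  {ae mu, forall t, `]0, T[%classic t -> natural theta_flux theta_source t}.
Proof.
have [etat [etax [thetat [thetax [[W1 W2] [Li1 Li2] _ _ weak]]]]] := sol.
have A1 := ae_dt (@clE theta) rdt W2.
have A3 := ae_dx (@clE theta) rdt Li2.
have := ae_and A1 (ae_and A3 weak).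
apply: ae_imp => t [H1 [H3 H4]] tT.
move: (H1 tT) (H3 tT) (H4 tT) => {}H1 {}H3 {}H4.
have [_ [mtt _] _] := W2; have [meta _ _] := Li1.
have [_ mtx _] := Li2.
apply: (@natural_flux R (fun x => theta_flux (t, x)) (fun x => theta_source (t, x))).
- by apply: continuous_slice2; exact: theta_flux_continuous.
- by apply: continuous_slice2; exact: theta_source_continuous.
move=> phi dphi H1phi; have [[mphi _] L2d _] := H1phi.
have mdphi : measurable_fun Omega dphi by have [] := L2d.
have malpha : measurable_fun Omega (fun x => alpha0 (t, x)).
  apply: (eq_measurable_fun (fun x => a0 (t, x))); last exact: meas_cont.
  by move=> x; rewrite inE => Ox; rewrite [RHS]clE //; split.
rewrite -(H4 phi dphi H1phi); congr (_ + _).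
  apply: Rintegral_ae_eq.
  - apply: measurable_funM => //; apply: meas_cont; exact: theta_source_continuous.
  - apply: measurable_funM => //; apply: measurable_funM => //.
    exact: measurable_slice tT mtt.
  apply: ae_imp H1 => x h1 Ox.
  by rewrite /theta_source h1 // [alpha0 (t, x)]clE //; split.
apply: Rintegral_ae_eq.
- by apply: measurable_funM => //; apply: meas_cont; exact: theta_flux_continuous.
- apply: measurable_funM => //; apply: measurable_funD; last first.
    by apply: measurable_funM => //; exact: measurable_slice tT mtx.
  apply: measurable_funM; last first.
    have -> : (fun x => derive1 (gam eps) (thetax (t, x))) = dgam eps \o (fun x => thetax (t, x)).
      by apply/funext => x; rewrite derive1_gam.
    apply: measurableT_comp.
      by apply: continuous_measurable_fun; exact: dgam_continuous.
    exact: measurable_slice tT mtx.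
  apply: measurable_funM => //; apply: measurable_funD => //.
  apply: measurable_funM => //; apply: measurable_funX.
  exact: measurable_slice tT meta.
apply: ae_imp H3 => x h3 Ox.
by rewrite /theta_flux h3 // derive1_gam // [eta (t, x)]clE //; split.
Qed.

End FluxOfSolution.

Section FluxBalanceOfSolution.
Context {R : realType}.
Notation mu := (@lebesgue_measure R).
Variables (T eps delta0 c kappa0 kappa nu L sigma M : R).
Variables (alpha0 : R * R -> R) (eta0 theta0 : R -> R) (eta theta : R * R -> R).
Variables (et ex tt tx : R * R -> R).
Hypotheses (T0 : 0 < T) (eps0 : 0 < eps) (sigma0 : 0 < sigma) (L0 : 0 <= L).
Hypothesis lip : lipschitz_with L (Qopen T) alpha0.
Hypothesis cont : {within Qbar T, continuous alpha0}.
Hypothesis sol : solution_S T eps delta0 c kappa0 kappa nu alpha0 eta0 theta0 eta theta.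
Hypothesis rde : regular_data T sigma M (eta \o clampQ T) et ex.
Hypothesis rdt : regular_data T sigma M (theta \o clampQ T) tt tx.

Lemma eta_flux_balance : exists2 B, 0 <= B & flux_balance T B sigma
  (eta_flux kappa0 ex) (eta_source T eps c kappa eta et tx).
Proof.
have M0 := rd_ge0 rde.
have c0 := normr_ge0 c; have k0 := normr_ge0 kappa.
pose B := M + `|c| * M + `|kappa| * (M * (eps + M) + M * (2 * M)).
have p1 : 0 <= `|c| * M by exact: mulr_ge0.
have p2 : 0 <= `|kappa| * (M * (eps + M) + M * (2 * M)).
  by rewrite !(mulr_ge0, addr_ge0) // ltW.
have B0 : 0 <= B by rewrite /B; lra.
exists B => //; apply: flux_balance_closure => //.
- exact: eta_flux_continuous rde.
- exact: eta_source_continuous rde rdt.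
- move=> t x y tI xI yI; rewrite /eta_source.
  set e := eta \o clampQ T.
  set d := `|y - x|; have d0 : 0 <= d by exact: normr_ge0.
  have h1 := rd_ut_x rde tI xI yI.
  have h2 := rd_u_lip rde tI xI yI.
  have h3 := rd_ux_x rdt tI xI yI.
  have h4 := norm_mulB (e (t, y)) (gam eps (tx (t, y))) (e (t, x)) (gam eps (tx (t, x))).
  have h5 : `|e (t, y) * gam eps (tx (t, y)) - e (t, x) * gam eps (tx (t, x))|
      <= (M * (eps + M) + M * (2 * M)) * d.
    apply: le_trans h4 _.
    have -> : (M * (eps + M) + M * (2 * M)) * d = (M * d) * (eps + M) + M * (2 * M * d) by ring.
    apply: lerD; apply: ler_pM => //.
      rewrite ger0_norm; last exact: ltW (gam_gt0 eps0 _).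
      by apply: le_trans (gam_le eps0 _) _; rewrite lerD2l; exact: rd_ux rdt _.
    - exact: rd_u rde _.
    - exact: le_trans (gam_lipschitz eps0 _ _) h3.
  rewrite (_ : _ - _ = (et (t, y) - et (t, x)) + (c * (e (t, y) - e (t, x))
    + kappa * (e (t, y) * gam eps (tx (t, y)) - e (t, x) * gam eps (tx (t, x))))); last by ring.
  apply: le_trans (ler_normD _ _) _.
  apply: (@le_trans _ _ (M * d `^ sigma + (`|c| * (M * d)
    + `|kappa| * ((M * (eps + M) + M * (2 * M)) * d)))).
    apply: lerD => //; apply: le_trans (ler_normD _ _) _.
    by apply: lerD; rewrite normrM ler_wpM2l.
  have s0 : 0 <= d `^ sigma by exact: powR_ge0.
  rewrite [leRHS]mulrDr; apply: lerD; first by rewrite ler_wpM2r // /B; lra.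
  have -> : `|c| * (M * d) + `|kappa| * ((M * (eps + M) + M * (2 * M)) * d) =
    (`|c| * M + `|kappa| * (M * (eps + M) + M * (2 * M))) * d by ring.
  by rewrite ler_wpM2r // /B; lra.
- exact: (eta_natural_flux T0 eps0 sol rde rdt).
Qed.

Lemma theta_flux_balance : exists2 B, 0 <= B & flux_balance T B sigma
  (theta_flux T eps delta0 kappa nu eta tx) (theta_source T alpha0 tt).
Proof.
have M0 := rd_ge0 rdt.
have [A A0 bA] := comp_clampQ_bounded T0 cont.
have p1 : 0 <= L * M by exact: mulr_ge0.
have p2 : 0 <= A * M by exact: mulr_ge0.
exists (L * M + A * M); first exact: addr_ge0.
apply: flux_balance_closure => //; first exact: addr_ge0.
- exact: theta_flux_continuous rde rdt.
- exact: (theta_source_continuous T0 cont rdt).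
- move=> t x y tI xI yI; rewrite /theta_source.
  set d := `|y - x|; have d0 : 0 <= d by exact: normr_ge0.
  have h1 := rd_ut_x rdt tI xI yI.
  have h2 := lipschitz_closure_x T0 lip cont L0 tI xI yI.
  apply: le_trans (norm_mulB _ _ _ _) _.
  apply: (@le_trans _ _ ((L * d) * M + A * (M * d `^ sigma))).
    by apply: lerD; apply: ler_pM => //; [exact: rd_ut rdt _|exact: bA].
  have s0 : 0 <= d `^ sigma by exact: powR_ge0.
  rewrite [leRHS]mulrDr [leRHS]addrC; apply: lerD.
    by rewrite mulrAC ler_wpM2r //; lra.
  by rewrite mulrA ler_wpM2r //; lra.
- exact: (theta_natural_flux T0 eps0 cont sol rde rdt).
Qed.

End FluxBalanceOfSolution.

(** * Summation by parts on the edges of the grid *)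

Section EdgeCalculus.
Context {R : realType}.
Implicit Types (f g q phi : nat -> R) (K k : nat).

Definition edge_sum K f : R := \sum_(i < K) f i.

(** The trapezoidal sum over the nodes 0, ..., K written as a sum over the K
edges.  All quadratic quantities become edge sums, so that the energy
inequalities can be verified edge by edge. *)
Definition trap K f : R := edge_sum K (fun i => (f i + f i.+1) / 2).

(** The divergence of an edge flux after even reflection: at the two boundary
nodes the ghost edge carries the opposite flux, which doubles the inner one. *)
Definition edge_div K q k : R :=
  if k == 0%N then 2 * q 0%N else if k == K then - (2 * q K.-1) else q k - q k.-1.

(** The mean over the two edges at a node; at the boundary the ghost edge
carries the same value as its mirror image. *)
Definition edge_avg K g k : R :=
  if k == 0%N then g 0%N else if k == K then g K.-1 else (g k + g k.-1) / 2.

Lemma edge_sumD K f g : edge_sum K (fun i => f i + g i) = edge_sum K f + edge_sum K g.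
Proof. exact: big_split. Qed.

Lemma edge_sumZ K (a : R) f : edge_sum K (fun i => a * f i) = a * edge_sum K f.
Proof. by rewrite /edge_sum mulr_sumr. Qed.

Lemma edge_sum_le K f g : (forall i, (i < K)%N -> f i <= g i) ->
  edge_sum K f <= edge_sum K g.
Proof. by move=> fg; apply: ler_sum => i _; exact: fg. Qed.

Lemma edge_sum_eq K f g : (forall i, (i < K)%N -> f i = g i) ->
  edge_sum K f = edge_sum K g.
Proof. by move=> fg; apply: eq_bigr => i _; exact: fg. Qed.

Lemma edge_sum_ge0 K f : (forall i, (i < K)%N -> 0 <= f i) -> 0 <= edge_sum K f.
Proof. by move=> f0; apply: sumr_ge0 => i _; exact: f0. Qed.

Lemma edge_sum_cst K (a : R) : edge_sum K (fun=> a) = K%:R * a.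
Proof. by rewrite /edge_sum sumr_const card_ord mulr_natl. Qed.

Lemma trapD K f g : trap K (fun k => f k + g k) = trap K f + trap K g.
Proof. by rewrite /trap -edge_sumD; apply: edge_sum_eq => i _; field. Qed.

Lemma trapZ K (a : R) f : trap K (fun k => a * f k) = a * trap K f.
Proof. by rewrite /trap -edge_sumZ; apply: edge_sum_eq => i _; field. Qed.

Lemma trap_le K f g : (forall k, (k <= K)%N -> f k <= g k) -> trap K f <= trap K g.
Proof.
move=> fg; apply: edge_sum_le => i iK.
by rewrite ler_pM2r ?invr_gt0 // lerD // fg // ltnW.
Qed.

Lemma trap_eq K f g : (forall k, (k <= K)%N -> f k = g k) -> trap K f = trap K g.
Proof. by move=> fg; apply/eqP; rewrite eq_le !trap_le // => k kK; rewrite fg. Qed.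

Lemma trap_ge0 K f : (forall k, (k <= K)%N -> 0 <= f k) -> 0 <= trap K f.
Proof.
move=> f0; apply: edge_sum_ge0 => i iK.
by rewrite divr_ge0 // addr_ge0 // f0 // ltnW.
Qed.

Lemma trap_nodal K f :
  trap K.+1 f = f 0%N / 2 + \sum_(1 <= k < K.+1) f k + f K.+1 / 2.
Proof.
elim: K => [|K IH].
  by rewrite /trap /edge_sum big_ord1 /= big_geq // addr0 mulrDl.
have -> : trap K.+2 f = trap K.+1 f + (f K.+1 + f K.+2) / 2.
  by rewrite /trap /edge_sum [LHS]big_ord_recr.
rewrite IH.
by rewrite [in RHS]big_nat_recr //=; field.
Qed.

Lemma trapsumE K (f : int -> R) : (0 < K)%N ->
  trapsum K f = trap K (fun k => f k%:Z).
Proof. by case: K => // K _; rewrite trap_nodal. Qed.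

(** The doubled boundary fluxes of edge_div compensate the half weights of the
trapezoidal sum, so no boundary term remains. *)
Lemma trap_edge_div K q phi : (0 < K)%N ->
  trap K (fun k => phi k * edge_div K q k)
  = - edge_sum K (fun i => q i * (phi i.+1 - phi i)).
Proof.
case: K => // K _; rewrite trap_nodal /edge_div /= eqxx.
have -> : \sum_(1 <= k < K.+1) phi k * (if k == 0%N then 2 * q 0%N
    else if k == K.+1 then - (2 * q K) else q k - q k.-1)
  = \sum_(1 <= k < K.+1) phi k * (q k - q k.-1).
  rewrite !big_nat; apply: eq_bigr => k /andP[k1 kK].
  by rewrite gtn_eqF // ltn_eqF.
rewrite /edge_sum; elim: K => [|K IH].
  by rewrite big_geq // big_ord1; field.
rewrite big_nat_recr //= big_ord_recr /= opprD -IH; by field.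
Qed.

Lemma trap_edge_avg K g phi : (0 < K)%N ->
  trap K (fun k => phi k * edge_avg K g k)
  = edge_sum K (fun i => g i * ((phi i + phi i.+1) / 2)).
Proof.
case: K => // K _; rewrite trap_nodal /edge_avg /= eqxx.
have -> : \sum_(1 <= k < K.+1) phi k * (if k == 0%N then g 0%N
    else if k == K.+1 then g K else (g k + g k.-1) / 2)
  = \sum_(1 <= k < K.+1) phi k * ((g k + g k.-1) / 2).
  rewrite !big_nat; apply: eq_bigr => k /andP[k1 kK].
  by rewrite gtn_eqF // ltn_eqF.
rewrite /edge_sum; elim: K => [|K IH].
  by rewrite big_geq // big_ord1; field.
rewrite big_nat_recr //= big_ord_recr /= -IH; by field.
Qed.

End EdgeCalculus.

Section SchemeOnEdges.
Context {R : realType}.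
Variables (K : nat) (h : R).
Hypotheses (K0 : (0 < K)%N) (h0 : 0 < h).
Implicit Types (V W : int -> R).

Definition slope V (i : nat) : R := (V i.+1%:Z - V i%:Z) / h.

Lemma dcent_eq0 V k : dcent h V k = 0 -> V (k + 1) = V (k - 1).
Proof.
rewrite /dcent => /eqP; rewrite mulf_eq0 invr_eq0 mulf_eq0 pnatr_eq0 (gt_eqF h0) /=.
by rewrite orbF subr_eq0 => /eqP.
Qed.

(** The ghost conditions give both neighbours of a node in the three possible
positions, for two grid functions at once. *)
Lemma node_cases V W k : (k <= K)%N ->
  dcent h V 0 = 0 -> dcent h V K%:Z = 0 -> dcent h W 0 = 0 -> dcent h W K%:Z = 0 ->
  [\/ k = 0%N /\ (V (k%:Z + 1) = V 1 /\ V (k%:Z - 1) = V 1)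
        /\ (W (k%:Z + 1) = W 1 /\ W (k%:Z - 1) = W 1),
      [/\ (0 < k)%N, k = K & (V (k%:Z + 1) = V k.-1%:Z /\ V (k%:Z - 1) = V k.-1%:Z)
        /\ (W (k%:Z + 1) = W k.-1%:Z /\ W (k%:Z - 1) = W k.-1%:Z)] |
      [/\ (0 < k)%N, (k < K)%N & (V (k%:Z + 1) = V k.+1%:Z /\ V (k%:Z - 1) = V k.-1%:Z)
        /\ (W (k%:Z + 1) = W k.+1%:Z /\ W (k%:Z - 1) = W k.-1%:Z)]].
Proof.
move=> kK /dcent_eq0 V0 /dcent_eq0 VK /dcent_eq0 W0 /dcent_eq0 WK.
have predE n : (0 < n)%N -> (n%:Z - 1 = n.-1%:Z :> int) by case: n => // n _; lia.
have [->|k0] := eqVneq k 0%N; first by constructor 1; rewrite -V0 -W0 add0r.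
have {}k0 : (0 < k)%N by rewrite lt0n.
have [->|kK'] := eqVneq k K; first by constructor 2; rewrite VK WK predE.
constructor 3; rewrite k0 ltn_neqAle kK' kK predE //.
by have -> : (k%:Z + 1 = k.+1%:Z :> int) by lia.
Qed.

End SchemeOnEdges.

Section SchemeToEdges.
Context {R : realType}.
Variables (K : nat) (h : R).
Hypotheses (K0 : (0 < K)%N) (h0 : 0 < h).
Implicit Types (V W : int -> R).

Let hn0 : h != 0. Proof. by rewrite gt_eqF. Qed.

Lemma dsecond_edge V k : (k <= K)%N -> dcent h V 0 = 0 -> dcent h V K%:Z = 0 ->
  dsecond h V k%:Z = edge_div K (slope h V) k / h.
Proof.
move=> kK V0 VK; rewrite /dsecond /edge_div /slope.
case: (node_cases K0 h0 kK V0 VK V0 VK) => [[k0 [[-> ->] _]]|[k0 kE [[-> ->] _]]|[k0 kE [[-> ->] _]]].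
- by rewrite k0 /=; field.
- by rewrite kE eqxx gtn_eqF //= prednK //; field.
- by rewrite gtn_eqF // ltn_eqF // prednK //; field.
Qed.

Lemma average_edge (g : R -> R) V k : (forall v, g (- v) = g v) ->
  (k <= K)%N -> dcent h V 0 = 0 -> dcent h V K%:Z = 0 ->
  (g (dplus h V k%:Z) + g (dminus h V k%:Z)) / 2
  = edge_avg K (fun i => g (slope h V i)) k.
Proof.
move=> gN kK V0 VK; rewrite /dplus /dminus /edge_avg /slope.
case: (node_cases K0 h0 kK V0 VK V0 VK) => [[k0 [[-> ->] _]]|[k0 kE [[-> ->] _]]|[k0 kE [[-> ->] _]]].
- by rewrite k0 /= -[X in _ + g X]opprK -mulNr opprB gN; field.
- rewrite kE eqxx gtn_eqF //= prednK //.
  by rewrite -[X in g X + _]opprK -mulNr opprB gN; field.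
- by rewrite gtn_eqF // ltn_eqF // prednK.
Qed.

(** Both one-sided discretizations combine to the divergence of one edge flux whose
mobility is the mean over the two end points of the edge. *)
Lemma flux_edge (al g : R -> R) V W k : (forall v, g (- v) = - g v) ->
  (k <= K)%N -> dcent h V 0 = 0 -> dcent h V K%:Z = 0 ->
  dcent h W 0 = 0 -> dcent h W K%:Z = 0 ->
  dplus h (fun i => al (V i) * g (dminus h W i)) k%:Z
  + dminus h (fun i => al (V i) * g (dplus h W i)) k%:Z
  = 2 * (edge_div K (fun i => (al (V i%:Z) + al (V i.+1%:Z)) / 2 * g (slope h W i)) k / h).
Proof.
move=> gN kK V0 VK W0 WK; rewrite /dplus /dminus addrK subrK.
rewrite /edge_div /slope.
have gopp a b : g ((a - b) / h) = - g ((b - a) / h) by rewrite -gN -mulNr opprB.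
case: (node_cases K0 h0 kK V0 VK W0 WK) => [[k0 [[-> ->] [-> ->]]]
  |[k0 kE [[-> ->] [-> ->]]]|[k0 kE [[-> ->] [-> ->]]]].
- by rewrite k0 /= (gopp (W 0) (W 1)); field.
- rewrite kE eqxx gtn_eqF //= prednK //.
  by rewrite (gopp (W K.-1%:Z) (W K%:Z)); field.
- by rewrite gtn_eqF // ltn_eqF // prednK //; field.
Qed.

End SchemeToEdges.

(** * One-step energy inequalities *)

Section Young.
Context {R : realFieldType}.
Implicit Types a b k : R.

Lemma young_weighted k a b : 0 < k -> 2 * (a * b) <= k * a ^+ 2 + b ^+ 2 / k.
Proof.
move=> k0; rewrite -subr_ge0.
have -> : k * a ^+ 2 + b ^+ 2 / k - 2 * (a * b) = (k * a - b) ^+ 2 / k.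
  by field; rewrite gt_eqF.
by rewrite divr_ge0 ?sqr_ge0 // ltW.
Qed.

Lemma young_weighted_neg k a b : 0 < k -> - (2 * (a * b)) <= k * a ^+ 2 + b ^+ 2 / k.
Proof. by move=> k0; have := young_weighted (- a) b k0; rewrite sqrrN; lra. Qed.

Lemma sqr_le_norm a b : `|a| <= b -> a ^+ 2 <= b ^+ 2.
Proof.
move=> ab; rewrite -(real_normK (num_real a)) lerXn2r ?nnegrE //.
exact: le_trans ab.
Qed.

(** Cauchy-Schwarz for the two-point mean. *)
Lemma mean_mul_sqr (E0 E1 y0 y1 C : R) : `|y0| <= C -> `|y1| <= C ->
  ((E0 * y0 + E1 * y1) / 2) ^+ 2 <= C ^+ 2 * ((E0 ^+ 2 + E1 ^+ 2) / 2).
Proof.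
move=> /sqr_le_norm h0 /sqr_le_norm h1.
have := sqr_ge0 (E0 * y1 - E1 * y0); have := sqr_ge0 E0; have := sqr_ge0 E1.
nra.
Qed.

End Young.

Section EnergySteps.
Context {R : realType}.
Variables (K : nat) (h dt kappa nu C1 s r0 : R).
Hypotheses (K0 : (0 < K)%N) (h0 : 0 < h) (dt0 : 0 < dt) (Kh : h * K%:R = 1).
Hypotheses (kappa_gt0 : 0 < kappa) (nu_gt0 : 0 < nu) (s0 : 0 < s) (s1 : s < 1).

Let B := (kappa * C1 / nu) ^+ 2.
Let snu : 0 < s * nu ^+ 2. Proof. by rewrite mulr_gt0 ?exprn_gt0. Qed.

(** The equation is tested with E' itself.  The diffusion absorbs the flux residual
rho, the damping 2 c + 2 kappa eps is kept, and the explicit treatment of the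
coupling costs the share s of the dissipation of the other error at the old time
level, measured by the slopes d. *)
Lemma eta_energy_step (c kappa0 eps : R) (E E' y r q rho G Gt d : nat -> R) :
  0 < c -> 0 < kappa0 ->
  (forall k, (k <= K)%N -> (E' k - E k) / dt = edge_div K q k / h - c * E' k
     - kappa * ((y k + E' k) * edge_avg K G k - y k * edge_avg K Gt k) - r k) ->
  (forall i, (i < K)%N -> q i = kappa0 ^+ 2 * ((E' i.+1 - E' i) / h) + rho i) ->
  (forall i, (i < K)%N -> eps <= G i) ->
  (forall i, (i < K)%N -> `|G i - Gt i| <= `|d i|) ->
  (forall k, (k <= K)%N -> `|y k| <= C1) ->
  (forall k, (k <= K)%N -> `|r k| <= r0) ->
  (forall i, (i < K)%N -> `|rho i| <= r0) ->
  h * trap K (fun k => E' k ^+ 2) - h * trap K (fun k => E k ^+ 2) <=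
  dt * (s * nu ^+ 2 * (h * edge_sum K (fun i => d i ^+ 2))
    + (B / s - 3 / 2 * c - 2 * kappa * eps) * (h * trap K (fun k => E' k ^+ 2))
    + ((2 * kappa0 ^+ 2)^-1 + 2 / c) * r0 ^+ 2).
Proof.
move=> c0 k00 nodal qE Geps GGt yC rr rhor.
pose m f i := (f i ^+ 2 + f i.+1 ^+ 2) / 2 : R.
have kk : 0 < 2 * kappa0 ^+ 2 by rewrite mulr_gt0 ?exprn_gt0.
have dtV : 0 < dt^-1 by rewrite invr_gt0.
have test : (trap K (fun k => E' k ^+ 2) - trap K (fun k => E k ^+ 2)) / dt <=
    2 * trap K (fun k => E' k * (edge_div K q k / h - c * E' k
     - kappa * ((y k + E' k) * edge_avg K G k - y k * edge_avg K Gt k) - r k)).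
  rewrite -trapZ -mulN1r -trapZ -trapD [leLHS]mulrC -trapZ.
  apply: trap_le => k kK; rewrite -nodal //.
  rewrite (_ : 2 * _ = dt^-1 * (2 * (E' k * (E' k - E k)))); last by field; rewrite gt_eqF.
  by rewrite ler_pM2l //; have := sqr_ge0 (E' k - E k); nra.
have expand : 2 * trap K (fun k => E' k * (edge_div K q k / h - c * E' k
     - kappa * ((y k + E' k) * edge_avg K G k - y k * edge_avg K Gt k) - r k))
  = edge_sum K (fun i => - (2 * (q i * ((E' i.+1 - E' i) / h)))
      + (- (2 * kappa) * (G i * ((E' i * (y i + E' i) + E' i.+1 * (y i.+1 + E' i.+1)) / 2))
      + (2 * kappa * (Gt i * ((E' i * y i + E' i.+1 * y i.+1) / 2))
      + ((- (2 * c) * m E' i) + - 2 * ((E' i * r i + E' i.+1 * r i.+1) / 2))))).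
  have -> : trap K (fun k => E' k * (edge_div K q k / h - c * E' k
     - kappa * ((y k + E' k) * edge_avg K G k - y k * edge_avg K Gt k) - r k))
   = trap K (fun k => h^-1 * (E' k * edge_div K q k)
      + (- kappa * ((E' k * (y k + E' k)) * edge_avg K G k)
      + (kappa * ((E' k * y k) * edge_avg K Gt k)
      + (- c * (E' k ^+ 2) + - 1 * (E' k * r k))))).
    by apply: trap_eq => k _; ring.
  rewrite !trapD !trapZ trap_edge_div // !trap_edge_avg // !edge_sumD.
  rewrite !mulrDr; congr (_ + (_ + (_ + (_ + _)))).
  - rewrite !mulrN mulrA -mulNr -edge_sumZ; apply: edge_sum_eq => i _.
    by field; rewrite gt_eqF.
  - by rewrite -!edge_sumZ; apply: edge_sum_eq => i _; field.
  - by rewrite -!edge_sumZ; apply: edge_sum_eq => i _; field.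
  - by rewrite /trap -!edge_sumZ; apply: edge_sum_eq => i _; rewrite /m; field.
  - by rewrite /trap -!edge_sumZ; apply: edge_sum_eq => i _; field.
have bound : 2 * trap K (fun k => E' k * (edge_div K q k / h - c * E' k
     - kappa * ((y k + E' k) * edge_avg K G k - y k * edge_avg K Gt k) - r k))
  <= s * nu ^+ 2 * edge_sum K (fun i => d i ^+ 2)
    + ((B / s - 3 / 2 * c - 2 * kappa * eps) * trap K (fun k => E' k ^+ 2)
    + K%:R * (((2 * kappa0 ^+ 2)^-1 + 2 / c) * r0 ^+ 2)).
  rewrite expand -(edge_sum_cst K) /trap -!edge_sumZ -!edge_sumD.
  apply: edge_sum_le => i iK; rewrite qE //.
  set D := (E' i.+1 - E' i) / h.
  have iK' : (i <= K)%N by exact: ltnW.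
  have h1 : - (2 * ((kappa0 ^+ 2 * D + rho i) * D)) <= (2 * kappa0 ^+ 2)^-1 * r0 ^+ 2.
    have := young_weighted_neg D (rho i) kk.
    have := sqr_le_norm (rhor i iK); rewrite -(ler_pM2l (x := (2 * kappa0 ^+ 2)^-1)) ?invr_gt0 //.
    rewrite [rho i ^+ 2 / _]mulrC; lra.
  have h2 k : (k <= K)%N -> - (2 * (E' k * r k)) <= c / 2 * E' k ^+ 2 + 2 / c * r0 ^+ 2.
    move=> kK; have c2 : 0 < c / 2 by rewrite divr_gt0.
    have := young_weighted_neg (E' k) (r k) c2.
    have := sqr_le_norm (rr k kK); rewrite -(ler_pM2l (x := 2 / c)) ?divr_gt0 //.
    rewrite [r k ^+ 2 / _]mulrC invf_div; lra.
  have h3 : 2 * (kappa * (Gt i - G i) * ((E' i * y i + E' i.+1 * y i.+1) / 2))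
      <= s * nu ^+ 2 * d i ^+ 2 + B / s * m E' i.
    have w2 := mean_mul_sqr (E' i) (E' i.+1) (yC i iK') (yC i.+1 iK).
    set w := (_ + _) / 2 in w2 *.
    have g2 : (Gt i - G i) ^+ 2 <= d i ^+ 2.
      by rewrite -[d i ^+ 2](real_normK (num_real (d i))); apply: sqr_le_norm; rewrite distrC GGt.
    have := young_weighted (Gt i - G i) (kappa * w) snu.
    have : (kappa * w) ^+ 2 / (s * nu ^+ 2) <= B / s * m E' i.
      rewrite (_ : B / s * m E' i = kappa ^+ 2 / (s * nu ^+ 2) * (C1 ^+ 2 * m E' i)); last first.
        by rewrite /B; field; rewrite !gt_eqF.
      rewrite (_ : _ / _ = kappa ^+ 2 / (s * nu ^+ 2) * w ^+ 2); last first.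
        by field; rewrite !gt_eqF.
      by rewrite ler_wpM2l // divr_ge0 ?sqr_ge0 // ltW.
    move: g2; rewrite -(ler_pM2l snu); lra.
  have h4 : 2 * kappa * eps * m E' i <= 2 * kappa * G i * m E' i.
    have m0 : 0 <= m E' i by rewrite divr_ge0 ?addr_ge0 ?sqr_ge0.
    by rewrite ler_wpM2r // ler_wpM2l ?Geps // mulr_ge0 // ltW.
  have := h2 i iK'; have := h2 i.+1 iK.
  move: h1 h3 h4; rewrite /m; set w1 := kappa0 ^+ 2 * D + _ => h1 h3 h4 h5 h6.
  lra.
have := le_trans test bound; rewrite ler_pdivrMr // => H.
have := H; rewrite -(ler_pM2l h0).
have -> : h * ((s * nu ^+ 2 * edge_sum K (fun i => d i ^+ 2)
    + ((B / s - 3 / 2 * c - 2 * kappa * eps) * trap K (fun k => E' k ^+ 2)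
    + K%:R * (((2 * kappa0 ^+ 2)^-1 + 2 / c) * r0 ^+ 2))) * dt)
  = dt * (s * nu ^+ 2 * (h * edge_sum K (fun i => d i ^+ 2))
    + (B / s - 3 / 2 * c - 2 * kappa * eps) * (h * trap K (fun k => E' k ^+ 2))
    + (h * K%:R) * (((2 * kappa0 ^+ 2)^-1 + 2 / c) * r0 ^+ 2)) by ring.
by rewrite Kh mul1r mulrBr.
Qed.


(** The equation is tested with F'.  Monotonicity of P removes the nonlinear flux
difference; what remains of it is the difference of the mobilities A - At, which
is linear in the error E.  From the dissipation 2 nu ^+ 2 an amount s nu ^+ 2
pays for that term, 2 (1 - s) nu ^+ 2 pays for the flux residual, and s nu ^+ 2
is left to compensate the old slopes in the other inequality. *)
Lemma theta_energy_step (delta0 L : R) (a a' F F' E y r q rho A At P Pt : nat -> R) :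
  0 < delta0 -> 0 <= L ->
  (forall k, (k <= K)%N ->
     a' k * ((F' k - F k) / dt) = edge_div K q k / h - r k) ->
  (forall i, (i < K)%N -> q i = kappa * (A i * P i - At i * Pt i)
     + nu ^+ 2 * ((F' i.+1 - F' i) / h) + rho i) ->
  (forall i, (i < K)%N -> 0 <= A i) ->
  (forall i, (i < K)%N -> 0 <= (P i - Pt i) * ((F' i.+1 - F' i) / h)) ->
  (forall i, (i < K)%N -> `|Pt i| <= 1) ->
  (forall i, (i < K)%N -> A i - At i = (E i * y i + E i.+1 * y i.+1) / 2) ->
  (forall k, (k <= K)%N -> `|y k| <= C1) ->
  (forall k, (k <= K)%N -> `|r k| <= r0) ->
  (forall i, (i < K)%N -> `|rho i| <= r0) ->
  (forall k, (k <= K)%N -> delta0 <= a k) ->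
  (forall k, (k <= K)%N -> delta0 <= a' k) ->
  (forall k, (k <= K)%N -> a' k <= a k + L * dt) ->
  h * trap K (fun k => a' k * F' k ^+ 2) - h * trap K (fun k => a k * F k ^+ 2) <=
  dt * (L / delta0 * (h * trap K (fun k => a k * F k ^+ 2))
    + delta0^-1 * (h * trap K (fun k => a' k * F' k ^+ 2))
    + B / s * (h * trap K (fun k => E k ^+ 2))
    - s * nu ^+ 2 * (h * edge_sum K (fun i => ((F' i.+1 - F' i) / h) ^+ 2))
    + ((2 * (1 - s) * nu ^+ 2)^-1 + 1) * r0 ^+ 2).
Proof.
move=> d0 L0 nodal qE A0 mono Pt1 AAt yC rr rhor ad a'd aL.
pose m f i := (f i ^+ 2 + f i.+1 ^+ 2) / 2 : R.
have nu2 : 0 < nu ^+ 2 by rewrite exprn_gt0.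
have kk : 0 < 2 * (1 - s) * nu ^+ 2 by rewrite !mulr_gt0 // subr_gt0.
have dtV : 0 < dt^-1 by rewrite invr_gt0.
have test : (trap K (fun k => a' k * F' k ^+ 2) - trap K (fun k => a k * F k ^+ 2)) / dt <=
    L / delta0 * trap K (fun k => a k * F k ^+ 2)
    + 2 * trap K (fun k => F' k * (edge_div K q k / h - r k)).
  rewrite -!trapZ -mulN1r -trapZ -trapD [leLHS]mulrC -trapZ -trapD.
  apply: trap_le => k kK; rewrite -nodal //.
  have ak := ad k kK; have a'k := a'd k kK; have aLk := aL k kK.
  have a'0 : 0 <= a' k := le_trans (ltW d0) a'k.
  have n1 : a' k * (F' k ^+ 2 - F k ^+ 2) <= 2 * (a' k * (F' k * (F' k - F k))).
    rewrite (_ : 2 * _ = a' k * (2 * (F' k * (F' k - F k)))); last by ring.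
    by rewrite ler_wpM2l //; have := sqr_ge0 (F' k - F k); nra.
  have n2 : (a' k - a k) * F k ^+ 2 <= dt * (L / delta0 * (a k * F k ^+ 2)).
    apply: (@le_trans _ _ (L * dt * F k ^+ 2)).
      by rewrite ler_wpM2r ?sqr_ge0 //; lra.
    rewrite (_ : dt * _ = L * dt * (a k / delta0 * F k ^+ 2)); last by field; rewrite gt_eqF.
    rewrite ler_wpM2l ?(mulr_ge0 L0 (ltW dt0)) //.
    by rewrite ler_peMl ?sqr_ge0 // ler_pdivlMr // mul1r.
  rewrite mulrC ler_pdivrMr //.
  rewrite (_ : (_ + _) * dt = dt * (L / delta0 * (a k * F k ^+ 2))
      + 2 * (a' k * (F' k * (F' k - F k)))); last by field; rewrite !gt_eqF.
  lra.
have expand : 2 * trap K (fun k => F' k * (edge_div K q k / h - r k))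
  = edge_sum K (fun i => - (2 * (q i * ((F' i.+1 - F' i) / h)))
      + - 2 * ((F' i * r i + F' i.+1 * r i.+1) / 2)).
  have -> : trap K (fun k => F' k * (edge_div K q k / h - r k))
   = trap K (fun k => h^-1 * (F' k * edge_div K q k) + - 1 * (F' k * r k)).
    by apply: trap_eq => k _; ring.
  rewrite !trapD !trapZ trap_edge_div // !edge_sumD mulrDr; congr (_ + _).
  - rewrite !mulrN mulrA -mulNr -edge_sumZ; apply: edge_sum_eq => i _.
    by field; rewrite gt_eqF.
  - by rewrite /trap -!edge_sumZ; apply: edge_sum_eq => i _; field.
have bound : 2 * trap K (fun k => F' k * (edge_div K q k / h - r k)) <=
    delta0^-1 * trap K (fun k => a' k * F' k ^+ 2)
    + (B / s * trap K (fun k => E k ^+ 2)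
    + (- (s * nu ^+ 2) * edge_sum K (fun i => ((F' i.+1 - F' i) / h) ^+ 2)
    + K%:R * (((2 * (1 - s) * nu ^+ 2)^-1 + 1) * r0 ^+ 2))).
  rewrite expand -(edge_sum_cst K) /trap -!edge_sumZ -!edge_sumD.
  apply: edge_sum_le => i iK; rewrite qE //.
  set D := (F' i.+1 - F' i) / h.
  have iK' : (i <= K)%N by exact: ltnW.
  have h1 : - (2 * (rho i * D)) <= 2 * (1 - s) * nu ^+ 2 * D ^+ 2
      + (2 * (1 - s) * nu ^+ 2)^-1 * r0 ^+ 2.
    have := young_weighted_neg D (rho i) kk.
    have := sqr_le_norm (rhor i iK).
    rewrite -(ler_pM2l (x := (2 * (1 - s) * nu ^+ 2)^-1)) ?invr_gt0 //.
    rewrite [rho i ^+ 2 / _]mulrC; lra.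
  have h2 k : (k <= K)%N ->
      - (2 * (F' k * r k)) <= delta0^-1 * (a' k * F' k ^+ 2) + r0 ^+ 2.
    move=> kK; have := young_weighted_neg (F' k) (r k) ltr01.
    rewrite mul1r divr1.
    have := sqr_le_norm (rr k kK).
    have : F' k ^+ 2 <= delta0^-1 * (a' k * F' k ^+ 2).
      by rewrite mulrA ler_peMl ?sqr_ge0 // mulrC ler_pdivlMr // mul1r a'd.
    lra.
  have h3 : - (2 * (kappa * (A i - At i) * Pt i * D))
      <= s * nu ^+ 2 * D ^+ 2 + B / s * m E i.
    have w2 := mean_mul_sqr (E i) (E i.+1) (yC i iK') (yC i.+1 iK).
    rewrite -AAt // in w2.
    have := young_weighted_neg D (kappa * ((A i - At i) * Pt i)) snu.
    have w3 : ((A i - At i) * Pt i) ^+ 2 <= C1 ^+ 2 * m E i.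
      apply: le_trans w2; rewrite exprMn ler_piMr ?sqr_ge0 //.
      by have := sqr_le_norm (Pt1 i iK); rewrite expr1n.
    have : (kappa * ((A i - At i) * Pt i)) ^+ 2 / (s * nu ^+ 2) <= B / s * m E i.
      rewrite (_ : B / s * m E i = kappa ^+ 2 / (s * nu ^+ 2) * (C1 ^+ 2 * m E i)); last first.
        by rewrite /B; field; rewrite !gt_eqF.
      rewrite (_ : _ / _ = kappa ^+ 2 / (s * nu ^+ 2) * ((A i - At i) * Pt i) ^+ 2); last first.
        by field; rewrite !gt_eqF.
      by rewrite ler_wpM2l // divr_ge0 ?sqr_ge0 // ltW.
    rewrite (_ : 2 * (kappa * (A i - At i) * Pt i * D) = 2 * (D * (kappa * ((A i - At i) * Pt i)))); last by ring.
    lra.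
  have h4 : 0 <= 2 * (kappa * A i * ((P i - Pt i) * D)).
    rewrite mulr_ge0 // mulr_ge0 ?mono // mulr_ge0 ?A0 //; exact: ltW.
  have E1 : - (2 * ((kappa * (A i * P i - At i * Pt i) + nu ^+ 2 * D + rho i) * D))
    = - (2 * (kappa * A i * ((P i - Pt i) * D)))
      + - (2 * (kappa * (A i - At i) * Pt i * D)) - 2 * nu ^+ 2 * D ^+ 2
      + - (2 * (rho i * D)) by ring.
  rewrite E1; have := h2 i iK'; have := h2 i.+1 iK.
  move: h1 h3 h4; rewrite /m.
  set z1 := 2 * (kappa * A i * _); set z2 := 2 * (kappa * (A i - At i) * _ * D).
  set z3 := 2 * (rho i * D).
  set z4 := delta0^-1 * (a' i * _); set z5 := delta0^-1 * (a' i.+1 * _).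
  move=> h1 h3 h4 h5 h6.
  have E2 : 2 * (1 - s) * nu ^+ 2 * D ^+ 2 = 2 * nu ^+ 2 * D ^+ 2 - 2 * (s * nu ^+ 2 * D ^+ 2) by ring.
  rewrite E2 in h1.
  have E3 : delta0^-1 * ((a' i * F' i ^+ 2 + a' i.+1 * F' i.+1 ^+ 2) / 2) = (z4 + z5) / 2.
    by rewrite /z4 /z5; field; rewrite gt_eqF.
  rewrite E3; lra.
have := le_trans test (lerD (lexx _) bound); rewrite ler_pdivrMr // => H.
have := H; rewrite -(ler_pM2l h0) mulrBr => {}H; apply: le_trans H _.
move: (_^-1 + 1) => k.
have kr : k * r0 ^+ 2 = (h * K%:R) * (k * r0 ^+ 2) by rewrite Kh mul1r.
by rewrite [in leRHS]kr le_eqVlt; apply/orP; left; apply/eqP; ring.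
Qed.

End EnergySteps.

(** * A discrete Gronwall inequality *)

Section DiscreteGronwall.
Context {R : realType}.

(** With m = a dt <= 1 / 2 and w = rho / a the recursion implies
Z j.+1 + w / 2 <= (1 + 4 m) (Z j + w / 2). *)
Lemma discrete_gronwall (N : nat) (a dt rho : R) (Z : nat -> R) :
  0 < a -> 0 < dt -> a * dt <= 1 / 2 -> 0 <= rho -> Z 0%N = 0 ->
  (forall j, 0 <= Z j) ->
  (forall j, (j < N)%N -> Z j.+1 - Z j <= dt * (a * Z j.+1 + a * Z j + rho)) ->
  forall j, (j <= N)%N -> Z j <= expR (4 * a * (N%:R * dt)) * (rho / a).
Proof.
move=> a0 dt0 adt rho0 Z0 Zge step.
pose w := rho / a; have w0 : 0 <= w by rewrite divr_ge0 // ltW.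
pose m := a * dt; have m0 : 0 < m by rewrite mulr_gt0.
have E : dt * rho = m * w by rewrite /m /w; field; rewrite gt_eqF.
have grow j : (j <= N)%N -> Z j + w / 2 <= (1 + 4 * m) ^+ j * (w / 2).
  elim: j => [_|j IH jN]; first by rewrite Z0 expr0; lra.
  have {}IH := IH (ltnW jN).
  have st := step j jN; have Zj := Zge j; have Zj' := Zge j.+1.
  have st1 : (1 - m) * Z j.+1 <= (1 + m) * Z j + m * w.
    by rewrite -E /m; lra.
  have m1 : m <= 1 / 2 by [].
  have st2 : Z j.+1 <= (1 + 2 * m) * ((1 + m) * Z j + m * w).
    have : (1 + 2 * m) * ((1 - m) * Z j.+1) <= (1 + 2 * m) * ((1 + m) * Z j + m * w).
      by rewrite ler_wpM2l //; lra.
    have : 0 <= m * (1 - 2 * m) * Z j.+1.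
      by apply: mulr_ge0 => //; apply: mulr_ge0; lra.
    lra.
  have st3 : Z j.+1 + w / 2 <= (1 + 4 * m) * (Z j + w / 2).
    have p1 : 0 <= m * (1 - 2 * m) * Z j by apply: mulr_ge0 => //; apply: mulr_ge0; lra.
    have p2 : 0 <= m * (1 - 2 * m) * w by apply: mulr_ge0 => //; apply: mulr_ge0; lra.
    lra.
  rewrite exprS -mulrA; apply: le_trans st3 _.
  by rewrite ler_wpM2l //; lra.
move=> j jN; have g := grow j jN.
have e1 : (1 + 4 * m) ^+ j <= expR (4 * a * (N%:R * dt)).
  apply: (@le_trans _ _ (expR (4 * m) ^+ j)).
    have q1 : 1 + 4 * m <= expR (4 * m) by exact: expR_ge1Dx.
    have q0 : 0 <= 1 + 4 * m by lra.
    by rewrite lerXn2r ?nnegrE ?expR_ge0.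
  rewrite -expRM_natl ler_expR /m.
  rewrite (_ : 4 * a * _ = N%:R * (4 * (a * dt))); last by ring.
  by rewrite ler_wpM2r ?ler_nat // !mulr_ge0 // ltW.
have e2 : (1 + 4 * m) ^+ j * (w / 2) <= expR (4 * a * (N%:R * dt)) * (w / 2).
  by rewrite ler_wpM2r // divr_ge0.
have e0 := expR_ge0 (4 * a * (N%:R * dt)).
have e3 : expR (4 * a * (N%:R * dt)) * (w / 2) <= expR (4 * a * (N%:R * dt)) * w.
  by rewrite ler_wpM2l //; lra.
rewrite -/w; lra.
Qed.

End DiscreteGronwall.

(** * Consistency of the scheme *)

Section Consistency.
Context {R : realType}.

Lemma edge_div_lin K (f g : nat -> R) k :
  edge_div K (fun i => f i - g i) k = edge_div K f k - edge_div K g k.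
Proof. by rewrite /edge_div; case: ifP => _; [ring|case: ifP => _; ring]. Qed.

Lemma edge_avg_close K (g : nat -> R) k (v b : R) : (0 < K)%N -> (k <= K)%N ->
  (forall i, (i < K)%N -> (i <= k <= i.+1)%N -> `|g i - v| <= b) ->
  `|edge_avg K g k - v| <= b.
Proof.
move=> K0 kK close; rewrite /edge_avg.
have [k0|k0] := eqVneq k 0%N; first by apply: close => //; rewrite k0.
have {}k0 : (0 < k)%N by rewrite lt0n.
have [kE|kE] := eqVneq k K.
  by apply: close; rewrite ?prednK // kE leqnn leq_pred.
have kK' : (k < K)%N by rewrite ltn_neqAle kE.
have c1 := close k kK' (introT andP (conj (leqnn k) (leqnSn k))).
have c2 : `|g k.-1 - v| <= b.
  by apply: close; rewrite ?prednK // ?leqnn ?leq_pred // ltnW // prednK.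
rewrite (_ : _ - v = ((g k - v) + (g k.-1 - v)) / 2); last by field.
rewrite normrM normfV (ger0_norm (x := 2)) // ler_pdivrMr //.
by apply: le_trans (ler_normD _ _) _; lra.
Qed.

Variables (T B sigma : R) (F G : R * R -> R) (K : nat) (h t : R).
Hypotheses (B0 : 0 <= B) (sigma0 : 0 < sigma) (K0 : (0 < K)%N) (h0 : 0 < h).
Hypotheses (Kh : h * K%:R = 1) (tI : 0 <= t <= T).

Lemma node_in k : (k <= K)%N -> 0 <= k%:R * h <= 1.
Proof.
move=> kK; apply/andP; split; first by rewrite mulr_ge0 // ltW.
by rewrite [leLHS]mulrC -[leRHS]Kh ler_wpM2l ?ler_nat // ltW.
Qed.

Lemma nodeS k : k.+1%:R * h = k%:R * h + h :> R.
Proof. by rewrite -natr1; ring. Qed.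

Lemma half_node_in i : (i < K)%N -> 0 <= i%:R * h + h / 2 <= 1.
Proof.
move=> iK; have /andP[i0 _] := node_in (ltnW iK).
have /andP[_] := node_in iK; rewrite nodeS.
move: (i%:R * h) i0 => x i0 i1; have := h0.
by move=> h0'; apply/andP; split; lra.
Qed.

Hypothesis balance : flux_balance T B sigma F G.

(** The discrete divergence of the exact flux, taken at the midpoints of the edges,
is the source at the node.  The cell of a boundary node is half as long, and
zero flux through the end point makes the doubled flux consistent there. *)
Lemma edge_div_flux k : (k <= K)%N ->
  `|edge_div K (fun i => F (t, i%:R * h + h / 2)) k / h - G (t, k%:R * h)|
  <= B * (h `^ sigma + h).
Proof.
move=> kK; have [F0 F1 bal] := balance tI.
have h1 : h <= 1 by have /andP[_] := @node_in 1 K0; rewrite mul1r.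
have half : (h / 2) `^ sigma + h / 2 <= h `^ sigma + h.
  apply: lerD; last by rewrite ler_pdivrMr //; have := h0; lra.
  have q0 : 0 <= h / 2 by rewrite divr_ge0 // ltW.
  have q1 : h / 2 <= h by rewrite ler_pdivrMr //; have := h0; lra.
  by apply: ge0_ler_powR; rewrite ?nnegrE //; exact: ltW.
have core (d e : R) : 0 < d -> `|e| <= B * (h `^ sigma + h) * d ->
    `|e / d| <= B * (h `^ sigma + h).
  by move=> d0; rewrite normrM normfV (gtr0_norm d0) ler_pdivrMr.
have h20 : 0 < h / 2 by rewrite divr_gt0.
rewrite /edge_div.
have [->|k0] := eqVneq k 0%N.
  rewrite !mul0r add0r.
  rewrite (_ : _ - _ = (F (t, h / 2) - F (t, 0) - (h / 2 - 0) * G (t, 0)) / (h / 2)); last first.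
    by rewrite F0; field; rewrite gt_eqF.
  apply: core => //.
  have hh : h / 2 <= 1 by lra.
  apply: le_trans (bal 0 0 (h / 2) (lexx _) (lexx _) (ltW h20) hh) _.
  by rewrite subr0 ler_wpM2r ?ler_wpM2l // ltW.
have {}k0 : (0 < k)%N by rewrite lt0n.
have xk : k%:R * h = k.-1%:R * h + h by rewrite -nodeS prednK.
have [kE|kE] := eqVneq k K.
  have xK : k%:R * h = 1 by rewrite kE mulrC.
  rewrite -kE xK (_ : k.-1%:R * h + h / 2 = 1 - h / 2); last by rewrite xK in xk; lra.
  rewrite (_ : _ - _ = (F (t, 1) - F (t, 1 - h / 2) - (1 - (1 - h / 2)) * G (t, 1)) / (h / 2)); last first.
    by rewrite F1; field; rewrite gt_eqF.
  apply: core => //.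
  have q1 : 0 <= 1 - h / 2 by lra.
  have q2 : 1 - h / 2 <= 1 by lra.
  apply: le_trans (bal _ 1 1 q1 q2 (lexx _) (lexx _)) _.
  rewrite (_ : 1 - (1 - h / 2) = h / 2); last by ring.
  by rewrite ler_wpM2r ?ler_wpM2l // ltW.
have kK' : (k < K)%N by rewrite ltn_neqAle kE.
have /andP[a0 _] := half_node_in (leq_ltn_trans (leq_pred k) kK').
have /andP[_ a1] := half_node_in kK'.
rewrite (_ : k.-1%:R * h + h / 2 = k%:R * h - h / 2) in a0 *; last by rewrite xk; field.
set x := k%:R * h in a0 a1 *.
have x1 : x - h / 2 <= x by lra.
have x2 : x <= x + h / 2 by lra.
have := bal _ _ _ a0 x1 x2 a1.
rewrite (_ : x + h / 2 - (x - h / 2) = h); last by field.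
move=> b.
rewrite (_ : _ - G (t, x) = (F (t, x + h / 2) - F (t, x - h / 2) - h * G (t, x)) / h); last first.
  by field; rewrite gt_eqF.
exact: core.
Qed.

End Consistency.

Section Residuals.
Context {R : realType}.
Variables (T eps delta0 c kappa0 kappa nu sigma M B A : R).
Variables (alpha0 eta theta et ex tt tx : R * R -> R).
Variables (K : nat) (h dt t : R).
Hypotheses (eps0 : 0 < eps) (kappa_gt0 : 0 < kappa) (delta_ge0 : 0 <= delta0).
Hypotheses (B0 : 0 <= B) (sigma0 : 0 < sigma) (K0 : (0 < K)%N) (h0 : 0 < h).
Hypotheses (Kh : h * K%:R = 1) (t0 : 0 <= t) (dt0 : 0 < dt) (tT : t + dt <= T).
Hypothesis A_ge : forall p, `|alpha0 (clampQ T p)| <= A.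
Hypothesis rde : regular_data T sigma M (eta \o clampQ T) et ex.
Hypothesis rdt : regular_data T sigma M (theta \o clampQ T) tt tx.
Hypothesis be : flux_balance T B sigma
  (eta_flux kappa0 ex) (eta_source T eps c kappa eta et tx).
Hypothesis bt : flux_balance T B sigma
  (theta_flux T eps delta0 kappa nu eta tx) (theta_source T alpha0 tt).

Let e := eta \o clampQ T.
Let th := theta \o clampQ T.
Let a0 := alpha0 \o clampQ T.
Let x (k : nat) := k%:R * h.
Let t' := t + dt.
Let rate := h `^ sigma + dt `^ sigma + dt + h + h ^+ 2.

Let t'I : 0 <= t' <= T. Proof. by rewrite /t' tT addr_ge0 // ltW. Qed.
Let tI : 0 <= t <= T.
Proof. by rewrite t0 (le_trans _ tT) // lerDl ltW. Qed.
Let M0 : 0 <= M. Proof. exact: rd_ge0 rde. Qed.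

Lemma slope_close (u ut ux : R * R -> R) (s y : R) i :
  regular_data T sigma M u ut ux -> 0 <= s <= T -> (i < K)%N -> x i <= y <= x i.+1 ->
  `|(u (s, x i.+1) - u (s, x i)) / h - ux (s, y)| <= M * h.
Proof.
move=> rd sI iK /andP[y1 y2].
have /andP[a1 _] := node_in h0 Kh (ltnW iK).
have /andP[_ a2] := node_in h0 Kh iK.
have := rd_u_xx rd sI a1 y1 y2 a2.
have -> : x i.+1 - i%:R * h = h by rewrite /x nodeS; ring.
move=> H; rewrite (_ : _ - _ = (u (s, x i.+1) - u (s, x i) - h * ux (s, y)) / h); last first.
  by field; rewrite gt_eqF.
rewrite normrM normfV (gtr0_norm h0) ler_pdivrMr //.
by apply: le_trans H _; rewrite expr2 mulrA.
Qed.

Lemma time_quotient_close (u ut ux : R * R -> R) k :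
  regular_data T sigma M u ut ux -> (k <= K)%N ->
  `|(u (t', x k) - u (t, x k)) / dt - ut (t', x k)| <= M * dt `^ sigma.
Proof.
move=> rd kK; have xI := node_in h0 Kh kK.
have t't : t' - t = dt by rewrite /t'; ring.
have tt' : t <= t' by rewrite lerDl ltW.
have := rd_u_t rd t0 tt' tT xI; rewrite t't => H.
rewrite (_ : _ - _ = (u (t', x k) - u (t, x k) - dt * ut (t', x k)) / dt); last first.
  by field; rewrite gt_eqF.
rewrite normrM normfV (gtr0_norm dt0) ler_pdivrMr //.
by apply: le_trans H _; rewrite [dt * _]mulrC mulrA.
Qed.

Let hs0 : 0 <= h `^ sigma. Proof. exact: powR_ge0. Qed.
Let ds0 : 0 <= dt `^ sigma. Proof. exact: powR_ge0. Qed.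

Let rate_ge : [/\ h `^ sigma + h <= rate, dt `^ sigma <= rate, h + dt <= rate & h <= rate].
Proof.
have h2 := sqr_ge0 h; have h1 := h0; have dt1 := dt0; have hs := hs0; have ds := ds0.
by rewrite /rate; split; lra.
Qed.

Let edge_mid i : x i <= x i + h / 2 <= x i.+1.
Proof.
have h1 := h0; rewrite /x nodeS; move: (i%:R * h) => y.
by apply/andP; split; lra.
Qed.

(** The defect of the exact solution at a node, when its exact midpoint fluxes are
used instead of difference quotients. *)
Lemma eta_residual k : (k <= K)%N ->
  `|(e (t', x k) - e (t, x k)) / dt
    - edge_div K (fun i => eta_flux kappa0 ex (t', x i + h / 2)) k / h
    + c * (e (t', x k) - 1)
    + kappa * e (t', x k)
      * edge_avg K (fun i => gam eps ((th (t, x i.+1) - th (t, x i)) / h)) k|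
  <= (M + B + kappa * M * M) * rate.
Proof.
move=> kK; have xI := node_in h0 Kh kK.
have [r1 r2 r3 _] := rate_ge.
have h1 := time_quotient_close rde kK.
have h2 := edge_div_flux B0 sigma0 K0 h0 Kh t'I be kK.
set D := edge_div _ _ _ in h2 *.
have h3 : `|edge_avg K (fun i => gam eps ((th (t, x i.+1) - th (t, x i)) / h)) k
    - gam eps (tx (t', x k))| <= M * (h + dt).
  apply: edge_avg_close => // i iK /andP[ik ki].
  apply: le_trans (gam_lipschitz eps0 _ _) _.
  have xik : x i <= x k <= x i.+1.
    by rewrite /x !ler_pM2r // !ler_nat ik.
  have s1 := slope_close rdt tI iK xik.
  have tt' : t <= t' by rewrite lerDl ltW.
  have s2 := rd_ux_t rdt t0 tt' tT xI.
  rewrite (_ : t' - t = dt) in s2; last by rewrite /t'; ring.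
  rewrite (_ : _ - _ = ((th (t, x i.+1) - th (t, x i)) / h - tx (t, x k))
     - (tx (t', x k) - tx (t, x k))); last by ring.
  by apply: le_trans (ler_normB _ _) _; rewrite mulrDr lerD.
set g := edge_avg _ _ _ in h3 *.
rewrite (_ : _ + _ = ((e (t', x k) - e (t, x k)) / dt - et (t', x k))
   + (- (D / h - eta_source T eps c kappa eta et tx (t', x k))
   + kappa * e (t', x k) * (g - gam eps (tx (t', x k))))); last first.
  by rewrite /eta_source -/e; ring.
apply: le_trans (ler_normD _ _) _.
rewrite (_ : (M + B + kappa * M * M) * rate
  = M * rate + (B * rate + kappa * (M * (M * rate)))); last by ring.
apply: lerD; first by apply: le_trans h1 _; rewrite ler_wpM2l.
apply: le_trans (ler_normD _ _) _; apply: lerD.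
  by rewrite normrN; apply: le_trans h2 _; rewrite ler_wpM2l.
rewrite -mulrA normrM (gtr0_norm kappa_gt0) ler_pM2l // normrM.
apply: ler_pM => //; first exact: rd_u rde _.
by apply: le_trans h3 _; rewrite ler_wpM2l.
Qed.

(** Only first order in h and not divided by h: this defect is tested against
difference quotients and absorbed by the diffusion. *)
Lemma eta_flux_residual i : (i < K)%N ->
  `|kappa0 ^+ 2 * ((e (t', x i.+1) - e (t', x i)) / h)
    - eta_flux kappa0 ex (t', x i + h / 2)| <= kappa0 ^+ 2 * M * rate.
Proof.
move=> iK; have [_ _ _ r4] := rate_ge.
rewrite /eta_flux -mulrBr normrM ger0_norm ?sqr_ge0 // -mulrA.
rewrite ler_wpM2l ?sqr_ge0 //; apply: le_trans (slope_close rde t'I iK (edge_mid i)) _.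
by rewrite ler_wpM2l.
Qed.

Lemma theta_residual k : (k <= K)%N ->
  `|a0 (t', x k) * ((th (t', x k) - th (t, x k)) / dt)
    - edge_div K (fun i => theta_flux T eps delta0 kappa nu eta tx (t', x i + h / 2)) k / h|
  <= (A * M + B) * rate.
Proof.
move=> kK; have [r1 r2 _ _] := rate_ge.
have h1 := time_quotient_close rdt kK.
have h2 := edge_div_flux B0 sigma0 K0 h0 Kh t'I bt kK.
set D := edge_div _ _ _ in h2 *.
rewrite (_ : _ - _ = a0 (t', x k) * ((th (t', x k) - th (t, x k)) / dt - tt (t', x k))
  - (D / h - theta_source T alpha0 tt (t', x k))); last first.
  by rewrite /theta_source -/a0; ring.
apply: le_trans (ler_normB _ _) _; rewrite [leRHS]mulrDl; apply: lerD.
  rewrite normrM -mulrA; apply: ler_pM => //; first exact: A_ge.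
  by apply: le_trans h1 _; rewrite ler_wpM2l.
by apply: le_trans h2 _; rewrite ler_wpM2l.
Qed.

Lemma alp_lipschitz (a b : R) : `|a| <= M -> `|b| <= M ->
  `|alp delta0 a - alp delta0 b| <= M * `|a - b|.
Proof.
move=> aM bM; rewrite /alp.
rewrite (_ : _ - _ = (a + b) / 2 * (a - b)); last by field.
rewrite normrM ler_wpM2r // normrM normfV (ger0_norm (x := 2)) // ler_pdivrMr //.
by apply: le_trans (ler_normD _ _) _; lra.
Qed.

Lemma theta_flux_residual i : (i < K)%N ->
  `|kappa * ((alp delta0 (e (t', x i)) + alp delta0 (e (t', x i.+1))) / 2
        * dgam eps ((th (t', x i.+1) - th (t', x i)) / h))
    + nu ^+ 2 * ((th (t', x i.+1) - th (t', x i)) / h)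
    - theta_flux T eps delta0 kappa nu eta tx (t', x i + h / 2)|
  <= (kappa * (M * M + (M ^+ 2 / 2 + delta0) * (2 / eps * M)) + nu ^+ 2 * M) * rate.
Proof.
move=> iK; have [_ _ _ r4] := rate_ge.
have s1 := slope_close rdt t'I iK (edge_mid i).
set D := (th (t', x i.+1) - th (t', x i)) / h in s1 *.
set y := x i + h / 2 in s1 *.
have xi := node_in h0 Kh (ltnW iK); have xi' := node_in h0 Kh iK.
have yI : 0 <= y <= 1 := half_node_in h0 Kh iK.
have dist z : 0 <= z <= 1 -> `|z - y| <= h -> `|alp delta0 (e (t', z)) - alp delta0 (e (t', y))| <= M * M * h.
  move=> zI zy; apply: le_trans (alp_lipschitz (rd_u rde _) (rd_u rde _)) _.
  rewrite -mulrA ler_wpM2l //; apply: le_trans (rd_u_lip rde t'I yI zI) _.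
  by rewrite ler_wpM2l.
have h1 := h0.
have d1 : `|alp delta0 (e (t', x i)) - alp delta0 (e (t', y))| <= M * M * h.
  apply: dist => //; rewrite /y (_ : _ - _ = - (h / 2)); last by ring.
  by rewrite normrN ger0_norm; lra.
have d2 : `|alp delta0 (e (t', x i.+1)) - alp delta0 (e (t', y))| <= M * M * h.
  apply: dist => //; rewrite /y /x nodeS (_ : _ - _ = h / 2); last by field.
  by rewrite ger0_norm; lra.
set At := (_ + _) / 2.
have d3 : `|At - alp delta0 (e (t', y))| <= M * M * h.
  rewrite (_ : _ - _ = ((alp delta0 (e (t', x i)) - alp delta0 (e (t', y)))
    + (alp delta0 (e (t', x i.+1)) - alp delta0 (e (t', y)))) / 2); last by rewrite /At; field.
  rewrite normrM normfV (ger0_norm (x := 2)) // ler_pdivrMr //.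
  by apply: le_trans (ler_normD _ _) _; lra.
have alpM : `|alp delta0 (e (t', y))| <= M ^+ 2 / 2 + delta0.
  rewrite /alp ger0_norm; last by rewrite addr_ge0 // divr_ge0 ?sqr_ge0.
  rewrite lerD2r ler_pM2r ?invr_gt0 //; apply: sqr_le_norm; exact: rd_u rde _.
rewrite /theta_flux -/e.
rewrite (_ : _ - _ = kappa * (At * dgam eps D - alp delta0 (e (t', y)) * dgam eps (tx (t', y)))
  + nu ^+ 2 * (D - tx (t', y))); last by ring.
apply: le_trans (ler_normD _ _) _; rewrite [leRHS]mulrDl; apply: lerD; last first.
  rewrite normrM ger0_norm ?sqr_ge0 // -mulrA ler_wpM2l ?sqr_ge0 //.
  by apply: le_trans s1 _; rewrite ler_wpM2l.
rewrite normrM (gtr0_norm kappa_gt0) -mulrA ler_pM2l //.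
apply: le_trans (norm_mulB _ _ _ _) _; rewrite [leRHS]mulrDl; apply: lerD.
  apply: (@le_trans _ _ (M * M * h * 1)).
    by apply: ler_pM => //; exact: dgam_norm_le1.
  by rewrite mulr1 ler_wpM2l // mulr_ge0.
rewrite -mulrA; apply: ler_pM => //.
apply: le_trans (dgam_lipschitz eps0 _ _) _.
rewrite -[leRHS]mulrA ler_wpM2l //; first by rewrite divr_ge0 // ltW.
by apply: le_trans s1 _; rewrite ler_wpM2l.
Qed.

End Residuals.

(** * The error estimate *)

Lemma flux_balance_mono (R : realType) (T B B' sigma : R) (F G : R * R -> R) :
  B <= B' -> flux_balance T B sigma F G -> flux_balance T B' sigma F G.
Proof.
move=> BB' bal t tI; have [F0 F1 b] := bal t tI; split => // x y x' x0 xy yx' x'1.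
apply: le_trans (b x y x' x0 xy yx' x'1) _.
have xx' : 0 <= x' - x by rewrite subr_ge0 (le_trans xy).
by rewrite ler_wpM2r // ler_wpM2r // addr_ge0 ?powR_ge0.
Qed.

Lemma edge_divZ (R : realType) K (a : R) (f : nat -> R) k :
  edge_div K (fun i => a * f i) k = a * edge_div K f k.
Proof. by rewrite /edge_div; case: ifP => _; [ring|case: ifP => _; ring]. Qed.

Section ErrorEstimate.
Context {R : realType}.
Variables (T eps delta0 c kappa0 kappa nu L sigma M B A C1 : R).
Variables (alpha0 eta theta et ex tt tx : R * R -> R).
Hypotheses (T0 : 0 < T) (eps0 : 0 < eps) (delta_gt0 : 0 < delta0).
Hypotheses (c0 : 0 < c) (kappa0_gt0 : 0 < kappa0) (kappa_gt0 : 0 < kappa).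
Hypotheses (nu_gt0 : 0 < nu) (L0 : 0 <= L) (sigma0 : 0 < sigma).
Hypothesis lip : lipschitz_with L (Qopen T) alpha0.
Hypothesis cont : {within Qbar T, continuous alpha0}.
Hypothesis inf_alpha0 : inf (alpha0 @` Qopen T) = delta0.
Hypothesis A_ge : forall p, `|alpha0 (clampQ T p)| <= A.
Hypothesis rde : regular_data T sigma M (eta \o clampQ T) et ex.
Hypothesis rdt : regular_data T sigma M (theta \o clampQ T) tt tx.
Hypothesis B0 : 0 <= B.
Hypothesis be : flux_balance T B sigma
  (eta_flux kappa0 ex) (eta_source T eps c kappa eta et tx).
Hypothesis bt : flux_balance T B sigma
  (theta_flux T eps delta0 kappa nu eta tx) (theta_source T alpha0 tt).

(** The share s is chosen below 1, with BB / s <= BB + c / 4 for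
BB = (kappa C1 / nu) ^+ 2; the growth of the energy then stays below
growth_rate. *)
Definition dissipation_share :=
  ((kappa * C1 / nu) ^+ 2 + 1) / ((kappa * C1 / nu) ^+ 2 + 1 + c / 4).

Definition growth_rate :=
  Num.max (2 * (kappa * C1 / nu) ^+ 2 - (2 * kappa * eps + c)) ((L + 1) / delta0).

Definition residual_constant :=
  (M + B + kappa * M * M) + kappa0 ^+ 2 * M + (A * M + B)
  + (kappa * (M * M + (M ^+ 2 / 2 + delta0) * (2 / eps * M)) + nu ^+ 2 * M).

Definition error_constant :=
  expR (4 * growth_rate * T)
  * (((2 * kappa0 ^+ 2)^-1 + 2 / c
      + ((2 * (1 - dissipation_share) * nu ^+ 2)^-1 + 1)) * residual_constant ^+ 2
     / growth_rate).

Let s := dissipation_share.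
Let a := growth_rate.
Let BB := (kappa * C1 / nu) ^+ 2.

Lemma dissipation_share_in : [/\ 0 < s, s < 1 & BB / s <= BB + c / 4].
Proof.
have b0 : 0 <= BB by exact: sqr_ge0.
have d0 : 0 < BB + 1 + c / 4 by have := c0; lra.
have n0 : 0 < BB + 1 by lra.
rewrite /s /dissipation_share -/BB; split.
- by rewrite divr_gt0.
- by rewrite ltr_pdivrMr // mul1r; have := c0; lra.
- rewrite invf_div mulrA ler_pdivrMr //.
  by have := mulr_ge0 b0 (ltW c0); have := c0; nra.
Qed.

Lemma growth_rate_ge : [/\ 0 < a, 2 * (BB / s) - 3 / 2 * c - 2 * kappa * eps <= a,
  delta0^-1 <= a & L / delta0 <= a].
Proof.
have [s0 s1 bs] := dissipation_share_in.
have a1 : 2 * BB - (2 * kappa * eps + c) <= a by rewrite /a /growth_rate le_max lexx.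
have a2 : (L + 1) / delta0 <= a by rewrite /a /growth_rate le_max lexx orbT.
have di : 0 < delta0^-1 by rewrite invr_gt0.
have Ld : 0 <= L / delta0 by rewrite mulr_ge0 // ltW.
rewrite mulrDl mul1r in a2.
by split; lra.
Qed.

Variables (K N : nat) (h dt : R) (H Theta : nat -> int -> R).
Hypotheses (K0 : (0 < K)%N) (h0 : 0 < h) (Kh : h * K%:R = 1).
Hypotheses (dt0 : 0 < dt) (Ndt : N%:R * dt = T) (adt : a * dt <= 1 / 2).
Hypothesis scheme : scheme_sol eps delta0 c kappa0 kappa nu alpha0 K N h dt H Theta.

Let e := eta \o clampQ T.
Let th := theta \o clampQ T.
Let a0 := alpha0 \o clampQ T.
Let x (k : nat) := k%:R * h.
Let t (j : nat) := j%:R * dt.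
Let E j (k : nat) := H j k%:Z - e (t j, x k).
Let F j (k : nat) := Theta j k%:Z - th (t j, x k).
Let rate := h `^ sigma + dt `^ sigma + dt + h + h ^+ 2.
Let r0 := residual_constant * rate.

Hypothesis E0 : forall k, (k <= K)%N -> E 0 k = 0.
Hypothesis F0 : forall k, (k <= K)%N -> F 0 k = 0.
Hypothesis HC : forall j k, (j <= N)%N -> (k <= K)%N -> `|H j k%:Z| <= C1.
Hypothesis eC : forall j k, (j <= N)%N -> (k <= K)%N -> `|e (t j, x k)| <= C1.

Let M0 : 0 <= M. Proof. exact: rd_ge0 rde. Qed.
Let A0 : 0 <= A. Proof. by apply: le_trans (A_ge (0, 0)). Qed.

Let rate0 : 0 <= rate.
Proof. by rewrite /rate !addr_ge0 ?powR_ge0 ?sqr_ge0 // ltW. Qed.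

Let tS j : t j.+1 = t j + dt. Proof. exact: nodeS. Qed.

Let t_ge0 j : 0 <= t j. Proof. by rewrite mulr_ge0 // ltW. Qed.

Let t_le j : (j <= N)%N -> t j <= T.
Proof. by move=> jN; rewrite -Ndt ler_wpM2r ?ler_nat // ltW. Qed.

Let xI k : (k <= K)%N -> 0 <= x k <= 1. Proof. exact: (node_in h0 Kh). Qed.

Let residual_parts : [/\ (M + B + kappa * M * M) * rate <= r0,
  kappa0 ^+ 2 * M * rate <= r0, (A * M + B) * rate <= r0 &
  (kappa * (M * M + (M ^+ 2 / 2 + delta0) * (2 / eps * M)) + nu ^+ 2 * M) * rate <= r0].
Proof.
have k1 : 0 <= kappa * M * M by rewrite !mulr_ge0 // ltW.
have k2 : 0 <= kappa0 ^+ 2 * M by rewrite mulr_ge0 // sqr_ge0.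
have k3 : 0 <= A * M by exact: mulr_ge0.
have k4 : 0 <= nu ^+ 2 * M by rewrite mulr_ge0 // sqr_ge0.
have k5 : 0 <= kappa * (M * M + (M ^+ 2 / 2 + delta0) * (2 / eps * M)).
  rewrite mulr_ge0 ?(ltW kappa_gt0) // addr_ge0 ?mulr_ge0 //.
    by rewrite addr_ge0 ?(ltW delta_gt0) // divr_ge0 ?sqr_ge0.
  by rewrite invr_ge0 ltW.
have b := B0; have m := M0.
by rewrite /r0 /residual_constant; split; rewrite ler_wpM2r //; lra.
Qed.

Let b j := h * trap K (fun k => E j k ^+ 2).
Let X j := h * trap K (fun k => a0 (t j, x k) * F j k ^+ 2).
Let Y j := h * edge_sum K (fun i => ((F j i.+1 - F j i) / h) ^+ 2).

Let ghost j : (j <= N)%N -> [/\ dcent h (H j) 0 = 0, dcent h (H j) K%:Z = 0,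
  dcent h (Theta j) 0 = 0 & dcent h (Theta j) K%:Z = 0].
Proof. by have [_ _] := scheme; apply. Qed.

Let eta_step j : (j < N)%N -> b j.+1 - b j <= dt * (s * nu ^+ 2 * Y j
  + (BB / s - 3 / 2 * c - 2 * kappa * eps) * b j.+1
  + ((2 * kappa0 ^+ 2)^-1 + 2 / c) * r0 ^+ 2).
Proof.
move=> jN; have [s0 s1 _] := dissipation_share_in.
have [p1 p2 _ _] := residual_parts.
have tT := t_le jN; rewrite tS in tT.
have [sch _ _] := scheme.
have [g1 g2 _ _] := ghost jN; have [_ _ g3 g4] := ghost (ltnW jN).
pose y k := e (t j.+1, x k).
pose f i := eta_flux kappa0 ex (t j + dt, x i + h / 2).
pose G i := gam eps (slope h (Theta j) i).
pose Gt i := gam eps ((th (t j, x i.+1) - th (t j, x i)) / h).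
apply: (@eta_energy_step _ K h dt kappa nu C1 s r0 K0 h0 dt0 Kh kappa_gt0 nu_gt0 s0
  c kappa0 eps (E j) (E j.+1) y
  (fun k => (e (t j + dt, x k) - e (t j, x k)) / dt - edge_div K f k / h
     + c * (e (t j + dt, x k) - 1) + kappa * e (t j + dt, x k) * edge_avg K Gt k)
  (fun i => kappa0 ^+ 2 * slope h (H j.+1) i - f i)
  (fun i => kappa0 ^+ 2 * ((y i.+1 - y i) / h) - f i)
  G Gt (fun i => (F j i.+1 - F j i) / h)) => //.
- move=> k kK; rewrite edge_div_lin edge_divZ.
  have := sch j k jN kK; rewrite (dsecond_edge K0 h0 kK g1 g2).
  rewrite (average_edge K0 h0 (@gam_even _ eps) kK g3 g4) -/(G _) => S.
  rewrite (_ : E j.+1 k - E j k = (H j.+1 k%:Z - H j k%:Z) - (e (t j + dt, x k) - e (t j, x k))); last first.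
    by rewrite /E tS; ring.
  rewrite mulrBl S /E /y tS -/(edge_avg K G k).
  ring.
- by move=> i iK; rewrite /slope /y /E; ring.
- by move=> i iK; exact: gam_ge.
- move=> i iK; apply: le_trans (gam_lipschitz eps0 _ _) _.
  by rewrite /slope /F -mulrBl opprD addrACA !opprD !opprK addrACA.
- by move=> k kK; exact: eC.
- move=> k kK; apply: le_trans p1.
  exact: (eta_residual eps0 kappa_gt0 B0 sigma0 K0 h0 Kh (t_ge0 j) dt0 tT rde rdt be kK).
- move=> i iK; apply: le_trans p2; rewrite /y tS.
  exact: (eta_flux_residual kappa0 h0 Kh (t_ge0 j) dt0 tT rde iK).
Qed.

Let clip_alpha0 j k : (j <= N)%N -> (k <= K)%N ->
  a0 (t j, x k) = alpha0 (t j, x k).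
Proof.
move=> jN kK; rewrite /a0 /= clampQ_id //.
by split; rewrite /= in_itv /= ?t_ge0 ?t_le // xI.
Qed.

Let a0_ge j k : (j <= N)%N -> (k <= K)%N -> delta0 <= a0 (t j, x k).
Proof.
move=> jN kK; apply: (inf_le_closure T0 cont inf_alpha0) => //; last exact: xI.
by rewrite t_ge0 t_le.
Qed.

Let theta_step j : (j < N)%N -> X j.+1 - X j <= dt * (L / delta0 * X j
  + delta0^-1 * X j.+1 + BB / s * b j.+1 - s * nu ^+ 2 * Y j.+1
  + ((2 * (1 - s) * nu ^+ 2)^-1 + 1) * r0 ^+ 2).
Proof.
move=> jN; have [s0 s1 _] := dissipation_share_in.
have [_ _ p3 p4] := residual_parts.
have tT := t_le jN; rewrite tS in tT.
have [_ sch _] := scheme.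
have [g1 g2 g3 g4] := ghost jN.
pose z k := th (t j.+1, x k).
pose y k := (H j.+1 k%:Z + e (t j.+1, x k)) / 2.
pose f i := theta_flux T eps delta0 kappa nu eta tx (t j + dt, x i + h / 2).
pose al := alp delta0.
pose Ai i := (al (H j.+1 i%:Z) + al (H j.+1 i.+1%:Z)) / 2.
pose At i := (al (e (t j + dt, x i)) + al (e (t j + dt, x i.+1))) / 2.
pose P i := dgam eps (slope h (Theta j.+1) i).
pose Pt i := dgam eps ((th (t j + dt, x i.+1) - th (t j + dt, x i)) / h).
have al_ge0 v : 0 <= al v.
  by rewrite /al /alp addr_ge0 ?(ltW delta_gt0) // divr_ge0 ?sqr_ge0.
apply: (@theta_energy_step _ K h dt kappa nu C1 s r0 K0 h0 dt0 Kh kappa_gt0 nu_gt0 s0 s1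
  delta0 L (fun k => a0 (t j, x k)) (fun k => a0 (t j.+1, x k))
  (F j) (F j.+1) (E j.+1) y
  (fun k => a0 (t j + dt, x k) * ((th (t j + dt, x k) - th (t j, x k)) / dt)
     - edge_div K f k / h)
  (fun i => kappa * (Ai i * P i) + nu ^+ 2 * slope h (Theta j.+1) i - f i)
  (fun i => kappa * (At i * Pt i)
     + nu ^+ 2 * ((th (t j + dt, x i.+1) - th (t j + dt, x i)) / h) - f i)
  Ai At P Pt) => //.
- move=> k kK; rewrite edge_div_lin.
  have gN v : derive1 (gam eps) (- v) = - derive1 (gam eps) v.
    by rewrite !derive1_gam // gam_even mulNr.
  have := sch j k jN kK; rewrite (dsecond_edge K0 h0 kK g3 g4).
  rewrite (flux_edge K0 h0 (alp delta0) gN kK g1 g2 g3 g4).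
  rewrite -[alpha0 _]clip_alpha0 // => S.
  have S2 : edge_div K (fun i => kappa * (Ai i * P i) + nu ^+ 2 * slope h (Theta j.+1) i) k
    = kappa * edge_div K (fun i => (alp delta0 (H j.+1 i) + alp delta0 (H j.+1 i.+1)) / 2
         * derive1 (gam eps) (slope h (Theta j.+1) i)) k
      + nu ^+ 2 * edge_div K (slope h (Theta j.+1)) k.
    rewrite -!edge_divZ -[RHS]opprK -[X in _ = - X]sub0r.
    rewrite /edge_div; have dE v : derive1 (gam eps) v = dgam eps v by rewrite derive1_gam.
    by case: ifP => _; [|case: ifP => _]; rewrite !dE /Ai /P /al; ring.
  rewrite S2.
  rewrite (_ : F j.+1 k - F j k = (Theta j.+1 k%:Z - Theta j k%:Z) - (th (t j + dt, x k) - th (t j, x k))); last first.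
    by rewrite /F tS; ring.
  rewrite mulrBl mulrBr S tS; move: (edge_div K _ k) (edge_div K _ k) => D1 D2.
  by field; rewrite !gt_eqF.
- by move=> i iK; rewrite /slope /F tS; ring.
- by move=> i iK; rewrite /Ai divr_ge0 // addr_ge0 ?al_ge0.
- move=> i iK; have := dgam_monotone eps0 (slope h (Theta j.+1) i)
    ((th (t j + dt, x i.+1) - th (t j + dt, x i)) / h).
  rewrite -/(P i) -/(Pt i); congr (0 <= _ * _).
  by rewrite /slope /F tS; ring.
- by move=> i iK; exact: dgam_norm_le1.
- by move=> i iK; rewrite /Ai /At /y /E /al /alp tS; field.
- move=> k kK; rewrite /y normrM normfV (ger0_norm (x := 2)) // ler_pdivrMr //.
  apply: le_trans (ler_normD _ _) _.
  by have := HC jN kK; have := eC jN kK; lra.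
- move=> k kK; apply: le_trans p3.
  exact: (theta_residual B0 sigma0 K0 h0 Kh (t_ge0 j) dt0 tT A_ge rde rdt bt kK).
- move=> i iK; apply: le_trans p4.
  exact: (theta_flux_residual nu eps0 kappa_gt0 (ltW delta_gt0) h0 Kh (t_ge0 j) dt0 tT rde rdt iK).
- by move=> k kK; apply: a0_ge => //; exact: ltnW.
- by move=> k kK; exact: a0_ge.
- move=> k kK.
  have tjI : 0 <= t j <= T by rewrite t_ge0 t_le // ltnW.
  have tjI' : 0 <= t j.+1 <= T by rewrite t_ge0 t_le.
  have := lipschitz_closure_t T0 lip cont L0 tjI tjI' (xI kK).
  rewrite -/a0 {2}tS (_ : t j + dt - t j = dt); last by ring.
  rewrite (gtr0_norm dt0) => /(le_trans (ler_norm _)); lra.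
Qed.

(** The energy |e_eta|^2 + |sqrt alpha0 e_theta|^2 + s nu^2 dt |D e_theta|^2 vanishes
initially, and by the two one-step inequalities it satisfies the recursion of
discrete_gronwall: the slopes at the old and at the new time level telescope. *)
Lemma error_energy_bound j : (j <= N)%N ->
  b j <= error_constant * rate ^+ 2 /\
  h * trap K (fun k => F j k ^+ 2) <= error_constant / delta0 * rate ^+ 2.
Proof.
have [s0 s1 _] := dissipation_share_in.
have [a_gt0 a1 a2 a3] := growth_rate_ge.
pose rho := ((2 * kappa0 ^+ 2)^-1 + 2 / c
      + ((2 * (1 - s) * nu ^+ 2)^-1 + 1)) * r0 ^+ 2.
pose Z i := if (i <= N)%N then b i + X i + s * nu ^+ 2 * dt * Y i else 0.
have snu : 0 <= s * nu ^+ 2 by rewrite mulr_ge0 ?sqr_ge0 // ltW.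
have b_ge0 i : 0 <= b i.
  by rewrite mulr_ge0 ?(ltW h0) // trap_ge0 // => k _; exact: sqr_ge0.
have X_ge0 i : (i <= N)%N -> 0 <= X i.
  move=> iN; rewrite mulr_ge0 ?(ltW h0) // trap_ge0 // => k kK.
  by rewrite mulr_ge0 ?sqr_ge0 // (le_trans (ltW delta_gt0)) // a0_ge.
have Y_ge0 i : 0 <= Y i.
  by rewrite mulr_ge0 ?(ltW h0) // edge_sum_ge0 // => k _; exact: sqr_ge0.
have rho0 : 0 <= rho.
  rewrite /rho mulr_ge0 ?sqr_ge0 // !addr_ge0 ?divr_ge0 ?invr_ge0 ?mulr_ge0 ?sqr_ge0 //;
  by [exact: ltW|rewrite subr_ge0 ltW].
have Z0 : Z 0%N = 0.
  have -> : Z 0%N = b 0%N + X 0%N + s * nu ^+ 2 * dt * Y 0%N by [].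
  rewrite /b /X /Y (@trap_eq _ _ _ (fun=> 0 * 0)) => [|k kK]; last by rewrite E0 // expr0n mul0r.
  rewrite trapZ (@trap_eq _ _ (fun k => _ * F 0 k ^+ 2) (fun=> 0 * 0)) => [|k kK]; last first.
    by rewrite F0 // expr0n mulr0 mul0r.
  rewrite trapZ (@edge_sum_eq _ _ _ (fun=> 0 * 0)) => [|i iK]; last first.
    by rewrite !F0 // ?(ltnW iK) // subrr mul0r expr0n mul0r.
  by rewrite edge_sumZ; ring.
have Zge i : 0 <= Z i.
  rewrite /Z; case: ifP => // iN.
  by rewrite !addr_ge0 ?X_ge0 // mulr_ge0 // mulr_ge0 // ltW.
have step i : (i < N)%N -> Z i.+1 - Z i <= dt * (a * Z i.+1 + a * Z i + rho).
  move=> iN; have e1 := eta_step iN; have e2 := theta_step iN.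
  rewrite /Z iN (ltnW iN).
  have x0 := X_ge0 i (ltnW iN); have x1 := X_ge0 i.+1 iN.
  have y0 := Y_ge0 i; have y1 := Y_ge0 i.+1; have b0 := b_ge0 i; have b1 := b_ge0 i.+1.
  have dt_ge0 := ltW dt0.
  have q1 : (2 * (BB / s) - 3 / 2 * c - 2 * kappa * eps) * b i.+1 <= a * b i.+1.
    by rewrite ler_wpM2r.
  have q2 : delta0^-1 * X i.+1 <= a * X i.+1 by rewrite ler_wpM2r.
  have q3 : L / delta0 * X i <= a * X i by rewrite ler_wpM2r.
  have q4 : 0 <= a * b i by rewrite mulr_ge0 // ltW.
  have q5 : 0 <= a * (s * nu ^+ 2 * dt * Y i).
    by rewrite mulr_ge0 ?(ltW a_gt0) // mulr_ge0 // mulr_ge0.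
  have q6 : 0 <= a * (s * nu ^+ 2 * dt * Y i.+1).
    by rewrite mulr_ge0 ?(ltW a_gt0) // mulr_ge0 // mulr_ge0.
  have main : dt * ((2 * (BB / s) - 3 / 2 * c - 2 * kappa * eps) * b i.+1
      + delta0^-1 * X i.+1 + L / delta0 * X i + rho)
    <= dt * (a * (b i.+1 + X i.+1 + s * nu ^+ 2 * dt * Y i.+1)
      + a * (b i + X i + s * nu ^+ 2 * dt * Y i) + rho).
    by rewrite ler_wpM2l // lerD2r; lra.
  apply: le_trans main.
  have -> : dt * ((2 * (BB / s) - 3 / 2 * c - 2 * kappa * eps) * b i.+1
      + delta0^-1 * X i.+1 + L / delta0 * X i + rho)
   = dt * (s * nu ^+ 2 * Y i
       + (BB / s - 3 / 2 * c - 2 * kappa * eps) * b i.+1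
       + ((2 * kappa0 ^+ 2)^-1 + 2 / c) * r0 ^+ 2)
   + dt * (L / delta0 * X i + delta0^-1 * X i.+1 + BB / s * b i.+1
       - s * nu ^+ 2 * Y i.+1 + ((2 * (1 - s) * nu ^+ 2)^-1 + 1) * r0 ^+ 2)
   + (s * nu ^+ 2 * dt * Y i.+1 - s * nu ^+ 2 * dt * Y i).
    by rewrite /rho; ring.
  have -> : b i.+1 + X i.+1 + s * nu ^+ 2 * dt * Y i.+1 -
    (b i + X i + s * nu ^+ 2 * dt * Y i) = (b i.+1 - b i) + (X i.+1 - X i)
    + (s * nu ^+ 2 * dt * Y i.+1 - s * nu ^+ 2 * dt * Y i) by ring.
  by rewrite lerD2r lerD.
move=> jN.
have := discrete_gronwall a_gt0 dt0 adt rho0 Z0 Zge step jN.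
rewrite Ndt /Z jN => G.
have cE : expR (4 * a * T) * (rho / a) = error_constant * rate ^+ 2.
  by rewrite /error_constant -/a -/s /rho /r0; ring.
rewrite cE in G.
have xj := X_ge0 j jN; have bj := b_ge0 j.
have yj : 0 <= s * nu ^+ 2 * dt * Y j by rewrite mulr_ge0 // mulr_ge0 // ltW.
split; first by lra.
rewrite mulrAC ler_pdivlMr //; apply: (@le_trans _ _ (X j)); last by lra.
rewrite /X -mulrA ler_pM2l // mulrC -trapZ; apply: trap_le => k kK.
by rewrite ler_wpM2r ?sqr_ge0 // a0_ge.
Qed.

End ErrorEstimate.

Lemma grid_index_range (k K : nat) (z : int) : (k <= K)%N -> z = k%:Z ->
  (-1 <= z <= K%:Z + 1)%R.
Proof. move=> kK ->; apply/andP; split; lia. Qed.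

Lemma refl_ext_inside (R : realType) (u : R * R -> R) (t x : R) :
  0 <= x <= 1 -> refl_ext u (t, x) = u (t, x).
Proof. by case/andP=> x0 x1; rewrite /refl_ext /= ltNge x0 x1. Qed.

Lemma L2d_err_le (R : realType) (K : nat) (h Q rate : R) (f : int -> R) :
  (0 < K)%N -> 0 <= rate ->
  h * trap K (fun k => f k%:Z ^+ 2) <= Q * rate ^+ 2 ->
  L2d K h f <= Num.sqrt Q * rate.
Proof.
move=> K0 rate0 fQ; rewrite /L2d trapsumE //.
rewrite (@trap_eq _ _ _ (fun k => h * f k%:Z ^+ 2)) => [|k _]; last first.
  by rewrite real_normK ?num_real // mulrC.
rewrite trapZ; apply: le_trans (ler_wsqrtr fQ) _.
by rewrite mulrC sqrtrM ?sqr_ge0 // sqrtr_sqr ger0_norm // mulrC.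
Qed.

Unset Implicit Arguments.
Set Strict Implicit.
Set Printing Implicit Defensive.

Theorem theorem2 (R : realType)
  (T eps delta0 c kappa0 kappa nu Lalpha0 : R)
  (alpha0 : R * R -> R) (eta0 theta0 : R -> R) (eta theta : R * R -> R)
  (sigma C1 : R)
  (hT : 0 < T)
  (heps : 0 < eps < 1) (hdelta0 : 0 < delta0 < 1)
  (hc : 0 < c) (hkappa0 : 0 < kappa0) (hkappa : 0 < kappa) (hnu : 0 < nu)
  (hLalpha0 : 0 <= Lalpha0)
  (halpha0_lip : lipschitz_with Lalpha0 (Qopen T) alpha0)
  (halpha0_cont : {within Qbar T, continuous alpha0})
  (halpha0_inf : inf (alpha0 @` Qopen T) = delta0)
  (heta0 : H1 eta0) (htheta0 : H1 theta0)
  (heta0_01 : {ae @lebesgue_measure R, forall x, Omega x -> 0 <= eta0 x <= 1})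
  (hsol : solution_S T eps delta0 c kappa0 kappa nu alpha0 eta0 theta0 eta theta)
  (heta_reg : regular_Qbar T eta) (htheta_reg : regular_Qbar T theta)
  (hsigma : 0 < sigma < 1)
  (heta_t : hoelder_continuous sigma (Qopen T) (pd 1 0 eta))
  (heta_xx : hoelder_continuous sigma (Qopen T) (pd 0 2 eta))
  (htheta_t : hoelder_continuous sigma (Qopen T) (pd 1 0 theta))
  (htheta_xx : hoelder_continuous sigma (Qopen T) (pd 0 2 theta)) :
  let a := Num.max (2 * (kappa * C1 / nu) ^+ 2 - (2 * kappa * eps + c))
                   ((Lalpha0 + 1) / delta0) in
  exists C : R,
    forall (K N : nat) (H Theta : nat -> int -> R),
      (0 < K)%N -> (0 < N)%N ->
      let dx : R := 1 / K%:R in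
      let dt : R := T / N%:R in
      scheme_sol eps delta0 c kappa0 kappa nu alpha0 K N dx dt H Theta ->
      (forall k : int, (-1 <= k <= K%:Z + 1)%R ->
         H 0%N k = refl_ext eta (0, k%:~R * dx) /\
         Theta 0%N k = refl_ext theta (0, k%:~R * dx)) ->
      (forall j k : nat, (j <= N)%N -> (k <= K)%N ->
         Num.max `|H j k%:Z| `|eta (j%:R * dt, k%:R * dx)| <= C1) ->
      dt < nu ^+ 2 * eps ^+ 2 / (4 * kappa ^+ 2 * delta0 * (delta0 + 1 / 2) ^+ 2)
           * dx ^+ 2 ->
      dt < 1 / (3 * a) ->
      forall j : nat, (1 <= j <= N)%N ->
        L2d K dx (err eta dx dt H j)
          <= C * (dx `^ sigma + dt `^ sigma + dt + dx + dx ^+ 2) /\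
        L2d K dx (err theta dx dt Theta j)
          <= C * (dx `^ sigma + dt `^ sigma + dt + dx + dx ^+ 2).
Proof.
move=> a.
have /andP[eps0 _] := heps; have /andP[delta_gt0 _] := hdelta0.
have /andP[sigma0 _] := hsigma.
have [M1 [et [ex rde1]]] := regular_data_exists hT sigma0 heta_reg heta_t.
have [M2 [tt [tx rdt2]]] := regular_data_exists hT sigma0 htheta_reg htheta_t.
pose M := Num.max M1 M2.
have rde : regular_data T sigma M (eta \o clampQ T) et ex.
  by apply: regular_data_mono rde1; rewrite le_max lexx.
have rdt : regular_data T sigma M (theta \o clampQ T) tt tx.
  by apply: regular_data_mono rdt2; rewrite le_max lexx orbT.
have [B1 B10 be1] := eta_flux_balance hT eps0 sigma0 hsol rde rdt.
have [B2 B20 bt2] := theta_flux_balance hT eps0 sigma0 hLalpha0 halpha0_lip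
  halpha0_cont hsol rde rdt.
pose B := Num.max B1 B2.
have B0 : 0 <= B by rewrite le_max B10.
have be : flux_balance T B sigma (eta_flux kappa0 ex) (eta_source T eps c kappa eta et tx).
  by apply: flux_balance_mono be1; rewrite le_max lexx.
have bt : flux_balance T B sigma (theta_flux T eps delta0 kappa nu eta tx)
    (theta_source T alpha0 tt).
  by apply: flux_balance_mono bt2; rewrite le_max lexx orbT.
have [A _ A_ge] := comp_clampQ_bounded hT halpha0_cont.
pose Q := error_constant T eps delta0 c kappa0 kappa nu Lalpha0 M B A C1.
exists (Num.sqrt Q + Num.sqrt (Q / delta0)) => K N H Theta K0 N0 dx dt scheme init bound _ dta.
have KR : 0 < K%:R :> R by rewrite ltr0n.
have NR : 0 < N%:R :> R by rewrite ltr0n.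
have h0 : 0 < dx by rewrite /dx divr_gt0.
have Kh : dx * K%:R = 1 by rewrite /dx divfK // gt_eqF.
have dt0 : 0 < dt by rewrite /dt divr_gt0.
have Ndt : N%:R * dt = T by rewrite /dt mulrC divfK // gt_eqF.
have a_gt0 : 0 < a.
  by have [] := growth_rate_ge eps kappa nu C1 delta_gt0 hc hLalpha0.
have adt : a * dt <= 1 / 2.
  move: dta; rewrite ltr_pdivlMr ?mulr_gt0 // => dta.
  by move: (a * dt) (mulrC a dt) => m; lra.
have inQ j k : (j <= N)%N -> (k <= K)%N -> Qbar T (j%:R * dt, k%:R * dx).
  move=> jN kK; split; rewrite /= in_itv /=.
    by rewrite mulr_ge0 ?(ltW dt0) //= -[leRHS]Ndt ler_wpM2r ?ler_nat // ltW.
  exact: (node_in h0 Kh kK).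
have errE u U j k : (j <= N)%N -> (k <= K)%N ->
    err u dx dt U j k%:Z = U j k%:Z - (u \o clampQ T) (j%:R * dt, k%:R * dx).
  move=> jN kK; rewrite /err -pmulrn refl_ext_inside; last exact: (node_in h0 Kh kK).
  by rewrite /= clampQ_id //; exact: inQ.
have init0 k : (k <= K)%N -> H 0%N k%:Z - (eta \o clampQ T) (0%:R * dt, k%:R * dx) = 0 /\
    Theta 0%N k%:Z - (theta \o clampQ T) (0%:R * dt, k%:R * dx) = 0.
  move=> kK; have [h1 h2] := init k%:Z (grid_index_range kK erefl).
  rewrite -!errE // /err mul0r h1 h2; split; exact: subrr.
have bounds j k : (j <= N)%N -> (k <= K)%N -> `|H j k%:Z| <= C1 /\
    `|(eta \o clampQ T) (j%:R * dt, k%:R * dx)| <= C1.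
  move=> jN kK; have := bound j k jN kK; rewrite ge_max => /andP[h1 h2].
  by rewrite /= clampQ_id //; exact: inQ.
move=> j /andP[_ jN].
have [bE bF] := error_energy_bound hT eps0 delta_gt0 hc hkappa0 hkappa hnu hLalpha0
  sigma0 halpha0_lip halpha0_cont halpha0_inf A_ge rde rdt B0 be bt K0 h0 Kh dt0 Ndt
  adt scheme (fun k kK => (init0 k kK).1) (fun k kK => (init0 k kK).2)
  (fun j k jN kK => (bounds j k jN kK).1) (fun j k jN kK => (bounds j k jN kK).2) jN.
set rate := _ + dx ^+ 2 in bE bF *.
have rate0 : 0 <= rate by rewrite /rate !addr_ge0 ?powR_ge0 ?sqr_ge0 // ltW.
have q1 := sqrtr_ge0 Q; have q2 := sqrtr_ge0 (Q / delta0).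
split.
- apply: (@le_trans _ _ (Num.sqrt Q * rate)); last by rewrite ler_wpM2r //; lra.
  apply: L2d_err_le => //.
  rewrite (@trap_eq _ _ _ (fun k => (H j k%:Z - (eta \o clampQ T) (j%:R * dt, k%:R * dx)) ^+ 2)) //.
  by move=> k kK; rewrite errE.
- apply: (@le_trans _ _ (Num.sqrt (Q / delta0) * rate)); last by rewrite ler_wpM2r //; lra.
  apply: L2d_err_le => //.
  rewrite (@trap_eq _ _ _ (fun k => (Theta j k%:Z - (theta \o clampQ T) (j%:R * dt, k%:R * dx)) ^+ 2)) //.
  by move=> k kK; rewrite errE.
Qed.
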